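(* There is a functor $\mathsf{A}:\mathbf{Fell}\to\mathbf{C^*}$ given by $$\mathsf{A}(\rho',\beta,\phi,\rho)=(\mathcal{C}^{\rho'}_{\mathsf r},\ \beta^{\rho'}_{\rho_\phi}\circ\phi^\rho_{\mathsf r},\ \mathcal{C}^\rho_{\mathsf r}),$$ where $\phi^\rho_{\mathsf r}$ denotes the restriction of the pullback-section map $\phi^\rho$ to $\mathcal{C}^\rho_{\mathsf r}$.
   Context: Groupoids. For a groupoid $\Gamma$, $\mathsf{s}(\gamma)=\gamma^{-1}\gamma$, $\mathsf{r}(\gamma)=\gamma\gamma^{-1}$, $\Gamma^0\subseteq\Gamma$ is the set of units, and $\Gamma^2$ is the set of composable pairs ($(\alpha,\beta)\in\Gamma^2$ iff $\mathsf{s}(\alpha)=\mathsf{r}(\beta)$). For $x\in\Gamma^0$, $\Gamma x=\{\gamma:\mathsf{s}(\gamma)=x\}$. An étale groupoid is a groupoid with a topology making product and inverse continuous and such that $\mathsf{s}$ is an open map. No Hausdorff, local compactness or countability assumption is made, even on $\Gamma^0$. A slice is a subset on which $\mathsf{s}$ and $\mathsf{r}$ are injective. A subset $K\subseteq\Gamma$ is biclosed if $\mathsf{s}[K]$ and $\mathsf{r}[K]$ are closed in $\Gamma^0$; it is bicompact if it is a biclosed compact subset of an open slice. A subgroupoid $\Delta$ of an étale groupoid $\Gamma$ is nice if it is open and every compact closed subset of $\Delta^0$ is closed in $\Gamma^0$. Fell bundles. A semigroupoid is a set with a partial binary operation such that $(ab)c$ is defined iff $a(bc)$ is, in which case they are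 equal; a *-semigroupoid also has an involution with $a^{**}=a$ and $(ab)^*=b^*a^*$ whenever $ab$ is defined. A Banach bundle is an open continuous surjection $\rho:B\twoheadrightarrow X$ of topological spaces such that each fibre $B_x=\rho^{-1}\{x\}$ is a complex Banach space (zero $0_x$); for each $\lambda\in\mathbb{C}$, $b\mapsto\lambda b$ is continuous on $B$; addition is continuous on $\{(a,b):\rho(a)=\rho(b)\}$; the norm is upper semicontinuous on $B$; and $\rho(b_\lambda)\to x$, $\|b_\lambda\|\to0$ imply $b_\lambda\to0_x$ for nets. A Fell bundle is a Banach bundle $\rho:B\twoheadrightarrow\Gamma$ such that: (1) $B$ is a *-semigroupoid with continuous product and involution, products are bilinear and $*$ is antilinear; (2) the norm is submultiplicative, $\Gamma$ is an étale groupoid, $ab$ is defined iff $(\rho(a),\rho(b))\in\Gamma^2$, in which case $\rho(ab)=\rho(a)\rho(b)$, and $\rho(a^* )=\rho(a)^{-1}$; (3) for all $b\in B$, $\|b^*b\|=\|b\|^2$ and there is $a\in B_{\rho(b^*b)}$ with $a^*a=b^*b$. Sections. For a Fell bundle $\rho:B\twoheadrightarrow\Gamma$, $\mathcal{S}^\rho$ is the vector space (pointwise operations) of all, possibly discontinuous, sections $a:\Gamma\to B$, $\rho\circ a=\mathrm{id}_\Gamma$. Put $\mathrm{supp}(a)=\{\gamma:a(\gamma)\ne0_\gamma\}$ and $a^*(\gamma)=a(\gamma^{-1})^*$. The convolution $ab(\gamma)=\sum_{\gamma=\alpha\beta}a(\alpha)b(\beta)$ is ''defined'' if for every $\gamma\in\Gamma$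 the net of finite partial sums converges in norm in $B_\gamma$. $\mathcal{F}^\rho$ denotes the finitely supported sections. Define $[0,\infty]$-valued norms by $$\|a\|_2=\sup_{x\in\Gamma^0}\ \sup_{F\subseteq\Gamma x\text{ finite}}\Big\|\sum_{\gamma\in F}a(\gamma)^*a(\gamma)\Big\|^{1/2},\qquad \|a\|_{\mathsf b}=\sup_{f\in\mathcal{F}^\rho}\frac{\|af\|_2}{\|f\|_2}\quad(0/0=0).$$ $\mathcal{B}^\rho=\{a\in\mathcal{S}^\rho:\|a\|_{\mathsf b}<\infty,\ a^*a\text{ and }aa^*\text{ are defined}\}$ is a C*-algebra with convolution, $*$ and norm $\|\cdot\|_{\mathsf b}$. For $Y\subseteq\Gamma$, $\mathcal{C}^\rho(Y)$ is the set of $a\in\mathcal{S}^\rho$ with $\mathrm{supp}(a)\subseteq Y$ that are, as functions on $\Gamma$, continuous at every point of $Y$. The reduced C*-algebra $\mathcal{C}^\rho_{\mathsf r}\subseteq\mathcal{B}^\rho$ is the $\|\cdot\|_{\mathsf b}$-closure of $\mathcal{C}^\rho_{\mathsf c}=\mathrm{span}\{a\in\mathcal{C}^\rho(K):K\subseteq\Gamma\text{ bicompact}\}$. Étale morphisms and pullbacks. A functor $\phi:\Delta\to\Gamma$ of groupoids is star-bijective if whenever $x\in\Delta^0$, $\gamma\in\Gamma$ and $\phi(x)=\mathsf{s}(\gamma)$, there is precisely one $\delta\in\Delta$ with $\mathsf{s}(\delta)=x$ and $\phi(\delta)=\gamma$. An étale morphism is a proper (preimages of compact sets are compact) continuous star-bijective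 functor between étale groupoids. Given a Fell bundle $\rho:B\twoheadrightarrow\Gamma$ and an étale morphism $\phi:\Delta\to\Gamma$, the pullback bundle is the Fell bundle $\rho_\phi:\phi^\rho B\twoheadrightarrow\Delta$, where $\phi^\rho B=\{(\delta,b)\in\Delta\times B:\phi(\delta)=\rho(b)\}$ has the subspace topology, $\rho_\phi(\delta,b)=\delta$, $\lambda(\delta,b)=(\delta,\lambda b)$, $(\delta,a)+(\delta,b)=(\delta,a+b)$, $(\delta,a)(\epsilon,b)=(\delta\epsilon,ab)$, $(\delta,b)^*=(\delta^{-1},b^* )$, $\|(\delta,b)\|=\|b\|$. The pullback-section map $\phi^\rho:\mathcal{S}^\rho\to\mathcal{S}^{\rho_\phi}$ is $\phi^\rho(a)(\delta)=(\delta,a(\phi(\delta)))$. Fibre morphisms. Let $\sigma:C\twoheadrightarrow\Delta$ and $\rho':B'\twoheadrightarrow\Gamma'$ be Fell bundles with $\Delta$ a nice subgroupoid of $\Gamma'$. A fibre morphism from $\sigma$ to $\rho'$ is a continuous map $\beta:C\to B'$ with $\rho'\circ\beta=\sigma$, $\beta(a^* )=\beta(a)^*$, $\beta(ab)=\beta(a)\beta(b)$ whenever $ab$ is defined, and $\beta$ linear on each fibre. It induces $\beta^{\rho'}_\sigma:\mathcal{S}^\sigma\to\mathcal{S}^{\rho'}$, $\beta^{\rho'}_\sigma(a)(\gamma')=\beta(a(\gamma'))$ for $\gamma'\in\Delta$ and $0_{\gamma'}$ for $\gamma'\in\Gamma'\setminus\Delta$. The category $\mathbf{Fell}$. Its elements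 (morphisms) are quadruples $(\rho',\beta,\phi,\rho)$ where $\rho:B\twoheadrightarrow\Gamma$ and $\rho':B'\twoheadrightarrow\Gamma'$ are Fell bundles, $\phi$ is an étale morphism from a nice subgroupoid of $\Gamma'$ to $\Gamma$, and $\beta$ is a fibre morphism from $\rho_\phi$ to $\rho'$. The product is $(\rho'',\beta',\phi',\rho')(\rho',\beta,\phi,\rho)=(\rho'',\beta'\bullet\beta,\phi\circ\phi',\rho)$, where $\phi\circ\phi'$ has domain $\phi'^{-1}[\mathrm{dom}(\phi)]$ and $(\beta'\bullet\beta)(\gamma'',b)=\beta'(\gamma'',\beta(\phi'(\gamma''),b))$. The units are $(\rho,\mathsf{p}_B,\mathrm{id}_\Gamma,\rho)$ with $\mathsf{p}_B(\gamma,b)=b$. The category $\mathbf{C^*}$. Its elements are triples $(A',\pi,A)$ with $A,A'$ C*-algebras and $\pi:A\to A'$ a *-homomorphism, with product $(A'',\pi',A')(A',\pi,A)=(A'',\pi'\circ\pi,A)$ and units $(A,\mathrm{id}_A,A)$. A functor is a map that sends units to units and preserves products: whenever $ab$ is defined, $\mathsf{A}(a)\mathsf{A}(b)$ is defined and equals $\mathsf{A}(ab)$.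
   Formalization: The product of (ρ'',β',φ',ρ') and (ρ',β,φ,ρ) is taken as defined only when the composite lies in Fell, i.e. when φ'^{-1}[dom(φ)] is nice; with the stated definitions this preimage need not be nice, so the product as written can fall outside Fell. *)

(* Defs.v *)
From HB Require Import structures.
From mathcomp Require Import all_boot all_order all_algebra complex finmap.
From mathcomp Require Import all_classical all_reals all_analysis summability.

Set Implicit Arguments.
Unset Strict Implicit.
Unset Printing Implicit Defensive.

Import Order.TTheory GRing.Theory Num.Theory.
Import numFieldNormedType.Exports.
Local Open Scope classical_set_scope.
Local Open Scope ring_scope.

(* A partial function is given by its graph; this is continuity on its domain
   of definition, with the subspace topology. *)
Definition pfun_continuous (X Y : topologicalType) (f : X -> Y -> Prop) :=
  forall x y, f x y -> forall W, nbhs y W ->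
    \forall x' \near x, forall y', f x' y' -> W y'.

Definition open_map (X Y : topologicalType) (f : X -> Y) :=
  forall U, open U -> open (f @` U).

Definition closed_in (X : topologicalType) (Y A : set X) :=
  exists2 C, closed C & A = Y `&` C.

(** Etale groupoids *)

(* [gmul a b] is [None] when the product is undefined.  The openness of the
   source map is meant for [gsrc] as a map from the groupoid to itself, so that
   the unit space is open. *)
Record etaleGroupoid := EtaleGroupoid {
  gcar :> topologicalType ;
  gmul : gcar -> gcar -> option gcar ;
  ginv : gcar -> gcar ;
  gsrc : gcar -> gcar ;
  grng : gcar -> gcar ;
  gmul_def : forall a b, isSome (gmul a b) <-> gsrc a = grng b ;
  gmulA : forall a b c,
    obind (gmul^~ c) (gmul a b) = obind (gmul a) (gmul b c) ;
  gmulVg : forall a, gmul (ginv a) a = Some (gsrc a) ;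
  gmulgV : forall a, gmul a (ginv a) = Some (grng a) ;
  gmulgs : forall a, gmul a (gsrc a) = Some a ;
  gmulrg : forall a, gmul (grng a) a = Some a ;
  gmul_continuous : pfun_continuous (fun p c => gmul p.1 p.2 = Some c) ;
  ginv_continuous : continuous ginv ;
  gsrc_open : open_map gsrc }.

Definition gunit (G : etaleGroupoid) : set G := [set x | gsrc x = x].

Definition slice (G : etaleGroupoid) (A : set G) :=
  {in A &, injective (@gsrc G)} /\ {in A &, injective (@grng G)}.

Definition biclosed (G : etaleGroupoid) (K : set G) :=
  closed_in (@gunit G) (@gsrc G @` K) /\ closed_in (@gunit G) (@grng G @` K).

Definition bicompact (G : etaleGroupoid) (K : set G) :=
  [/\ biclosed K, compact K & exists O, [/\ open O, slice O & K `<=` O]].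

Section groupoid_theory.
Context (G : etaleGroupoid).
Implicit Types a b c : G.

Lemma gmul_src a b c : gmul a b = Some c -> gsrc c = gsrc b.
Proof.
move=> ab; have := gmulA a b (gsrc b); rewrite ab gmulgs /= ab => cb.
have /gmul_def -> : isSome (gmul c (gsrc b)) by rewrite cb.
by apply/esym/gmul_def; rewrite gmulgs.
Qed.

Lemma gmul_rng a b c : gmul a b = Some c -> grng c = grng a.
Proof.
move=> ab; have := gmulA (grng a) a b; rewrite ab gmulrg /= ab => ac.
have /gmul_def <- : isSome (gmul (grng a) c) by rewrite -ac.
by apply/gmul_def; rewrite gmulrg.
Qed.

Lemma gsrcV a : gsrc (ginv a) = grng a.
Proof. by apply/gmul_def; rewrite gmulVg. Qed.

Lemma grngV a : grng (ginv a) = gsrc a.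
Proof. by apply/esym/gmul_def; rewrite gmulgV. Qed.

Lemma grng_src a : grng (gsrc a) = gsrc a.
Proof. by apply/esym/gmul_def; rewrite gmulgs. Qed.

Lemma gsrc_rng a : gsrc (grng a) = grng a.
Proof. by apply/gmul_def; rewrite gmulrg. Qed.

Lemma gsrc_src a : gsrc (gsrc a) = gsrc a.
Proof. by rewrite -[in RHS](gmul_src (gmulVg a)). Qed.

Lemma ginv_uniq a b : gmul b a = Some (gsrc a) -> b = ginv a.
Proof.
move=> ba; have := gmulA b a (ginv a); rewrite ba gmulgV /=.
have /gmul_def <- : isSome (gmul b a) by rewrite ba.
by rewrite -grngV gmulrg gmulgs => -[].
Qed.

Lemma ginvK : involutive (@ginv G).
Proof.
by move=> a; apply/esym/ginv_uniq; rewrite gmulgV gsrcV.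
Qed.

Lemma gmulVsrc a : gmul (ginv (gsrc a)) (gsrc a) = Some (gsrc a).
Proof. by rewrite gmulVg gsrc_src. Qed.

End groupoid_theory.

Record is_subgroupoid (G : etaleGroupoid) (D : set G) : Prop := IsSubgroupoid {
  subgpd_inv : forall a, D a -> D (ginv a) ;
  subgpd_mul : forall a b c, D a -> D b -> gmul a b = Some c -> D c }.

(* The units of a subgroupoid [D] are [D `&` gunit]. *)
Record niceSubgroupoid (G : etaleGroupoid) := NiceSubgroupoid {
  nset :> set G ;
  nset_subgpd : is_subgroupoid nset ;
  nset_open : open nset ;
  nset_closed : forall K, compact K -> closed_in (nset `&` @gunit G) K ->
    closed_in (@gunit G) K }.

Definition sub_elt (T : Type) (A : set T) (x : T) (Ax : A x) : A :=
  exist _ x (mem_set Ax).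

Section set_type_topology.
Context {T : topologicalType} (D : set T).

Lemma nbhs_set_type (x : D) (U : set D) :
  nbhs x U <-> exists2 V, nbhs (set_val x) V & set_val @^-1` V `<=` U.
Proof.
rewrite [nbhs x]nbhsE; split=> [[_ [[W oW <-] Wx] BU]|[V]].
  by exists W; [exact: open_nbhs_nbhs|exact: BU].
rewrite nbhsE => -[W [oW Wx] WV] VU; exists (set_val @^-1` W).
  by split => //; exists W.
by move=> y /WV /VU.
Qed.

Lemma set_val_continuous : continuous (set_val : D -> T).
Proof. exact: initial_continuous. Qed.

Lemma continuous_set_type (S : topologicalType) (f : S -> D) (x : S) :
  {for x, continuous (set_val \o f)} -> {for x, continuous f}.
Proof.
move=> cf U /nbhs_set_type[V Vx VU].
have := cf _ Vx; rewrite !nbhs_simpl /=.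
by apply: filterS => y; exact: VU.
Qed.

Lemma open_set_type (U : set D) : open D -> open U -> open (set_val @` U).
Proof.
move=> oD [W oW <-]; rewrite (_ : _ @` _ = W `&` D); first exact: openI.
apply/seteqP; split=> [_ [x Wx <-]|x [Wx Dx]].
  by split => //; exact: set_valP.
by exists (sub_elt Dx).
Qed.

End set_type_topology.

Section subgroupoid.
Context (G : etaleGroupoid) (D : niceSubgroupoid G).
Implicit Types x y z : D.

Lemma subgpd_src a : nset D a -> nset D (gsrc a).
Proof.
have [Dinv Dmul] := nset_subgpd D.
by move=> Da; apply: Dmul (gmulVg a) => //; exact: Dinv.
Qed.

Lemma subgpd_rng a : nset D a -> nset D (grng a).
Proof.
have [Dinv Dmul] := nset_subgpd D.
by move=> Da; apply: Dmul (gmulgV a) => //; exact: Dinv.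
Qed.

Definition sub_mul x y : option D := obind insub (gmul (set_val x) (set_val y)).

Definition sub_inv x : D := sub_elt (subgpd_inv (nset_subgpd D) (set_valP x)).

Definition sub_src x : D := sub_elt (subgpd_src (set_valP x)).

Definition sub_rng x : D := sub_elt (subgpd_rng (set_valP x)).

Lemma sub_mulE x y z :
  sub_mul x y = Some z <-> gmul (set_val x) (set_val y) = Some (set_val z).
Proof.
rewrite /sub_mul; case xy : gmul => [c|//] /=.
have Dc := subgpd_mul (nset_subgpd D) (set_valP x) (set_valP y) xy.
rewrite insubT ?mem_set// => Dc'; split=> [[<-]//|[cz]].
by congr Some; apply: val_inj.
Qed.

Lemma sub_mulN x y : sub_mul x y = None <-> gmul (set_val x) (set_val y) = None.
Proof.
rewrite /sub_mul; case xy : gmul => [c|//] /=.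
have Dc := subgpd_mul (nset_subgpd D) (set_valP x) (set_valP y) xy.
by rewrite insubT ?mem_set.
Qed.

Lemma omap_sub_mul x y :
  omap set_val (sub_mul x y) = gmul (set_val x) (set_val y).
Proof.
case xy : sub_mul => [z|]; first by move/sub_mulE : xy => ->.
by move/sub_mulN : xy => ->.
Qed.

Lemma omap_val_inj : injective (omap (set_val : D -> G)).
Proof. by move=> [x|] [y|] //= [/val_inj ->]. Qed.

Lemma sub_mul_def x y : isSome (sub_mul x y) <-> sub_src x = sub_rng y.
Proof.
have -> : isSome (sub_mul x y) = isSome (gmul (set_val x) (set_val y)).
  by rewrite -omap_sub_mul; case: sub_mul.
rewrite gmul_def; split=> [?|/(congr1 set_val)//].
exact: val_inj.
Qed.

Lemma sub_mulA x y z :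
  obind (sub_mul^~ z) (sub_mul x y) = obind (sub_mul x) (sub_mul y z).
Proof.
apply: omap_val_inj.
have := gmulA (set_val x) (set_val y) (set_val z).
rewrite -!omap_sub_mul; case: sub_mul => [xy|]; case: sub_mul => [yz|] //=;
  by rewrite ?omap_sub_mul.
Qed.

Lemma sub_mulVg x : sub_mul (sub_inv x) x = Some (sub_src x).
Proof. exact/sub_mulE/gmulVg. Qed.

Lemma sub_mulgV x : sub_mul x (sub_inv x) = Some (sub_rng x).
Proof. exact/sub_mulE/gmulgV. Qed.

Lemma sub_mulgs x : sub_mul x (sub_src x) = Some x.
Proof. exact/sub_mulE/gmulgs. Qed.

Lemma sub_mulrg x : sub_mul (sub_rng x) x = Some x.
Proof. exact/sub_mulE/gmulrg. Qed.

Lemma sub_mul_continuous :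
  pfun_continuous (fun (p : D * D) z => sub_mul p.1 p.2 = Some z).
Proof.
move=> [x y] z /= /sub_mulE xy W /nbhs_set_type[V Vz VW].
have := @gmul_continuous G (set_val x, set_val y) _ xy _ Vz.
rewrite /prop_near1 => -[[A B] /= [xA yB] AB].
exists (set_val @^-1` A, set_val @^-1` B) => /=.
  by split; apply/nbhs_set_type; [exists A|exists B].
move=> [x' y'] /= [Ax' By'] z' /sub_mulE xy'; apply: VW.
by apply: (AB (set_val x', set_val y')).
Qed.

Lemma sub_inv_continuous : continuous sub_inv.
Proof.
move=> x; apply: continuous_set_type.
apply: (@continuous_comp _ _ _ set_val (@ginv G)).
  exact: set_val_continuous.
exact: ginv_continuous.
Qed.

Lemma sub_src_open : open_map sub_src.
Proof.
move=> U oU; exists (@gsrc G @` (set_val @` U)).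
  by apply: gsrc_open; apply: open_set_type => //; exact: nset_open.
apply/seteqP; split=> [x [_ [y Uy <-] yx]|_ [y Uy <-] /=].
  by exists y => //; apply: val_inj.
by exists (set_val y) => //; exists y.
Qed.

Definition sub_groupoid : etaleGroupoid :=
  @EtaleGroupoid (D : Type) sub_mul sub_inv sub_src sub_rng sub_mul_def
    sub_mulA sub_mulVg sub_mulgV sub_mulgs sub_mulrg sub_mul_continuous
    sub_inv_continuous sub_src_open.

End subgroupoid.

Record etaleMorphism (H G : etaleGroupoid) := EtaleMorphism {
  efun :> H -> G ;
  efun_continuous : continuous efun ;
  efun_unit : forall x, gunit x -> gunit (efun x) ;
  efun_mul : forall a b c,
    gmul a b = Some c -> gmul (efun a) (efun b) = Some (efun c) ;
  efun_star : forall (x : H) (g : G), gunit x -> efun x = gsrc g ->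
    exists! d : H, gsrc d = x /\ efun d = g ;
  efun_proper : forall K, compact K -> compact (efun @^-1` K) }.

Section etale_morphism_theory.
Context (H G : etaleGroupoid) (f : etaleMorphism H G).

Lemma efun_src a : f (gsrc a) = gsrc (f a).
Proof.
have fa := efun_mul f (gmulgs a).
have /gmul_def -> : isSome (gmul (f a) (f (gsrc a))) by rewrite fa.
have : gunit (f (gsrc a)) by apply: efun_unit; exact: gsrc_src.
by move=> fu; rewrite -[in RHS]fu grng_src fu.
Qed.

Lemma efun_inv a : f (ginv a) = ginv (f a).
Proof.
by apply: ginv_uniq; rewrite (efun_mul f (gmulVg a)) efun_src.
Qed.

Lemma efun_invE a b : ginv a = b -> ginv (f a) = f b.
Proof. by move=> <-; rewrite efun_inv. Qed.

End etale_morphism_theory.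

(** Banach and Fell bundles *)

(* A bundle over [X] is given by its fibres, so that the total space consists
   of the pairs of a point of [X] and a vector of the fibre there, with the
   first component as projection.  The total space carries a topology of its
   own, which is not the library's disjoint-union topology. *)
Record total (X : Type) (F : X -> Type) := Tot { proj : X ; vec : F proj }.

Record preBundle (R : realType) (X : topologicalType) := PreBundle {
  fibre :> X -> completeNormedModType R[i] ;
  total_topology : Topological.axioms_ (total fibre) }.

Definition tspace (R : realType) (X : topologicalType) (E : preBundle R X)
  : topologicalType := Topological.Pack (total_topology E).

Definition tot (R : realType) (X : topologicalType) (E : preBundle R X)
  (x : X) (v : E x) : tspace E := Tot (F := fibre E) v.

(* The norm of a complex normed space takes its values in [R[i]]. *)
Definition rnorm (R : realType) (V : normedModType R[i]) (v : V) : R :=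
  complex.Re `|v|.

Section bundle_operations.
Context (R : realType) (X : topologicalType) (E : preBundle R X).

Definition tproj (b : tspace E) : X := proj b.

Definition tnorm (b : tspace E) : R := rnorm (vec b).

Definition tscale (k : R[i]) (b : tspace E) : tspace E := tot (k *: vec b).

Variant tadd : tspace E * tspace E -> tspace E -> Prop :=
  Tadd x (u v : E x) : tadd (tot u, tot v) (tot (u + v)).

End bundle_operations.

(* Surjectivity of the projection is automatic.  Nets are replaced by
   filters. *)
Record is_banach (R : realType) (X : topologicalType) (E : preBundle R X)
    : Prop := IsBanach {
  tproj_continuous : continuous (@tproj R X E) ;
  tproj_open : open_map (@tproj R X E) ;
  tscale_continuous : forall k, continuous (@tscale R X E k) ;
  tadd_continuous : pfun_continuous (@tadd R X E) ;
  tnorm_usc : forall r : R, open [set b : tspace E | tnorm b < r] ;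
  tnorm_cvg0 : forall (x : X) (F : set_system (tspace E)), Filter F ->
    @tproj R X E @ F --> x -> @tnorm R X E @ F --> (0 : R) ->
    F --> tot (0 : E x) }.

(* The product and the involution are given fibrewise.  [fmul] takes a proof
   that the base points are composable with a given product and [fstar] a proof
   that its endpoints are inverse to each other, so that the compatibility of
   the operations with the projection is built in, and so that the laws of a
   *-semigroupoid are equations in one fibre: by [gmulA], [(ab)c] and [a(bc)]
   are defined for the same triples. *)
Record fellBundle (R : realType) (G : etaleGroupoid) := FellBundle {
  fpre :> preBundle R G ;
  fell_banach : is_banach fpre ;
  fmul : forall a b c : G, gmul a b = Some c -> fpre a -> fpre b -> fpre c ;
  fstar : forall a b : G, ginv a = b -> fpre a -> fpre b ;
  fmulA : forall (a b c ab bc abc : G) (e1 : gmul a b = Some ab)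
    (e2 : gmul ab c = Some abc) (e3 : gmul b c = Some bc)
    (e4 : gmul a bc = Some abc) (x : fpre a) (y : fpre b) (z : fpre c),
    fmul e2 (fmul e1 x y) z = fmul e4 x (fmul e3 y z) ;
  fmul_linearl : forall (a b c : G) (e : gmul a b = Some c) (k : R[i])
    (x x' : fpre a) (y : fpre b),
    fmul e (k *: x + x') y = k *: fmul e x y + fmul e x' y ;
  fmul_linearr : forall (a b c : G) (e : gmul a b = Some c) (k : R[i])
    (x : fpre a) (y y' : fpre b),
    fmul e x (k *: y + y') = k *: fmul e x y + fmul e x y' ;
  fstar_antilinear : forall (a b : G) (e : ginv a = b) (k : R[i])
    (x y : fpre a), fstar e (k *: x + y) = k^* *: fstar e x + fstar e y ;
  fstarK : forall (a b : G) (e : ginv a = b) (e' : ginv b = a) (x : fpre a),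
    fstar e' (fstar e x) = x ;
  fstarM : forall (a b c a' b' c' : G) (e : gmul a b = Some c)
    (ea : ginv a = a') (eb : ginv b = b') (ec : ginv c = c')
    (e' : gmul b' a' = Some c') (x : fpre a) (y : fpre b),
    fstar ec (fmul e x y) = fmul e' (fstar eb y) (fstar ea x) ;
  fmul_continuous : pfun_continuous
    (fun (p : tspace fpre * tspace fpre) (q : tspace fpre) =>
      exists a b c (e : gmul a b = Some c) (x : fpre a) (y : fpre b),
        p = (tot x, tot y) /\ q = tot (fmul e x y)) ;
  fstar_continuous :
    continuous (fun b : tspace fpre => tot (fstar erefl (vec b)) : tspace fpre) ;
  fnormM : forall (a b c : G) (e : gmul a b = Some c) (x : fpre a) (y : fpre b),
    `|fmul e x y| <= `|x| * `|y| ;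
  fnormC : forall (a : G) (x : fpre a),
    `|fmul (gmulVg a) (fstar erefl x) x| = `|x| ^+ 2 ;
  fpositive : forall (a : G) (x : fpre a), exists y : fpre (gsrc a),
    fmul (gmulVsrc a) (fstar erefl y) y = fmul (gmulVg a) (fstar erefl x) x }.

(** Sections *)

(* The supremum in [0, +oo]: it is [0] for the empty set, which matters when the
   groupoid is empty. *)
Definition supremum0 (R : realType) (A : set (\bar R)) : \bar R :=
  ereal_sup (0%E |` A).

Section sections.
Context (R : realType) (G : etaleGroupoid) (E : fellBundle R G).

Definition section := forall g : G, E g.

Implicit Types a b f : section.

Definition supp a : set G := [set g | a g != 0].

Definition sec_star a : section := fun g => fstar (ginvK g) (a (ginv g)).

Definition factorizations (g : G) : set (G * G) :=
  [set p | gmul p.1 p.2 = Some g].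

Definition conv_term a b (g : G) (p : factorizations g) : E g :=
  fmul (set_valP p) (a (set_val p).1) (b (set_val p).2).

Definition conv_defined a b :=
  forall g, cvg (partial_sum (@conv_term a b g) @ totally).

(* The value is meaningful only where the partial sums converge. *)
Definition conv a b : section := fun g => summability.sum (@conv_term a b g).

Definition star_fibre (x : G) : set G := [set g | gsrc g = x].

Definition norm2_term a (x : G) (g : star_fibre x) : E x :=
  fmul (etrans (gmulVg (set_val g)) (congr1 Some (set_valP g)))
    (fstar erefl (a (set_val g))) (a (set_val g)).

Definition norm2 a : \bar R :=
  supremum0 [set r | exists2 x, gunit x & exists F : {fset star_fibre x},
    r = (Num.sqrt (rnorm (partial_sum (@norm2_term a x) F)))%:E].

(* In [\bar R], [0 / 0 = 0]. *)
Definition normb a : \bar R :=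
  supremum0 [set norm2 (conv a f) / norm2 f | f in
    [set f | finite_set (supp f)]]%E.

Definition bounded_sections : set section :=
  [set a | [/\ (normb a < +oo)%E, conv_defined (sec_star a) a &
              conv_defined a (sec_star a)]].

Definition continuous_on (Y : set G) : set section :=
  [set a | supp a `<=` Y /\
    forall g, Y g -> {for g, continuous (fun h => tot (a h) : tspace E)}].

Definition compact_sections : set section :=
  [set a | exists n (k : 'I_n -> R[i]) (K : 'I_n -> set G)
    (f : 'I_n -> section),
    (forall i, bicompact (K i) /\ continuous_on (K i) (f i)) /\
    forall g, a g = \sum_i k i *: f i g].

Definition reduced_sections : set section :=
  [set a | bounded_sections a /\ forall e : R, 0 < e ->
    exists2 c, compact_sections c & (normb (fun g => a g - c g)%R < e%:E)%E].

End sections.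

(** Pullback bundles *)

Section fell_bundle_theory.
Context (R : realType) (G : etaleGroupoid) (E : fellBundle R G).

Lemma fnormC_gen (a b c : G) (ea : ginv a = b) (e : gmul b a = Some c)
  (x : E a) : `|fmul e (fstar ea x) x| = `|x| ^+ 2.
Proof.
subst b; have := e; rewrite gmulVg => -[ca]; subst c.
by rewrite (Prop_irrelevance e (gmulVg a)) fnormC.
Qed.

Lemma fpositive_gen (a b c d : G) (ea : ginv a = b) (e : gmul b a = Some c)
  (ec : ginv c = d) (e' : gmul d c = Some c) (x : E a) :
  exists y : E c, fmul e' (fstar ec y) y = fmul e (fstar ea x) x.
Proof.
subst b d; have := e; rewrite gmulVg => -[ca]; subst c.
rewrite (Prop_irrelevance e (gmulVg a)) (Prop_irrelevance e' (gmulVsrc a)).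
exact: fpositive.
Qed.

End fell_bundle_theory.

Section initial_topology.
Context (S : choiceType) (T : topologicalType) (i : S -> T).

Lemma nbhs_initial (x : initial_topology i) U :
  nbhs x U <-> exists2 V, nbhs (i x) V & i @^-1` V `<=` U.
Proof.
rewrite [nbhs x]nbhsE; split=> [[_ [[W oW <-] Wx] BU]|[V]].
  by exists W; [exact: open_nbhs_nbhs|exact: BU].
rewrite nbhsE => -[W [oW Wx] WV] VU; exists (i @^-1` W).
  by split => //; exists W.
by move=> y /WV /VU.
Qed.

End initial_topology.

Section pullback.
Context (R : realType) (H G : etaleGroupoid).
Context (f : etaleMorphism H G) (E : fellBundle R G).

Definition pullback_fibre (x : H) : completeNormedModType R[i] := E (f x).

Definition pullback_incl (b : {classic total pullback_fibre}) : H * tspace E :=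
  (proj b, tot (vec b)).

Definition pullback_pre : preBundle R H :=
  @PreBundle R H pullback_fibre
    (Topological.class (initial_topology pullback_incl)).

Local Notation P := pullback_pre.
Local Notation toE b := (@tot R G E (f (proj b)) (vec b)).

Lemma nbhs_pullback (x : H) (v : P x) (U : set (tspace P)) :
  nbhs (tot v : tspace P) U <-> exists A B, [/\ nbhs x A,
    nbhs (tot (v : E (f x)) : tspace E) B &
    forall y (w : P y), A y -> B (tot (w : E (f y))) -> U (tot w)].
Proof.
rewrite (@nbhs_initial _ _ pullback_incl (tot v)); split.
  move=> [V [[A B] /= [xA vB] AB] VU]; exists A, B; split => //.
  by move=> y w Ay Bw; apply: VU; apply: AB; split.
move=> [A [B [xA vB AB]]]; exists (A `*` B); first by exists (A, B).
by move=> [y w] [/= Ay Bw]; exact: AB.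
Qed.

Lemma pullback_banach : is_banach P.
Proof.
have [_ Eopen Escale Eadd Eusc Ecvg] := fell_banach E.
split.
- move=> [x v] U xU; apply/(@nbhs_pullback x v); exists U, setT; split => //.
  exact: filterT.
- move=> U [W oW <-]; rewrite openE => _ [[x v] /= Wxv <-].
  have [[A B] /= [xA vB] AB] : nbhs (x, tot (v : E (f x)) : tspace E) W.
    exact: open_nbhs_nbhs.
  have : nbhs (tot (v : E (f x)) : tspace E) B := vB.
  rewrite nbhsE => -[B' [oB' B'v] B'B].
  have fB : nbhs (f x) (@tproj R G E @` B').
    by apply: open_nbhs_nbhs; split; [exact: Eopen|exists (@tot R G E (f x) v)].
  rewrite /interior; near=> y.
  have [[z w] B'w /= zy] : (@tproj R G E @` B') (f y).
    by near: y; exact: (@efun_continuous _ _ f x).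
  rewrite /tproj /= in zy; subst z.
  exists (Tot (F := pullback_fibre) w) => //=; apply: AB; split => /=.
    by near: y.
  exact: B'B.
- move=> k [x v] U /(@nbhs_pullback x)[A [B [xA vB AB]]].
  apply/(@nbhs_pullback x v); exists A, (@tscale R G E k @^-1` B); split => //.
    exact: Escale.
  by move=> y w Ay Bw; exact: AB.
- move=> p q [x u v] U /(@nbhs_pullback x)[A [B [xA vB AB]]].
  have [[B1 B2] /= [uB1 vB2] B12] := Eadd _ _ (@Tadd R G E _ u v) _ vB.
  exists ([set b : tspace P | A (proj b) /\ B1 (toE b)],
          [set b : tspace P | B2 (toE b)]) => /=.
    split; apply/(@nbhs_pullback x); first by exists A, B1; split.
    by exists setT, B2; split => //; exact: filterT.
  move=> r [r1 r2] s rs; case: rs r1 r2 => y u' v' /= [Ay B1u] B2v.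
  apply: AB => //; apply: (B12 (_, _)); first by split; [exact: B1u|exact: B2v].
  exact: Tadd.
- move=> r; exists [set p | tnorm p.2 < r].
    rewrite openE => -[x b] /= br.
    exists (setT, [set b : tspace E | tnorm b < r]) => /=; last by move=> ? [].
    by split; [exact: filterT|exact: open_nbhs_nbhs].
  by [].
- move=> x F FF Fx F0 U /(@nbhs_pullback x)[A [B [xA vB AB]]].
  pose j (b : tspace P) : tspace E := toE b.
  have jF : j @ F --> tot (0 : E (f x)).
    apply: Ecvg.
    + rewrite (_ : _ @ _ = (f \o @tproj R H P) @ F)//.
      exact: cvg_comp Fx (@efun_continuous _ _ f x).
    + exact: F0.
  have FB : F (j @^-1` B) by exact: jF.
  have FA : F (@tproj R H P @^-1` A) by exact: Fx.
  by apply: filterS2 FA FB => -[y w]; exact: AB.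
Unshelve. all: by end_near. Qed.

Definition pullback_mul (a b c : H) (e : gmul a b = Some c) (x : P a) (y : P b)
  : P c := fmul (efun_mul f e) x y.

Definition pullback_star (a b : H) (e : ginv a = b) (x : P a) : P b :=
  fstar (efun_invE f e) x.

Lemma pullback_mul_continuous : pfun_continuous
  (fun (p : tspace P * tspace P) (q : tspace P) =>
    exists a b c (e : gmul a b = Some c) (x : P a) (y : P b),
      p = (tot x, tot y) /\ q = tot (pullback_mul e x y)).
Proof.
move=> _ _ [a [b [c [e [u [v [-> ->]]]]]]] U /(@nbhs_pullback c)[A [B [cA vB AB]]].
have [[B1 B2] /= [uB1 vB2] B12] := @fmul_continuous _ _ E (@tot R G E _ u, @tot R G E _ v) _
  (ex_intro _ _ (ex_intro _ _ (ex_intro _ _ (ex_intro _ (efun_mul f e)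
  (ex_intro _ u (ex_intro _ v (conj erefl erefl))))))) _ vB.
have [[A1 A2] /= [aA1 bA2] A12] := @gmul_continuous H (a, b) _ e _ cA.
exists ([set b : tspace P | A1 (proj b) /\ B1 (toE b)],
        [set b : tspace P | A2 (proj b) /\ B2 (toE b)]) => /=.
  by split; apply/nbhs_pullback; [exists A1, B1|exists A2, B2].
move=> r /= [r1 r2] _ [a' [b' [c' [e' [u' [v' [rE ->]]]]]]]; subst r.
move: r1 r2 => /= [A1a B1u] [A2b B2v]; apply: AB.
  exact: (A12 (a', b')).
apply: (B12 (_, _)); first by split; [exact: B1u|exact: B2v].
by exists (f a'), (f b'), (f c'), (efun_mul f e'), u', v'.
Qed.

Lemma pullback_star_continuous : continuous
  (fun b : tspace P => tot (pullback_star erefl (vec b)) : tspace P).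
Proof.
move=> [a x] U /(@nbhs_pullback (ginv a))[A [B [aA xB AB]]].
have fstarE (b c : G) (e : ginv b = c) (y : E b) :
    tot (fstar e y) = tot (fstar erefl y) :> tspace E by subst c.
apply/nbhs_pullback.
exists (@ginv H @^-1` A),
  ((fun b : tspace E => tot (fstar erefl (vec b)) : tspace E) @^-1` B).
split.
- exact: ginv_continuous.
- by apply: fstar_continuous => /=; rewrite -(fstarE _ _ (efun_invE f erefl)).
- by move=> y w Ay Bw; apply: AB => //; rewrite fstarE.
Qed.

Definition pullback : fellBundle R H.
Proof.
refine (@FellBundle R H P pullback_banach pullback_mul pullback_star
  _ _ _ _ _ _ pullback_mul_continuous pullback_star_continuous _ _ _).
- by move=> *; exact: fmulA.
- by move=> *; exact: fmul_linearl.
- by move=> *; exact: fmul_linearr.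
- by move=> *; exact: fstar_antilinear.
- by move=> *; exact: fstarK.
- by move=> *; exact: fstarM.
- by move=> *; exact: fnormM.
- by move=> *; exact: fnormC_gen.
- by move=> *; exact: fpositive_gen.
Defined.

End pullback.

Definition pullback_section (R : realType) (H G : etaleGroupoid)
    (f : etaleMorphism H G) (E : fellBundle R G) (a : section E)
    : section (pullback f E) :=
  fun x => a (f x).

(** Fibre morphisms *)

Record fibreMorphism (R : realType) (G : etaleGroupoid)
    (D : niceSubgroupoid G) (C : fellBundle R (sub_groupoid D))
    (E : fellBundle R G) := FibreMorphism {
  bfun :> forall x : sub_groupoid D, C x -> E (set_val x) ;
  bfun_continuous : continuous
    (fun c : tspace C => tot (bfun (vec c)) : tspace E) ;
  bfun_star : forall (x y : sub_groupoid D) (e : ginv x = y)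
    (e' : ginv (set_val x) = set_val y) (c : C x),
    bfun (fstar e c) = fstar e' (bfun c) ;
  bfun_mul : forall (x y z : sub_groupoid D) (e : gmul x y = Some z)
    (e' : gmul (set_val x) (set_val y) = Some (set_val z)) (c : C x) (d : C y),
    bfun (fmul e c d) = fmul e' (bfun c) (bfun d) ;
  bfun_linear : forall (x : sub_groupoid D) (k : R[i]) (c d : C x),
    bfun (k *: c + d) = k *: bfun c + bfun d }.

Definition fibre_section (R : realType) (G : etaleGroupoid)
    (D : niceSubgroupoid G) (C : fellBundle R (sub_groupoid D))
    (E : fellBundle R G) (beta : fibreMorphism C E) (a : section C)
    : section E :=
  fun g => match pselect (nset D g) with
           | left Dg => beta (sub_elt Dg) (a (sub_elt Dg))
           | right _ => 0
           end.

(** The category of Fell bundles *)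

Record fellObject (R : realType) := FellObject {
  fgpd : etaleGroupoid ;
  fbun :> fellBundle R fgpd }.

Record fellMorphism (R : realType) (X X' : fellObject R) := FellMorphism {
  fdom : niceSubgroupoid (fgpd X') ;
  fphi : etaleMorphism (sub_groupoid fdom) (fgpd X) ;
  fbeta : fibreMorphism (pullback fphi X) X' }.

(* The data underlying a morphism.  On these, products are always defined. *)
Record fellData (R : realType) (X X' : fellObject R) := FellData {
  ddom : set (fgpd X') ;
  dphi : ddom -> fgpd X ;
  dbeta : forall x : ddom, X (dphi x) -> X' (set_val x) }.

Definition fell_data (R : realType) (X X' : fellObject R)
    (f : fellMorphism X X') : fellData X X' :=
  @FellData R X X' (nset (fdom f)) (fphi f) (@bfun _ _ _ _ _ (fbeta f)).

Section fell_product.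
Context (R : realType) (X X' X'' : fellObject R).
Context (g : fellData X' X'') (f : fellData X X').

Definition comp_dom : set (fgpd X'') :=
  [set x | exists gx : ddom g x, ddom f (dphi (sub_elt gx))].

Lemma comp_dom_fst x : comp_dom x -> ddom g x.
Proof. by case. Qed.

Definition comp_fst (x : comp_dom) : ddom g :=
  sub_elt (comp_dom_fst (set_valP x)).

Lemma comp_dom_snd (x : comp_dom) : ddom f (dphi (comp_fst x)).
Proof.
by case: (set_valP x) => gx; rewrite /comp_fst (Prop_irrelevance (comp_dom_fst _) gx).
Qed.

Definition comp_snd (x : comp_dom) : ddom f := sub_elt (comp_dom_snd x).

Definition comp_data : fellData X X'' :=
  @FellData R X X'' comp_dom (fun x => dphi (comp_snd x))
    (fun x v => dbeta (x := comp_fst x) (dbeta (x := comp_snd x) v)).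

End fell_product.

Definition id_data (R : realType) (X : fellObject R) : fellData X X :=
  @FellData R X X setT set_val (fun x v => v).

Record fellElement (R : realType) := FellElement {
  fell_tgt : fellObject R ;
  fell_src : fellObject R ;
  fell_mor : fellMorphism fell_src fell_tgt }.

Arguments FellElement {R fell_tgt fell_src}.

Variant fell_unit (R : realType) : fellElement R -> Prop :=
  FellUnit (X : fellObject R) (u : fellMorphism X X) of
    fell_data u = id_data X : fell_unit (FellElement u).

(* [fell_product g f h] means that the product of [g] and [f] is defined and is
   [h].  The composite data underlie a morphism exactly when the domain of the
   composite is nice (see [fell_product_exists]).  This is not automatic: take
   the trivial groupoid on [nat] plus a point [oo], whose open sets are the
   initial segments of [nat], [nat] itself and the whole space.  Then [nat] is
   nice, but its preimage [{0}] in the subspace [{0, oo}] is not. *)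
Variant fell_product (R : realType)
    : fellElement R -> fellElement R -> fellElement R -> Prop :=
  FellProduct (X X' X'' : fellObject R) (g : fellMorphism X' X'')
    (f : fellMorphism X X') (h : fellMorphism X X'') of
    fell_data h = comp_data (fell_data g) (fell_data f) :
    fell_product (FellElement g) (FellElement f) (FellElement h).

Section fell_identity.
Context (R : realType) (X : fellObject R).
Let G := fgpd X.

Let all_nice : niceSubgroupoid G.
Proof.
refine (@NiceSubgroupoid G setT _ openT _); first by split.
by move=> K _; rewrite setTI.
Defined.

Let all_elt (x : G) : sub_groupoid all_nice := @sub_elt G setT x I.

Let all_val : etaleMorphism (sub_groupoid all_nice) G.
Proof.
refine (@EtaleMorphism (sub_groupoid all_nice) G set_val
  (@set_val_continuous G setT) _ _ _ _).
- by move=> x /(congr1 set_val).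
- by move=> a b c /sub_mulE.
- move=> x g _ xg; exists (all_elt g); split=> [|d [_ dg]].
    by split => //; apply: val_inj.
  exact: val_inj.
- move=> K cK F FF FK.
  have [p [Kp Fp]] := cK (set_val @ F) _ FK.
  exists (all_elt p); split => // A B FA /nbhs_set_type[V pV VB].
  have [_ [[x Ax <-] Vx]] := Fp (set_val @` A) V
    (filterS (@preimage_image _ _ set_val A) FA) pV.
  by exists x; split => //; exact: VB.
Defined.

Let all_beta : fibreMorphism (pullback all_val X) X.
Proof.
refine (@FibreMorphism R G all_nice (pullback all_val X) X (fun x v => v)
  _ _ _ _).
- move=> [x v] U vU; apply/(@nbhs_pullback _ _ _ all_val X x v).
  by exists setT, U; split => //; exact: filterT.
- by move=> x y e e' c; rewrite (Prop_irrelevance e' (efun_invE all_val e)).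
- by move=> x y z e e' c d; rewrite (Prop_irrelevance e' (efun_mul all_val e)).
- by [].
Defined.

Lemma fell_unit_exists : exists u : fellMorphism X X, fell_unit (FellElement u).
Proof. by exists (FellMorphism all_beta). Qed.

End fell_identity.

Section fell_composition.
Context (R : realType) (X X' X'' : fellObject R).
Context (g : fellMorphism X' X'') (f : fellMorphism X X').
Let dg := fell_data g.
Let df := fell_data f.
Let Hg := sub_groupoid (fdom g).
Let Hf := sub_groupoid (fdom f).
Let cdom : set (fgpd X'') := comp_dom dg df.

Hypothesis cdom_closed : forall K, compact K ->
  closed_in (cdom `&` @gunit (fgpd X'')) K -> closed_in (@gunit (fgpd X'')) K.

Let cdomP (y : Hg) : nset (fdom f) (fphi g y) -> cdom (set_val y).
Proof.
move=> fy; exists (set_valP y); rewrite /dg/= (_ : sub_elt _ = y) //.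
exact: val_inj.
Qed.

Let cdomE : cdom = set_val @` (fphi g @^-1` nset (fdom f)).
Proof.
apply/seteqP; split=> [x [gx fx]|_ [y fy <-]]; last exact: cdomP.
by exists (sub_elt gx).
Qed.

Let cdom_open : open cdom.
Proof.
rewrite cdomE; apply: open_set_type; first exact: nset_open.
by move/continuousP: (@efun_continuous _ _ (fphi g)); apply; exact: nset_open.
Qed.

Let cdom_subgpd : is_subgroupoid cdom.
Proof.
have [finv fmul'] := nset_subgpd (fdom f).
rewrite cdomE; split.
  move=> _ [y fy <-]; exists (ginv y) => //=.
  by rewrite efun_inv; exact: finv.
move=> _ _ c [y fy <-] [z fz <-] yz.
have gc := subgpd_mul (nset_subgpd (fdom g)) (set_valP y) (set_valP z) yz.
exists (sub_elt gc) => //=; apply: fmul' fy fz _; apply: efun_mul.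
exact/sub_mulE.
Qed.

Let D : niceSubgroupoid (fgpd X'') :=
  NiceSubgroupoid cdom_subgpd cdom_open cdom_closed.
Let H := sub_groupoid D.
Let p1 (x : H) : Hg := @comp_fst R X X' X'' dg df x.
Let p2 (x : H) : Hf := @comp_snd R X X' X'' dg df x.

Let p1_mul (x y z : H) : gmul x y = Some z -> gmul (p1 x) (p1 y) = Some (p1 z).
Proof. by move=> /sub_mulE xy; exact/sub_mulE. Qed.

Let p2_mul (x y z : H) : gmul x y = Some z -> gmul (p2 x) (p2 y) = Some (p2 z).
Proof. by move=> /p1_mul /(efun_mul (fphi g)) xy; exact/sub_mulE. Qed.

Let p1_src (x : H) : p1 (gsrc x) = gsrc (p1 x).
Proof. exact: val_inj. Qed.

Let p2_src (x : H) : p2 (gsrc x) = gsrc (p2 x).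
Proof. by apply: val_inj => /=; rewrite -/(p1 _) p1_src efun_src. Qed.

Let p1_unit (x : H) : gunit x -> gunit (p1 x).
Proof. by move=> ux; have := p1_src x; rewrite (ux : gsrc x = x) => /esym. Qed.

Let p2_unit (x : H) : gunit x -> gunit (p2 x).
Proof. by move=> ux; have := p2_src x; rewrite (ux : gsrc x = x) => /esym. Qed.

Let p1_inv (x y : H) : ginv x = y -> ginv (p1 x) = p1 y.
Proof. by move=> <-; exact: val_inj. Qed.

Let p2_inv (x y : H) : ginv x = y -> ginv (p2 x) = p2 y.
Proof.
by move=> /p1_inv xy; apply: val_inj => /=; rewrite -efun_inv; congr (fphi g _).
Qed.

Let p1_continuous : continuous p1.
Proof.
move=> x; apply: continuous_set_type.
exact: (@set_val_continuous (fgpd X'') cdom).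
Qed.

Let p2_continuous : continuous p2.
Proof.
move=> x; apply: continuous_set_type.
apply: (@continuous_comp _ _ _ p1 (fphi g)); first exact: p1_continuous.
exact: efun_continuous.
Qed.

Let cphi : etaleMorphism H (fgpd X).
Proof.
refine (@EtaleMorphism H (fgpd X) (fun x => fphi f (p2 x)) _ _ _ _ _).
- move=> x; apply: (@continuous_comp _ _ _ p2 (fphi f)).
    exact: p2_continuous.
  exact: efun_continuous.
- by move=> x ux; apply: efun_unit; exact: p2_unit.
- by move=> a b c ab; apply: efun_mul; exact: p2_mul.
- move=> x c ux xc.
  have [d [[dx dc] dU]] := efun_star (p2_unit ux) xc.
  have xd : fphi g (p1 x) = gsrc (set_val d) by move/(congr1 set_val): dx.
  have [d' [[d'x d'd] d'U]] := efun_star (p1_unit ux) xd.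
  have fd' : nset (fdom f) (fphi g d') by rewrite d'd; exact: set_valP.
  pose y : H := @sub_elt _ cdom _ (cdomP fd').
  have y1 : p1 y = d' by exact: val_inj.
  have y2 : p2 y = d by apply: val_inj => /=; rewrite -/(p1 y) y1.
  exists y; split.
    split; last by rewrite y2.
    by apply: val_inj => /=; move/(congr1 set_val): d'x.
  move=> z [zx zc]; apply: val_inj.
  have z2 : d = p2 z by apply: dU; split => //; rewrite -p2_src zx.
  have z1 : d' = p1 z.
    by apply: d'U; split; [rewrite -p1_src zx|rewrite z2].
  by move/(congr1 set_val): z1.
- move=> K cK F FF FK.
  have cK1 : compact (set_val @` (fphi f @^-1` K)).
    apply: continuous_compact; last exact: efun_proper.
    by apply: continuous_subspaceT; exact: set_val_continuous.
  have cK2 := efun_proper (e := fphi g) cK1.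
  have F2 : (p1 @ F) (fphi g @^-1` (set_val @` (fphi f @^-1` K))).
    apply: (@filterS _ F _ _ _ _ FK) => x Kx.
    by exists (p2 x).
  have [q [[r Kr rq] Fq]] := cK2 (p1 @ F) _ F2.
  have fq : nset (fdom f) (fphi g q) by rewrite -rq; exact: set_valP.
  pose y : H := @sub_elt _ cdom _ (cdomP fq).
  have y1 : p1 y = q by exact: val_inj.
  have y2 : p2 y = r by apply: val_inj => /=; rewrite -/(p1 y) y1.
  exists y; split; first by rewrite /= y2.
  move=> A B FA /nbhs_set_type[V yV VB].
  have qV : nbhs q (set_val @^-1` V) by apply/nbhs_set_type; exists V.
  have [_ [[x Ax <-] Vx]] := Fq (p1 @` A) _
    (filterS (@preimage_image _ _ p1 A) FA) qV.
  by exists x; split => //; exact: VB.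
Defined.

Let cbeta : fibreMorphism (pullback cphi X) X''.
Proof.
refine (@FibreMorphism R (fgpd X'') D (pullback cphi X) X''
  (fun x v => fbeta g (p1 x) (fbeta f (p2 x) v)) _ _ _ _).
- move=> [x v] U vU.
  have /nbhs_pullback[A [B [xA vB AB]]] :=
    @bfun_continuous _ _ _ _ _ (fbeta g)
      (@tot _ _ (pullback (fphi g) X') (p1 x) (fbeta f (p2 x) v)) _ vU.
  have /nbhs_pullback[A' [B' [xA' vB' AB']]] :=
    @bfun_continuous _ _ _ _ _ (fbeta f)
      (@tot _ _ (pullback (fphi f) X) (p2 x) v) _ vB.
  apply/(@nbhs_pullback _ _ _ cphi X x v).
  exists (p1 @^-1` A `&` p2 @^-1` A'), B'; split => //.
    by apply: filterI; [exact: p1_continuous|exact: p2_continuous].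
  move=> y w [Ay A'y] B'w; apply: (AB (p1 y) (fbeta f (p2 y) w)) => //.
  exact: (AB' (p2 y) w).
- move=> x y e e' c.
  apply: etrans (bfun_star (fbeta g) (p1_inv e) e' (fbeta f (p2 x) c)).
  apply: (congr1 (fbeta g (p1 y))).
  apply: etrans (bfun_star (fbeta f) (p2_inv e) (efun_invE (fphi g) (p1_inv e)) c).
  apply: (congr1 (fbeta f (p2 y))); rewrite /= /pullback_star.
  by congr fstar; exact: Prop_irrelevance.
- move=> x y z e e' c d.
  apply: etrans (bfun_mul (fbeta g) (p1_mul e) e' (fbeta f (p2 x) c)
    (fbeta f (p2 y) d)).
  apply: (congr1 (fbeta g (p1 z))).
  apply: etrans (bfun_mul (fbeta f) (p2_mul e)
    (efun_mul (fphi g) (p1_mul e)) c d).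
  apply: (congr1 (fbeta f (p2 z))); rewrite /= /pullback_mul.
  by congr fmul; exact: Prop_irrelevance.
- move=> x k c d.
  apply: etrans (bfun_linear (fbeta g) k (fbeta f (p2 x) c) (fbeta f (p2 x) d)).
  apply: (congr1 (fbeta g (p1 x))).
  exact: (bfun_linear (fbeta f) k c d).
Defined.

Lemma fell_product_exists :
  exists h : fellMorphism X X'',
    fell_product (FellElement g) (FellElement f) (FellElement h).
Proof. by exists (FellMorphism cbeta). Qed.

End fell_composition.

(** The category of C*-algebras *)

Record cstarAlgebra (R : realType) := CstarAlgebra {
  cs_car :> completeNormedModType R[i] ;
  cs_mul : cs_car -> cs_car -> cs_car ;
  cs_star : cs_car -> cs_car ;
  cs_mulA : associative cs_mul ;
  cs_mul_linearl : forall (k : R[i]) (a b c : cs_car),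
    cs_mul (k *: a + b) c = k *: cs_mul a c + cs_mul b c ;
  cs_mul_linearr : forall (k : R[i]) (a b c : cs_car),
    cs_mul a (k *: b + c) = k *: cs_mul a b + cs_mul a c ;
  cs_star_antilinear : forall (k : R[i]) (a b : cs_car),
    cs_star (k *: a + b) = k^* *: cs_star a + cs_star b ;
  cs_starK : involutive cs_star ;
  cs_starM : forall a b, cs_star (cs_mul a b) = cs_mul (cs_star b) (cs_star a) ;
  cs_normM : forall a b, `|cs_mul a b| <= `|a| * `|b| ;
  cs_normC : forall a, `|cs_mul (cs_star a) a| = `|a| ^+ 2 }.

Record starHom (R : realType) (A B : cstarAlgebra R) := StarHom {
  sh_fun :> A -> B ;
  sh_linear : forall (k : R[i]) (a b : A),
    sh_fun (k *: a + b) = k *: sh_fun a + sh_fun b ;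
  sh_mul : forall a b : A, sh_fun (cs_mul a b) = cs_mul (sh_fun a) (sh_fun b) ;
  sh_star : forall a : A, sh_fun (cs_star a) = cs_star (sh_fun a) }.

Record cstarElement (R : realType) := CstarElement {
  cstar_tgt : cstarAlgebra R ;
  cstar_src : cstarAlgebra R ;
  cstar_hom : starHom cstar_src cstar_tgt }.

Arguments CstarElement {R cstar_tgt cstar_src}.

Variant cstar_unit (R : realType) : cstarElement R -> Prop :=
  CstarUnit (A : cstarAlgebra R) (u : starHom A A) of
    sh_fun u = id : cstar_unit (CstarElement u).

Variant cstar_product (R : realType)
    : cstarElement R -> cstarElement R -> cstarElement R -> Prop :=
  CstarProduct (A A' A'' : cstarAlgebra R) (q : starHom A' A'')
    (p : starHom A A') (r : starHom A A'') of sh_fun r = q \o p :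
    cstar_product (CstarElement q) (CstarElement p) (CstarElement r).

(* Categories are given by their elements, their units, and the graph of their
   partial product. *)
Definition is_functor (C D : Type) (uC : C -> Prop) (mC : C -> C -> C -> Prop)
    (uD : D -> Prop) (mD : D -> D -> D -> Prop) (F : C -> D) :=
  (forall u, uC u -> uD (F u)) /\
  (forall a b ab, mC a b ab -> mD (F a) (F b) (F ab)).

(* The reduced C*-algebra of a Fell bundle: a C*-algebra whose elements are
   identified with the sections in [reduced_sections E], with the pointwise
   linear structure, the convolution, the involution and the norm [normb]. *)
Record reducedAlgebra (R : realType) (G : etaleGroupoid) (E : fellBundle R G) :=
    ReducedAlgebra {
  red_alg :> cstarAlgebra R ;
  red_sec : red_alg -> section E ;
  red_inj : injective red_sec ;
  red_range : range red_sec = @reduced_sections R G E ;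
  red_linear : forall (k : R[i]) (a b : red_alg) (g : G),
    red_sec (k *: a + b) g = k *: red_sec a g + red_sec b g ;
  red_conv : forall a b : red_alg, conv_defined (red_sec a) (red_sec b) /\
    red_sec (cs_mul a b) = conv (red_sec a) (red_sec b) ;
  red_star : forall a : red_alg, red_sec (cs_star a) = sec_star (red_sec a) ;
  red_norm : forall a : red_alg, (rnorm a)%:E = normb (red_sec a) }.

(* Main.v *)
(* The fibre over a unit [x] is a C*-algebra, over which the families of vectors
   at finitely many elements with source [x] form a Hilbert module.  The norm
   [normb a] is that of convolution by [a] on these modules; equivalently it is
   the supremum of the norms of the finite matrices [a (q i j)], where the
   [q i j] are the quotients of elements with a common source.  All identities
   and estimates in the reduced algebra hold for compactly supported sections,
   whose convolutions are finite sums, and pass to limits because [normb]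
   dominates the norm of every value.

   For a morphism with components [beta] and [phi], the matrices of the image
   of [a] are block diagonal, with blocks [beta (a (phi (s i j)))].  On each
   entry [beta] is bounded by some constant [K].  Applying this bound to the
   powers [(m^* m)^(2^n)] of a matrix [m] and letting [n] grow replaces [K] by 1,
   as for *-homomorphisms of C*-algebras, so the map on sections is contractive.
   It preserves compactly supported sections because [phi] is proper and its
   domain is nice, and convolutions because star-bijectivity lifts the
   factorizations of [phi x] to those of [x]. *)

From HB Require Import structures.
From mathcomp Require Import all_boot all_order all_algebra complex finmap.
From mathcomp Require Import ring lra.
From mathcomp Require Import all_classical all_reals all_analysis summability.
Require Import Defs.

Set Implicit Arguments.
Unset Strict Implicit.
Unset Printing Implicit Defensive.

Import Order.TTheory GRing.Theory Num.Theory.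
Import numFieldNormedType.Exports.
Local Open Scope classical_set_scope.
Local Open Scope ring_scope.
Local Open Scope complex_scope.

(** * Linear identities in a module *)

(** The fibres over units need not be unital, so positivity is developed without spectra: an element
    is positive when it is the square of a self-adjoint one, the unitization is represented by the
    operators [l + h] on the algebra, and square roots come from the iteration
    [t -> (l + h + t^2) / 2]. The hard point is that [x^# ** x] is positive; afterwards the order is
    used through monotonicity of the norm and Cauchy-Schwarz. Contractivity cannot be quoted from a
    single fibre: a fibre morphism also acts over non-units, and a matrix over the bundle is not an
    element of one fibre. The power argument is therefore carried out on the matrices themselves.
    Nothing is Hausdorff, so compact sets need not be closed. Closedness of the sources and ranges
    of products and preimages has to be proved separately from compactness. All estimates are
    phrased with [op_bound]. Each of its instances involves only finitely many values of the
    section, so it survives pointwise limits. This yields completeness and the passage from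
    compactly supported sections to their closure, with sections, not Cauchy classes, as
    elements. *)

Inductive mexp (K : Type) :=
  MVar of nat | MZero | MAdd of mexp K & mexp K | MOpp of mexp K
| MScale of K & mexp K.

Arguments MVar {K}.
Arguments MZero {K}.

Section module_expressions.
Context (K : comNzRingType) (V : lmodType K).

Fixpoint mdenote (env : seq V) (e : mexp K) : V :=
  match e with
  | MVar i => nth 0 env i
  | MZero => 0
  | MAdd a b => mdenote env a + mdenote env b
  | MOpp a => - mdenote env a
  | MScale k a => k *: mdenote env a
  end.

(* [Nat.eqb] rather than [==], so that [cbn] computes the coefficients. *)
Fixpoint mcoef (e : mexp K) (i : nat) : K :=
  match e with
  | MVar j => if Nat.eqb j i then 1 else 0
  | MZero => 0
  | MAdd a b => mcoef a i + mcoef b i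
  | MOpp a => - mcoef a i
  | MScale k a => k * mcoef a i
  end.

Fixpoint same_coefs (n : nat) (a b : mexp K) : Prop :=
  if n is m.+1 then mcoef a m = mcoef b m /\ same_coefs m a b else True.

Lemma mdenoteE (env : seq V) (e : mexp K) :
  mdenote env e = \sum_(i < size env) mcoef e i *: nth 0 env i.
Proof.
elim: e => [j||a IHa b IHb|a IHa|k a IHa] /=.
- have eqbE (i : nat) : Nat.eqb j i = (j == i).
    by apply/idP/eqP => [/PeanoNat.Nat.eqb_eq|/PeanoNat.Nat.eqb_eq].
  have [js|sj] := ltnP j (size env); last first.
    rewrite nth_default // big1 // => i _.
    by rewrite eqbE gtn_eqF ?(leq_trans (ltn_ord i)) // scale0r.
  rewrite (bigD1 (Ordinal js)) //= eqbE eqxx scale1r big1 ?addr0 // => i.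
  by rewrite -val_eqE /= eq_sym eqbE => /negbTE ->; rewrite scale0r.
- by rewrite big1 // => i _; rewrite scale0r.
- by rewrite IHa IHb -big_split; apply: eq_bigr => i _; rewrite scalerDl.
- by rewrite IHa -sumrN; apply: eq_bigr => i _; rewrite scaleNr.
- by rewrite IHa scaler_sumr; apply: eq_bigr => i _; rewrite scalerA.
Qed.

Lemma mdenote_eq (env : seq V) (a b : mexp K) :
  same_coefs (size env) a b -> mdenote env a = mdenote env b.
Proof.
move=> ab; rewrite !mdenoteE; apply: eq_bigr => i _; congr (_ *: _).
have H n : (i < n)%N -> same_coefs n a b -> mcoef a i = mcoef b i; last exact: H ab.
elim: n => //= n IH.
by rewrite ltnS leq_eqVlt => /orP[/eqP -> []|/IH h []].
Qed.

End module_expressions.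

Ltac mindex x env :=
  lazymatch env with
  | @cons _ ?y ?s =>
      match goal with
      | _ => let _ := match goal with _ => constr_eq x y end in constr:(O)
      | _ => let i := mindex x s in constr:(S i)
      end
  end.
Ltac minsert x env :=
  match goal with
  | _ => let _ := mindex x env in env
  | _ => constr:(cons x env)
  end.
Ltac matoms env t :=
  lazymatch t with
  | GRing.add ?a ?b => let e := matoms env a in matoms e b
  | @Algebra.add _ ?a ?b => let e := matoms env a in matoms e b
  | GRing.opp ?a => matoms env a
  | @Algebra.opp _ ?a => matoms env a
  | GRing.natmul ?a 2 => matoms env a
  | GRing.scale _ ?a => matoms env a
  | GRing.zero => env
  | @Algebra.zero _ => env
  | _ => minsert t env
  end.
Ltac mreify K env t :=
  lazymatch t with
  | GRing.add ?a ?b =>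
      let a' := mreify K env a in let b' := mreify K env b in constr:(@MAdd K a' b')
  | @Algebra.add _ ?a ?b =>
      let a' := mreify K env a in let b' := mreify K env b in constr:(@MAdd K a' b')
  | GRing.opp ?a => let a' := mreify K env a in constr:(@MOpp K a')
  | @Algebra.opp _ ?a => let a' := mreify K env a in constr:(@MOpp K a')
  | GRing.natmul ?a 2 => let a' := mreify K env a in constr:(@MAdd K a' a')
  | GRing.scale ?k ?a => let a' := mreify K env a in constr:(@MScale K k a')
  | GRing.zero => constr:(@MZero K)
  | @Algebra.zero _ => constr:(@MZero K)
  | _ => let i := mindex t env in constr:(@MVar K i)
  end.
(** Comparing coefficients leaves one equation in [K] per atom, which [ring] or [field] can close,
    with side relations such as ['i * 'i = -1] where needed. *)
Ltac module_pre K :=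
  match goal with
  | |- @eq ?T ?a ?b =>
      let e0 := constr:(@nil T) in
      let e1 := matoms e0 a in
      let e2 := matoms e1 b in
      let a' := mreify K e2 a in
      let b' := mreify K e2 b in
      refine (@mdenote_eq _ _ e2 a' b' _);
      cbn [same_coefs size mcoef Nat.eqb]; repeat split
  end.

Ltac lmodule R := module_pre R[i]; ring.

(** * Real-valued norms and Cauchy sequences *)

Section real_norm.
Context (R : realType) (V : normedModType R[i]).
Implicit Types u v : V.

Lemma rnormE v : `|v| = (rnorm v)%:C.
Proof.
by have /ger0_Im := normr_ge0 v; rewrite /rnorm; case: `|v| => a b /= ->.
Qed.

Lemma rnorm_ge0 v : 0 <= rnorm v.
Proof. by rewrite -lecR -rnormE; exact: normr_ge0. Qed.

Lemma rnorm0 : rnorm (0 : V) = 0.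
Proof. by rewrite /rnorm normr0. Qed.

Lemma rnorm_eq0 v : (rnorm v == 0) = (v == 0).
Proof. by rewrite -(normr_eq0 v) rnormE eq_complex /= eqxx andbT. Qed.

Lemma rnormD u v : rnorm (u + v) <= rnorm u + rnorm v.
Proof. by rewrite -lecR rmorphD /= -!rnormE ler_normD. Qed.

Lemma rnormN v : rnorm (- v) = rnorm v.
Proof. by rewrite /rnorm normrN. Qed.

Lemma rnormB u v : rnorm (u - v) <= rnorm u + rnorm v.
Proof. by rewrite -(rnormN v) rnormD. Qed.

Lemma rnorm_distC u v : rnorm (u - v) = rnorm (v - u).
Proof. by rewrite -rnormN opprB. Qed.

Lemma rnorm_tri w u v : rnorm (u - v) <= rnorm (u - w) + rnorm (w - v).
Proof. by rewrite -[u - v](subrKA w) rnormD. Qed.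

Lemma rnormZ (k : R[i]) v : rnorm (k *: v) = complex.Re `|k| * rnorm v.
Proof.
rewrite {1}/rnorm normrZ rnormE.
by have /ger0_Im := normr_ge0 k; case: `|k| => a b /= ->; rewrite mul0r subr0.
Qed.

Lemma rnormZr (k : R) v : rnorm (k%:C *: v) = `|k| * rnorm v.
Proof. by rewrite rnormZ normc_def /= expr0n addr0 sqrtr_sqr. Qed.

Lemma rnormMi v : rnorm ('i *: v) = rnorm v.
Proof. by rewrite rnormZ normc_def /= expr0n add0r expr1n sqrtr1 mul1r. Qed.

Lemma rnorm_sum (I : Type) (r : seq I) (P : pred I) (F : I -> V) :
  rnorm (\sum_(i <- r | P i) F i) <= \sum_(i <- r | P i) rnorm (F i).
Proof.
elim/big_rec2: _ => [|i y x _ xy]; first by rewrite rnorm0.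
by apply: le_trans (rnormD _ _) _; rewrite lerD2l.
Qed.

End real_norm.

Section cauchy_sequences.
Context (R : realType) (V : completeNormedModType R[i]).

Lemma cvg_rnorm (u : nat -> V) (l : V) : u @ \oo --> l ->
  forall e : R, 0 < e -> exists N, forall n, (N <= n)%N -> rnorm (l - u n) < e.
Proof.
move=> /cvgrPdist_lt ul e e0; have := ul e%:C; rewrite ltcR => /(_ e0)[N _ hN].
by exists N => n /hN; rewrite rnormE ltcR.
Qed.

Lemma rnorm_cauchy (u : nat -> V) :
  (forall e : R, 0 < e -> exists N, forall m n, (N <= m)%N -> (N <= n)%N ->
    rnorm (u m - u n) < e) ->
  exists l : V, forall e : R, 0 < e -> exists N, forall n, (N <= n)%N ->
    rnorm (l - u n) < e.
Proof.
move=> h; have : cvgn u.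
  apply/cauchy_cvgP/cauchy_exP => -[e e'] /=; rewrite ltcE /= => /andP[/eqP -> e0].
  have [N hN] := h e e0; exists (u N); exists N => // n /= Nn.
  by rewrite -ball_normE /= rnormE ltcR; apply: hN.
by move=> /cvg_rnorm; exists (lim (u @ \oo)).
Qed.

End cauchy_sequences.

(** The second hypothesis forces [s] to be nondecreasing, hence convergent; telescoping transfers
    the Cauchy property to [u]. *)
Lemma rnorm_cauchy_dominated (R : realType) (V : completeNormedModType R[i])
    (u : nat -> V) (s : nat -> R) (B : R) :
  (forall n, s n <= B) -> (forall n, rnorm (u n.+1 - u n) <= s n.+1 - s n) ->
  exists l : V, forall e : R, 0 < e -> exists N, forall n, (N <= n)%N ->
    rnorm (l - u n) < e.
Proof.
move=> sB us; apply: rnorm_cauchy.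
have s_mono n k : s n <= s (n + k)%N.
  elim: k => [|k IH]; rewrite ?addn0 // addnS (le_trans IH) //.
  by have := rnorm_ge0 (u (n + k).+1 - u (n + k)%N); have := us (n + k)%N; lra.
have us' n k : rnorm (u (n + k)%N - u n) <= s (n + k)%N - s n.
  elim: k => [|k IH]; first by rewrite addn0 !subrr rnorm0.
  rewrite addnS; apply: le_trans (rnorm_tri (u (n + k)%N) _ _) _.
  by have := us (n + k)%N; lra.
have cs : cvgn s.
  apply: nondecreasing_is_cvgn; last by exists B => _ [n _ <-].
  by move=> m n mn; rewrite -(subnKC mn).
move=> e e0; have /cvgrPdist_lt/(_ (e / 2 / 2)) := cs.
rewrite !divr_gt0 // => /(_ isT)[N _ hN].
have key m : (N <= m)%N -> rnorm (u m - u N) < e / 2.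
  move=> Nm; have := hN _ (leqnn N); have := hN _ Nm.
  rewrite -(subnKC Nm) /= !ltr_norml => /andP[h1 h2] /andP[h3 h4].
  by have := us' N (m - N)%N; lra.
exists N => m n Nm Nn; apply: le_lt_trans (rnorm_tri (u N) _ _) _.
by rewrite (rnorm_distC (u N)); have := key m Nm; have := key n Nn; lra.
Qed.

(** * Positivity in C*-algebras *)

Section cstar_basics.
Context (R : realType) (A : cstarAlgebra R).
Implicit Types (a b c h p q x y : A) (k : R[i]) (l M : R) (t : R * A).
Local Notation "a ** b" := (cs_mul a b) (at level 40, left associativity).
Local Notation "a ^#" := (cs_star a) (at level 2, format "a ^#").

Lemma csDl a b c : (a + b) ** c = a ** c + b ** c.
Proof. by have := cs_mul_linearl 1 a b c; rewrite !scale1r. Qed.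

Lemma csDr a b c : a ** (b + c) = a ** b + a ** c.
Proof. by have := cs_mul_linearr 1 a b c; rewrite !scale1r. Qed.

Lemma cs0l a : 0 ** a = 0.
Proof. by apply: (addrI (0 ** a)); rewrite -csDl !addr0. Qed.

Lemma cs0r a : a ** 0 = 0.
Proof. by apply: (addrI (a ** 0)); rewrite -csDr !addr0. Qed.

Lemma csZl k a b : (k *: a) ** b = k *: (a ** b).
Proof. by have := cs_mul_linearl k a 0 b; rewrite addr0 cs0l addr0. Qed.

Lemma csZr k a b : a ** (k *: b) = k *: (a ** b).
Proof. by have := cs_mul_linearr k a b 0; rewrite addr0 cs0r addr0. Qed.

Lemma csNl a b : (- a) ** b = - (a ** b).
Proof. by rewrite -scaleN1r csZl scaleN1r. Qed.

Lemma csNr a b : a ** (- b) = - (a ** b).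
Proof. by rewrite -scaleN1r csZr scaleN1r. Qed.

Lemma csBl a b c : (a - b) ** c = a ** c - b ** c.
Proof. by rewrite csDl csNl. Qed.

Definition csE := (csDl, csDr, csZl, csZr, csNl, csNr, cs0l, cs0r).

Lemma cs_starD a b : (a + b)^# = a^# + b^#.
Proof. by have := cs_star_antilinear 1 a b; rewrite conjC1 !scale1r. Qed.

Lemma cs_star0 : 0^# = 0 :> A.
Proof. by apply: (addrI (0^#)); rewrite -cs_starD !addr0. Qed.

Lemma cs_starZ k a : (k *: a)^# = (k^* )%R *: a^#.
Proof. by have := cs_star_antilinear k a 0; rewrite addr0 cs_star0 addr0. Qed.

Lemma cs_starZr l a : (l%:C *: a)^# = l%:C *: a^#.
Proof. by rewrite cs_starZ; congr (_ *: _); exact: conjc_real. Qed.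

Lemma cs_starN a : (- a)^# = - a^#.
Proof. by rewrite -scaleN1r cs_starZ rmorphN1 scaleN1r. Qed.

Lemma cs_starB a b : (a - b)^# = a^# - b^#.
Proof. by rewrite cs_starD cs_starN. Qed.

Lemma cs_rnormM a b : rnorm (a ** b) <= rnorm a * rnorm b.
Proof. by rewrite -lecR rmorphM /= -!rnormE; exact: cs_normM. Qed.

Lemma cs_rnormC a : rnorm (a^# ** a) = rnorm a ^+ 2.
Proof. by apply: complexI; rewrite rmorphXn /= -!rnormE; exact: cs_normC. Qed.

Lemma sqr_le_mul (x y : R) : 0 <= x -> 0 <= y -> x ^+ 2 <= y * x -> x <= y.
Proof.
move=> x0 y0 xy; have [->//|xn0] := eqVneq x 0.
by rewrite -(@ler_pM2r _ x) // lt_def xn0.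
Qed.

Lemma cs_rnorm_star a : rnorm a^# = rnorm a.
Proof.
have le b : rnorm b <= rnorm b^#.
  apply: sqr_le_mul; rewrite ?rnorm_ge0 // -cs_rnormC; exact: cs_rnormM.
by apply/le_anti; rewrite le andbT -[X in _ <= rnorm X]cs_starK le.
Qed.

Lemma cs_rnorm_sq h : h^# = h -> rnorm (h ** h) = rnorm h ^+ 2.
Proof. by move=> hh; rewrite -{1}hh cs_rnormC. Qed.

Lemma cs_rnormC' a : rnorm (a ** a^#) = rnorm a ^+ 2.
Proof. by have := cs_rnormC a^#; rewrite cs_starK cs_rnorm_star. Qed.

(** The test element is [x = a^#]. With no unit to test on, this is how a norm is read off left
    multiplication. *)
Lemma cs_rnorm_faithful a M : 0 <= M ->
  (forall x, rnorm (a ** x) <= M * rnorm x) -> rnorm a <= M.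
Proof.
move=> M0 aM; apply: sqr_le_mul; rewrite ?rnorm_ge0 //.
by have := aM a^#; rewrite cs_rnormC' cs_rnorm_star.
Qed.

(* The pair [(l, h)] stands for the element [l + h] of the unitization, acting
   on [A] by left multiplication. *)
Definition uapp (t : R * A) (x : A) : A := t.1%:C *: x + t.2 ** x.

Definition umul (t t' : R * A) : R * A :=
  (t.1 * t'.1, t.1%:C *: t'.2 + t'.1%:C *: t.2 + t.2 ** t'.2).

Definition ubnd (t : R * A) (M : R) :=
  forall x, rnorm (uapp t x) <= M * rnorm x.

Lemma uapp_mul t t' x : uapp (umul t t') x = uapp t (uapp t' x).
Proof.
by rewrite /uapp /umul /= !(csE, cs_mulA); lmodule R.
Qed.

Lemma ubnd_mul t t' M M' : 0 <= M ->
  ubnd t M -> ubnd t' M' -> ubnd (umul t t') (M * M').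
Proof.
move=> M0 tM tM' x; rewrite uapp_mul (le_trans (tM _)) // -mulrA.
by rewrite ler_wpM2l.
Qed.

Lemma ubnd_le t M M' : M <= M' -> ubnd t M -> ubnd t M'.
Proof.
by move=> MM' tM x; apply: le_trans (tM x) _; rewrite ler_wpM2r ?rnorm_ge0.
Qed.

(** The C*-identity for a self-adjoint operator: [|t x|^2 = |x^# t^2 x|]. *)
Lemma ubnd_sq t M : 0 <= M -> t.2^# = t.2 ->
  ubnd (umul t t) (M ^+ 2) -> ubnd t M.
Proof.
move=> M0 ts tM x.
rewrite -(@ler_pXn2r _ 2) ?nnegrE ?mulr_ge0 ?rnorm_ge0 // exprMn -cs_rnormC.
have -> : (uapp t x)^# ** uapp t x = x^# ** uapp (umul t t) x.
  rewrite uapp_mul /uapp cs_starD cs_starZr cs_starM ts.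
  by rewrite !(csE, cs_mulA); lmodule R.
apply: le_trans (cs_rnormM _ _) _; rewrite cs_rnorm_star.
by have := tM x; have := rnorm_ge0 x; nra.
Qed.

Lemma ubnd_rnorm h M : 0 <= M -> ubnd (0, h) M -> rnorm h <= M.
Proof.
move=> M0 hM; apply: cs_rnorm_faithful => // x.
by have := hM x; rewrite /uapp /= rmorph0 scale0r add0r.
Qed.

Lemma uappD t t' x : uapp (t.1 + t'.1, t.2 + t'.2) x = uapp t x + uapp t' x.
Proof. by rewrite /uapp /= csDl; lmodule R. Qed.

Lemma uappZ (r : R) t x : uapp (r * t.1, r%:C *: t.2) x = r%:C *: uapp t x.
Proof. by rewrite /uapp /= csZl; lmodule R. Qed.

Lemma ubndD t t' M M' : ubnd t M -> ubnd t' M' ->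
  ubnd (t.1 + t'.1, t.2 + t'.2) (M + M').
Proof.
move=> tM tM' x; rewrite uappD mulrDl.
exact: le_trans (rnormD _ _) (lerD (tM x) (tM' x)).
Qed.

Lemma ubndZ (r : R) t M : ubnd t M ->
  ubnd (r * t.1, r%:C *: t.2) (`|r| * M).
Proof. by move=> tM x; rewrite uappZ rnormZr -mulrA ler_wpM2l. Qed.

Lemma ubnd_h h : ubnd (0, h) (rnorm h).
Proof. by move=> x; rewrite /uapp /= rmorph0 scale0r add0r cs_rnormM. Qed.

(* The power series of [1 - sqrt (1 - u)] has nonnegative coefficients, so its
   partial sums at [l + h] are dominated by those at the scalar 1. *)
Fixpoint sqrt_bound (n : nat) : R :=
  if n is m.+1 then (1 + sqrt_bound m ^+ 2) / 2 else 0.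

Fixpoint sqrt_iter (l : R) (h : A) (n : nat) : R * A :=
  if n is m.+1 then
    let t := umul (sqrt_iter l h m) (sqrt_iter l h m) in
    ((l + t.1) / 2, (2^-1)%:C *: (h + t.2))
  else (0, 0).

Lemma sqrt_bound_ge0 n : 0 <= sqrt_bound n.
Proof. by elim: n => //= n IH; nra. Qed.

Lemma sqrt_bound_le1 n : sqrt_bound n <= 1.
Proof. by elim: n => //= n IH; have := sqrt_bound_ge0 n; nra. Qed.

Lemma sqrt_bound_incr n : sqrt_bound n <= sqrt_bound n.+1.
Proof. by rewrite /=; have := sqrt_bound_le1 n; nra. Qed.

Lemma sqrt_iter_bound l h n : ubnd (l, h) 1 ->
  ubnd (sqrt_iter l h n) (sqrt_bound n).
Proof.
move=> lh; elim: n => [|n IH].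
  by move=> x; rewrite /uapp /= cs0l rmorph0 scale0r addr0 rnorm0 mul0r.
have := ubndZ 2^-1 (ubndD lh (ubnd_mul (sqrt_bound_ge0 n) IH IH)).
rewrite ger0_norm ?invr_ge0 //= (mulrC _ (_ + _)) -expr2.
by rewrite (mulrC _ (1 + _)).
Qed.

Lemma sqrt_iter_star l h n : h^# = h ->
  (sqrt_iter l h n).2^# = (sqrt_iter l h n).2.
Proof.
move=> hs; elim: n => [|n IH] /=; first by rewrite cs_star0.
by rewrite cs_starZr !cs_starD !cs_starZr cs_starM hs !IH.
Qed.

Lemma sqrt_iter_comm l h c n : c ** h = h ** c ->
  c ** (sqrt_iter l h n).2 = (sqrt_iter l h n).2 ** c.
Proof.
move=> hc; elim: n => [|n IH] /=; first by rewrite cs0l cs0r.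
by rewrite csZr csZl !csDr !csDl !csZr !csZl hc !IH cs_mulA IH -!cs_mulA IH.
Qed.

End cstar_basics.

(** * Square roots in the unitization *)

Section cstar_square_roots.
Context (R : realType) (A : cstarAlgebra R).
Implicit Types (a b c h p q x y : A) (k : R[i]) (l M : R) (t : R * A).
Local Notation "a ** b" := (cs_mul a b) (at level 40, left associativity).
Local Notation "a ^#" := (cs_star a) (at level 2, format "a ^#").

Lemma uappB t x y : uapp t (x - y) = uapp t x - uapp t y.
Proof. by rewrite /uapp !csE; lmodule R. Qed.

(** Limits are taken through this form: an estimate with error [d * C] for all small [d]. If
    [x > 0], then [d = 1] shows [C > 0], and [d = x / (2 C)], when at most 1, would give
    [x <= x / 2]. *)
Lemma le0_small (x C : R) :
  (forall d, 0 < d -> d <= 1 -> x <= d * C) -> x <= 0.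
Proof.
move=> h; rewrite leNgt; apply/negP => x0.
have C0 : 0 < C by have := h 1 ltr01 (lexx _); rewrite mul1r; exact: lt_le_trans.
have [d1|d1] := leP (x / (2 * C)) 1.
  have := h (x / (2 * C)); rewrite d1 divr_gt0 ?mulr_gt0 // => /(_ isT isT).
  rewrite (_ : x / (2 * C) * C = x / 2); first by lra.
  by field; rewrite gt_eqF.
by have := h 1 ltr01 (lexx _); move: d1; rewrite ltr_pdivlMr ?mulr_gt0 //; lra.
Qed.

Lemma rnorm_eq_small (V : normedModType R[i]) (v : V) (C : R) :
  (forall d, 0 < d -> d <= 1 -> rnorm v <= d * C) -> v = 0.
Proof.
by move=> /le0_small v0; apply/eqP; rewrite -rnorm_eq0 eq_le v0 rnorm_ge0.
Qed.

Lemma cs_eq_small x y (C : R) :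
  (forall d, 0 < d -> d <= 1 -> rnorm (x - y) <= d * C) -> x = y.
Proof. by move=> /rnorm_eq_small/eqP; rewrite subr_eq0 => /eqP. Qed.

(** With [t_n] the iterates, [2 (t_(n+2) - t_(n+1)) = t_(n+1) (t_(n+1) - t_n) + (t_(n+1) - t_n)
    t_n], and [sqrt_bound] satisfies the same recursion. The scalar components are also shown
    nondecreasing, to obtain their limit. *)
Lemma sqrt_iter_incr l h n : 0 <= l <= 1 -> ubnd (l, h) 1 ->
  0 <= (sqrt_iter l h n).1 <= sqrt_bound R n /\
  0 <= (sqrt_iter l h n.+1).1 - (sqrt_iter l h n).1
    <= sqrt_bound R n.+1 - sqrt_bound R n /\
  forall x, rnorm (uapp (sqrt_iter l h n.+1) x - uapp (sqrt_iter l h n) x)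
    <= (sqrt_bound R n.+1 - sqrt_bound R n) * rnorm x.
Proof.
move=> /andP[l0 l1] lh; elim: n => [|n [IH1 [IH2 IH3]]].
  split; first by rewrite /= lexx.
  split; first by rewrite /=; lra.
  move=> x; rewrite [X in _ - X](_ : _ = 0); last first.
    by rewrite /uapp /= rmorph0 scale0r cs0l addr0.
  rewrite !subr0; exact: (sqrt_iter_bound 1 lh).
have b0 := sqrt_bound_ge0 R n; have b1 := sqrt_bound_ge0 R n.+1.
have IH1' : 0 <= (sqrt_iter l h n.+1).1 <= sqrt_bound R n.+1.
  by case/andP: IH1 => t0 t1; case/andP: IH2 => t2 t3; apply/andP; split; lra.
split=> //; split.
  have -> : (sqrt_iter l h n.+2).1 - (sqrt_iter l h n.+1).1 =
      ((sqrt_iter l h n.+1).1 - (sqrt_iter l h n).1) *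
      ((sqrt_iter l h n.+1).1 + (sqrt_iter l h n).1) / 2.
    by rewrite /=; field.
  have -> : sqrt_bound R n.+2 - sqrt_bound R n.+1 =
      (sqrt_bound R n.+1 - sqrt_bound R n) *
      (sqrt_bound R n.+1 + sqrt_bound R n) / 2.
    by rewrite /=; field.
  move: IH1 IH1' IH2 => /andP[t0 t1] /andP[t2 t3] /andP[t4 t5].
  rewrite ler_pM2r ?invr_gt0 // ler_pM //; last exact: lerD.
    by rewrite andbT divr_ge0 // mulr_ge0 // addr_ge0.
  exact: addr_ge0.
move=> x; set t2 := sqrt_iter l h n.+2; set t1 := sqrt_iter l h n.+1.
set t0 := sqrt_iter l h n.
have E2 y : uapp t2 y = (2^-1)%:C *: (uapp (l, h) y + uapp t1 (uapp t1 y)).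
  rewrite -uapp_mul -uappD -uappZ; congr (uapp (_, _) _).
  by rewrite /= mulrC.
have E1 y : uapp t1 y = (2^-1)%:C *: (uapp (l, h) y + uapp t0 (uapp t0 y)).
  rewrite -uapp_mul -uappD -uappZ; congr (uapp (_, _) _).
  by rewrite /= mulrC.
rewrite E2 [X in _ - X]E1.
rewrite (_ : _ - _ = (2^-1)%:C *: (uapp t1 (uapp t1 x - uapp t0 x) +
    (uapp t1 (uapp t0 x) - uapp t0 (uapp t0 x)))); last first.
  by rewrite uappB; lmodule R.
rewrite rnormZr ger0_norm ?invr_ge0 //.
have B1 := sqrt_iter_bound n.+1 lh (uapp t1 x - uapp t0 x).
have B0 := sqrt_iter_bound n lh x; have D1 := IH3 x; have D2 := IH3 (uapp t0 x).
rewrite -/t1 -/t0 in B1 B0 D1 D2.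
apply: (@le_trans _ _ (2^-1 * (sqrt_bound R n.+1 * ((sqrt_bound R n.+1 - sqrt_bound R n) * rnorm x)
   + (sqrt_bound R n.+1 - sqrt_bound R n) * (sqrt_bound R n * rnorm x)))).
  rewrite ler_wpM2l ?invr_ge0 //; apply: le_trans (rnormD _ _) _; apply: lerD.
    by apply: le_trans B1 _; rewrite ler_wpM2l.
  by apply: le_trans D2 _; rewrite ler_wpM2l // subr_ge0 sqrt_bound_incr.
rewrite [sqrt_bound R n.+2]/= -/(sqrt_bound R n.+1).
have -> : sqrt_bound R n.+1 = (1 + sqrt_bound R n ^+ 2) / 2 by [].
by rewrite le_eqVlt; apply/orP; left; apply/eqP; field.
Qed.

(** For [t = r + s] the two equations say [2 t = (l + h) + t^2], that is
    [(1 - t)^2 = 1 - (l + h)]. *)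
Lemma sqrt_exists l h : h^# = h -> 0 <= l <= 1 -> ubnd (l, h) 1 ->
  exists (r : R) (s : A), [/\ s^# = s, 0 <= r <= 1, r *+ 2 = l + r ^+ 2,
    s *+ 2 = h + r%:C *: s *+ 2 + s ** s & ubnd (r, s) 1] /\
    forall c, c ** h = h ** c -> c ** s = s ** c.
Proof.
move=> hs l01 lh; set T := sqrt_iter l h; have incr n := sqrt_iter_incr n l01 lh.
have T1_mono : {homo (fun n => (T n).1) : m n / (m <= n)%N >-> m <= n}.
  apply: homo_leq => //; first exact: le_trans.
  by move=> n; have [_ [/andP[]]] := incr n; rewrite subr_ge0.
have T1_le n : (T n).1 <= 1.
  by have [/andP[_ h1] _] := incr n; rewrite (le_trans h1) // sqrt_bound_le1.
have c1 : cvgn (fun n => (T n).1).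
  by apply: nondecreasing_is_cvgn => //; exists 1 => _ [n _ <-].
set r := lim ((fun n => (T n).1) @ \oo).
have [s hS] : exists s : A, forall e : R, 0 < e -> exists N, forall n, (N <= n)%N ->
    rnorm (s - (T n).2) < e.
  (* The factor 2: an increment of the second component is an increment of the operator minus one of
     the scalar, and each is at most an increment of [sqrt_bound]. *)
  apply: (@rnorm_cauchy_dominated _ _ _ (fun n => 2 * sqrt_bound R n) 2).
    by move=> n; have := sqrt_bound_le1 R n; lra.
  move=> n; rewrite -mulrBr; apply: cs_rnorm_faithful.
    by rewrite mulr_ge0 // subr_ge0 sqrt_bound_incr.
  move=> x; have [_ [/andP[D1 D1'] /(_ x) D2]] := incr n.
  rewrite (_ : _ ** x = (uapp (T n.+1) x - uapp (T n) x)
    - ((T n.+1).1 - (T n).1)%:C *: x); last first.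
    by rewrite /uapp !csE; lmodule R.
  apply: le_trans (rnormB _ _) _; rewrite rnormZr ger0_norm //.
  by have D3 := ler_wpM2r (rnorm_ge0 x) D1'; lra.
have near (d : R) : 0 < d -> exists n, [/\ `|r - (T n).1| <= d, `|r - (T n.+1).1| <= d,
    rnorm (s - (T n).2) <= d & rnorm (s - (T n.+1).2) <= d].
  move=> d0; have [N hN] := hS d d0.
  have /cvgrPdist_lt/(_ d d0)[N' _ hN'] := c1.
  exists (maxn N N'); split; apply/ltW;
    by [apply: hN'; rewrite /= ?leqW ?leq_maxr|apply: hN; rewrite ?leqW ?leq_maxl].
have r_ge0 : 0 <= r.
  apply: limr_ge => //; apply: nearW => n.
  by have [/andP[]] := incr n.
have r_le1 : r <= 1 by apply: limr_le => //; apply: nearW => n.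
exists r, s; split; first split => //.
- apply: (@cs_eq_small _ _ 2) => d d0 d1; have [n [_ _ dn _]] := near d d0.
  rewrite (_ : _ - _ = (s - (T n).2)^# - (s - (T n).2)); last first.
    by rewrite cs_starB /T sqrt_iter_star //; lmodule R.
  by apply: le_trans (rnormB _ _) _; rewrite cs_rnorm_star; lra.
- by rewrite r_ge0.
- apply/eqP; rewrite -subr_eq0 -normr_eq0 eq_le normr_ge0 andbT.
  apply: (@le0_small _ 4) => d d0 d1; have [n [e1 e2 _ _]] := near d d0.
  rewrite (_ : _ - _ = 2 * (r - (T n.+1).1) - (r - (T n).1) * (r + (T n).1)); last first.
    by rewrite /=; field.
  apply: le_trans (ler_normB _ _) _; rewrite !normrM.
  have [/andP[t0 _] _] := incr n.
  rewrite normr_nat (ger0_norm (_ : 0 <= r + (T n).1)) ?addr_ge0 //.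
  have tn : 0 <= (T n).1 by [].
  have : `|r - (T n).1| * (r + (T n).1) <= `|r - (T n).1| * 2.
    by rewrite ler_wpM2l //; have := T1_le n; lra.
  by lra.
(* The constant adds up [E1] to [E5]: [5 = 2 + 2 + 1] and [4 = 2 + 1 + 1], using [d^2 <= d] in
   [E5]. *)
- apply: (@cs_eq_small _ _ (5 + 4 * rnorm s)) => d d0 d1.
  have [n [e1 e2 dn dn1]] := near d d0.
  rewrite (_ : _ - _ = (s - (T n.+1).2) *+ 2
     - ((r - (T n).1)%:C *: s *+ 2 + ((T n).1)%:C *: (s - (T n).2) *+ 2
     + s ** (s - (T n).2) + (s - (T n).2) ** (T n).2)); last first.
    by rewrite /= -/(T n) !csE; module_pre R[i]; field.
  have [/andP[t0 _] _] := incr n; have tn : 0 <= (T n).1 by [].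
  have t1 := T1_le n.
  have sT : rnorm (T n).2 <= rnorm s + d.
    rewrite -[(T n).2](subKr s); apply: le_trans (rnormB _ _) _.
    by rewrite lerD2l.
  apply: le_trans (rnormB _ _) _; rewrite mulr2n.
  have E1 : rnorm (s - (T n.+1).2 + (s - (T n.+1).2)) <= 2 * d.
    by apply: le_trans (rnormD _ _) _; lra.
  have E2 : rnorm ((r - (T n).1)%:C *: s *+ 2) <= 2 * (d * rnorm s).
    rewrite mulr2n; apply: le_trans (rnormD _ _) _.
    by rewrite rnormZr; have := rnorm_ge0 s; nra.
  have E3 : rnorm ((T n).1%:C *: (s - (T n).2) *+ 2) <= 2 * d.
    rewrite mulr2n; apply: le_trans (rnormD _ _) _.
    rewrite rnormZr ger0_norm //; have := rnorm_ge0 (s - (T n).2); nra.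
  have E4 : rnorm (s ** (s - (T n).2)) <= rnorm s * d.
    by apply: le_trans (cs_rnormM _ _) _; rewrite ler_wpM2l ?rnorm_ge0.
  have E5 : rnorm ((s - (T n).2) ** (T n).2) <= d * (rnorm s + d).
    apply: le_trans (cs_rnormM _ _) _.
    by rewrite ler_pM ?rnorm_ge0.
  have := rnormD ((r - (T n).1)%:C *: s *+ 2 + (T n).1%:C *: (s - (T n).2) *+ 2
    + s ** (s - (T n).2)) ((s - (T n).2) ** (T n).2).
  have := rnormD ((r - (T n).1)%:C *: s *+ 2 + (T n).1%:C *: (s - (T n).2) *+ 2)
    (s ** (s - (T n).2)).
  have := rnormD ((r - (T n).1)%:C *: s *+ 2) ((T n).1%:C *: (s - (T n).2) *+ 2).
  by nra.
- move=> x; rewrite -subr_le0; apply: (@le0_small _ (2 * rnorm x)) => d d0 d1.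
  have [n [e1 _ dn _]] := near d d0.
  rewrite (_ : uapp _ x = uapp (T n) x + ((r - (T n).1)%:C *: x + (s - (T n).2) ** x)); last first.
    by rewrite /uapp /= !csE; lmodule R.
  have E1 := rnormD (uapp (T n) x) ((r - (T n).1)%:C *: x + (s - (T n).2) ** x).
  have E2 := rnormD ((r - (T n).1)%:C *: x) ((s - (T n).2) ** x).
  rewrite rnormZr in E2; have E3 := cs_rnormM (s - (T n).2) x.
  have E4 := sqrt_iter_bound n lh x; have E5 := sqrt_bound_le1 R n.
  rewrite -/T in E4; have := rnorm_ge0 x; nra.
- move=> c ch; apply: (@cs_eq_small _ _ (2 * rnorm c)) => d d0 d1.
  have [n [_ _ dn _]] := near d d0.
  have E := sqrt_iter_comm l n ch.
  rewrite (_ : _ - _ = c ** (s - (T n).2) - (s - (T n).2) ** c); last first.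
    by rewrite !csE /T E; lmodule R.
  apply: le_trans (rnormB _ _) _.
  have := cs_rnormM c (s - (T n).2); have := cs_rnormM (s - (T n).2) c.
  by have := rnorm_ge0 c; nra.
Qed.

End cstar_square_roots.

(** * Positive elements and norm inequalities *)

Section cstar_positivity.
Context (R : realType) (A : cstarAlgebra R).
Implicit Types (a b c h p q x y : A) (k : R[i]) (l M t : R).
Local Notation "a ** b" := (cs_mul a b) (at level 40, left associativity).
Local Notation "a ^#" := (cs_star a) (at level 2, format "a ^#").

(** The case [l = 0]: the scalar part solves [2 r = r^2] with [r <= 1], so it vanishes, and
    [s = 1 - sqrt (1 - h)] lies in [A] itself. *)
Lemma small_sqrt h : h^# = h -> rnorm h <= 1 ->
  exists s, [/\ s^# = s, s *+ 2 = h + s ** s, rnorm s <= 1 &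
    forall c, c ** h = h ** c -> c ** s = s ** c].
Proof.
move=> hs h1; have [||r [s [[ss /andP[r0 r1] rE sE rs] sc]]] := sqrt_exists (l := 0) hs.
- by rewrite lexx ler01.
- by apply: ubnd_le h1 _; exact: ubnd_h.
have {}r0 : r = 0.
  have [//|rn0] := eqVneq r 0; have : r *+ 2 = r * r by rewrite rE add0r expr2.
  by move/esym; rewrite mulrC mulr2n -mulr2n -mulr_natr => /(mulfI rn0); lra.
exists s; split => //; first by rewrite [LHS]sE r0 rmorph0 scale0r mul0rn addr0.
by apply: ubnd_rnorm => //; move: rs; rewrite r0.
Qed.

(** Positivity without a unit or a spectrum. That every [x^# ** x] is of this form is the deep fact
    [star_square_pos]. *)
Definition cpos h := exists2 y : A, y^# = y & h = y ** y.

Lemma cpos_star h : cpos h -> h^# = h.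
Proof. by move=> [y ys ->]; rewrite cs_starM ys. Qed.

(** [sqrt_exists] at [1 - h]: the scalar part solves [2 r = 1 + r^2], so [r = 1], and the root
    [1 - (r + s) = - s] of [h] has no scalar part. *)
Lemma sqrt_pos h : h^# = h -> ubnd (1, - h) 1 ->
  exists z, [/\ z^# = z, z ** z = h, ubnd (1, - z) 1 &
    forall c, c ** h = h ** c -> c ** z = z ** c].
Proof.
move=> hs h1; have [|||r [s [[ss /andP[r0 r1] rE sE rs] sc]]] :=
  @sqrt_exists _ _ 1 (- h) _ _ _; rewrite ?cs_starN ?hs ?ler01 ?lexx //.
have {}r1 : r = 1.
  apply/eqP; rewrite -subr_eq0 -sqrf_eq0.
  by rewrite (_ : _ ^+ 2 = 1 + r ^+ 2 - r *+ 2); [rewrite -rE subrr|ring].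
exists (- s); split; first by rewrite cs_starN ss.
- rewrite !csE opprK; move: sE; rewrite r1 scale1r => sE.
  by apply: (addrI (- h + s *+ 2)); rewrite -sE; lmodule R.
- by move: rs; rewrite opprK r1.
- by move=> c ch; rewrite !csE sc // !csE ch.
Qed.

Lemma conj_i : (('i : R[i])^* )%R = - 'i.
Proof. by apply/eqP; rewrite eq_complex /= oppr0 !eqxx. Qed.

(* If [b = 1 - s] and [b^2 = 1 - y^2] then [y + i b] and [y - i b] are
   isometric, and [b] is half the difference of two isometries. *)
Lemma square_bound y : y^# = y -> rnorm y <= 1 -> ubnd (1, - (y ** y)) 1.
Proof.
move=> ys y1; have yy1 : rnorm (y ** y) <= 1.
  by apply: le_trans (cs_rnormM _ _) _; have := rnorm_ge0 y; nra.
have [|s [ss sE _ sc]] := small_sqrt _ yy1; first by rewrite cs_starM ys.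
have ys_comm : y ** s = s ** y by apply: sc; rewrite cs_mulA.
pose b x := x - s ** x.
have isom (e : R[i]) x : e * e = -1 -> (e^* )%R = - e ->
    rnorm (y ** x + e *: b x) = rnorm x.
  move=> e2 eJ; apply/eqP; rewrite -(@eqrXn2 _ 2) ?rnorm_ge0 // -!cs_rnormC.
  apply/eqP; congr rnorm.
  rewrite cs_starD cs_starM ys cs_starZ eJ /b cs_starB cs_starM ss.
  have w1 : x^# ** y ** y ** x = x^# ** s ** x *+ 2 - x^# ** s ** s ** x.
    rewrite -(cs_mulA x^# y y) -(addrK (s ** s) (y ** y)) -sE mulr2n.
    by rewrite !(csE, cs_mulA) mulr2n.
  have w2 : x^# ** y ** s ** x = x^# ** s ** y ** x.
    by rewrite -(cs_mulA x^#) ys_comm cs_mulA.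
  by rewrite !(csE, cs_mulA) w1 w2; module_pre R[i]; ring: e2.
have b_le x : rnorm (b x) <= rnorm x.
  have i2 : ('i : R[i]) * 'i = -1 by rewrite -expr2 sqr_i.
  have E1 := isom 'i x i2 conj_i.
  have i2' : - ('i : R[i]) * - 'i = -1 by rewrite mulrNN.
  have iJ : ((- ('i : R[i]))^* )%R = - - 'i by rewrite -conj_i conjCK conj_i opprK.
  have E2 := isom _ x i2' iJ.
  have : rnorm (2%:C *: ('i *: b x)) = 2 * rnorm (b x).
    by rewrite rnormZr rnormMi normr_nat.
  rewrite (_ : _ *: _ = (y ** x + 'i *: b x) - (y ** x + - 'i *: b x)); last first.
    by module_pre R[i]; ring.
  by have := rnormB (y ** x + 'i *: b x) (y ** x + - 'i *: b x); lra.
move=> x; rewrite mul1r (_ : uapp _ x = b (b x)).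
  exact: le_trans (b_le _) (b_le _).
rewrite /b /uapp /= !(csE, cs_mulA).
rewrite -(addrK (s ** s) (y ** y)) -sE mulr2n !(csE, cs_mulA).
by rewrite rmorph1; lmodule R.
Qed.

Lemma bound_cpos_sqrt h t : h^# = h -> 0 < t -> ubnd (t, - h) t ->
  exists z, [/\ z^# = z, z ** z = h, ubnd (Num.sqrt t, - z) (Num.sqrt t) &
    forall c, c ** h = h ** c -> c ** z = z ** c].
Proof.
move=> hs t0 ht; have st0 : 0 < Num.sqrt t by rewrite sqrtr_gt0.
have [||z [zs zE zb zc]] := @sqrt_pos (t^-1%:C *: h).
- by rewrite cs_starZr hs.
- have := ubndZ t^-1 ht; rewrite ger0_norm ?invr_ge0 ?ltW //= mulVf ?gt_eqF //.
  by rewrite scalerN.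
exists ((Num.sqrt t)%:C *: z); split.
- by rewrite cs_starZr zs.
- rewrite csZl csZr scalerA -rmorphM /= -expr2 sqr_sqrtr ?ltW // zE scalerA.
  by rewrite -rmorphM /= divff ?gt_eqF // scale1r.
- have := ubndZ (Num.sqrt t) zb; rewrite ger0_norm ?sqrtr_ge0 //= !mulr1.
  by rewrite scalerN.
- move=> c ch; rewrite csZr csZl zc //.
  by rewrite csZr csZl ch.
Qed.

(** With its converse [cpos_bound], this turns positivity into the norm inequality [|t - h| <= t],
    which is visibly stable under sums ([cposD]). *)
Lemma bound_cpos h t : h^# = h -> 0 < t -> ubnd (t, - h) t -> cpos h.
Proof.
move=> hs t0 /(bound_cpos_sqrt hs t0)[z [zs zE _ _]].
by exists z.
Qed.

Lemma cpos_bound h t : cpos h -> 0 < t -> rnorm h <= t -> ubnd (t, - h) t.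
Proof.
move=> [y ys ->] t0 yt; have st0 : 0 < Num.sqrt t by rewrite sqrtr_gt0.
rewrite cs_rnorm_sq // in yt.
have := @square_bound ((Num.sqrt t)^-1%:C *: y); rewrite cs_starZr ys => /(_ erefl).
rewrite rnormZr ger0_norm ?invr_ge0 ?(ltW st0) // mulrC ler_pdivrMr // mul1r.
rewrite -[rnorm y](ger0_norm (rnorm_ge0 _)) -sqrtr_sqr ler_wsqrtr // => /(_ isT).
move=> /(ubndZ t); rewrite ger0_norm ?ltW //= !mulr1 csZl csZr scalerA.
rewrite -rmorphM /= -expr2 exprVn sqr_sqrtr ?ltW // scalerN scalerA -rmorphM /=.
by rewrite divff ?gt_eqF // scale1r.
Qed.

Lemma cpos0 : cpos 0.
Proof. by exists 0; rewrite ?cs_star0 ?cs0l. Qed.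

Lemma cposZ r p : 0 <= r -> cpos p -> cpos (r%:C *: p).
Proof.
move=> r0 [y ys ->]; exists ((Num.sqrt r)%:C *: y); rewrite ?cs_starZr ?ys //.
by rewrite csZl csZr scalerA -rmorphM /= -expr2 sqr_sqrtr.
Qed.

Lemma cposD p q : cpos p -> cpos q -> cpos (p + q).
Proof.
move=> P Q; apply: (@bound_cpos _ ((rnorm p + 1) + (rnorm q + 1))).
- by rewrite cs_starD !cpos_star.
- by have := rnorm_ge0 p; have := rnorm_ge0 q; lra.
rewrite opprD; apply: (@ubndD _ _ (rnorm p + 1, - p) (rnorm q + 1, - q)).
- by apply: cpos_bound => //; have := rnorm_ge0 p; lra.
- by apply: cpos_bound => //; have := rnorm_ge0 q; lra.
Qed.

Lemma cpos_sum (I : Type) (r : seq I) (P : pred I) (F : I -> A) :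
  (forall i, P i -> cpos (F i)) -> cpos (\sum_(i <- r | P i) F i).
Proof. by move=> PF; elim/big_ind: _ => //; [exact: cpos0|exact: cposD]. Qed.

(* [(M + h)^2 - (M - h)^2 = 4 M h]. *)
Lemma ubnd_pm h M t : 0 <= M ->
  ubnd (t, h) M -> ubnd (t, - h) M -> 0 <= t -> 2 * t * rnorm h <= M ^+ 2.
Proof.
move=> M0 hM h'M t0; have [->|tn0] := eqVneq t 0.
  by rewrite mulr0 mul0r sqr_ge0.
have H1 := ubnd_mul M0 hM hM; have H2 := ubnd_mul M0 h'M h'M.
suff : rnorm ((4 * t)%:C *: h) <= 2 * M ^+ 2.
  by rewrite rnormZr ger0_norm ?mulr_ge0 //; lra.
apply: cs_rnorm_faithful => [|x]; first by rewrite mulr_ge0 ?sqr_ge0.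
rewrite (_ : _ ** x = uapp (umul (t, h) (t, h)) x - uapp (umul (t, - h) (t, - h)) x).
  by apply: le_trans (rnormB _ _) _; have := H1 x; have := H2 x; lra.
by rewrite !uapp_mul /uapp /= !(csE, cs_mulA); lmodule R.
Qed.

(** [ubnd_pm] with [M = t = |h|] gives [2 |h|^2 <= |h|^2]. *)
Lemma cpos_antisym h : cpos h -> cpos (- h) -> h = 0.
Proof.
move=> P Q; apply/eqP; rewrite -rnorm_eq0; apply/negPn/negP => hn0.
have h0 : 0 < rnorm h by rewrite lt_def hn0 rnorm_ge0.
have := @ubnd_pm h (rnorm h) (rnorm h) (ltW h0) _ (cpos_bound P h0 (lexx _)) (ltW h0).
have := cpos_bound Q h0; rewrite opprK rnormN => /(_ (lexx _)) H /(_ H).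
by nra.
Qed.

(** A crude first bound, sharpened to 1 in [cpos_norm_le1]. For [c = |p|] both [c + 1 - p] and
    [c + 1 + p = (c + 1 - q) + (p + q)] have norm at most [c + 2], so [2 (c + 1) c <= (c + 2)^2],
    whence [c <= 4]. *)
Lemma cpos_norm4 p q : cpos p -> cpos q -> rnorm (p + q) <= 1 -> rnorm p <= 4.
Proof.
move=> P Q pq; set c := rnorm p; have c0 : 0 <= c := rnorm_ge0 p.
have c1 : 0 < c + 1 by lra.
have qc : rnorm q <= c + 1.
  rewrite (_ : q = p + q - p); last by lmodule R.
  by apply: le_trans (rnormB _ _) _; rewrite /c; lra.
have b1 := cpos_bound Q c1 qc.
have b2 : ubnd (c + 1, - p) (c + 2).
  by apply: ubnd_le (cpos_bound P c1 _); rewrite /c; lra.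
have b3 : ubnd (c + 1, p) (c + 2).
  have := ubndD b1 (ubnd_h (p + q)); rewrite /= addr0 => H.
  rewrite (_ : p = - q + (p + q)); last by lmodule R.
  by apply: ubnd_le H; lra.
have := ubnd_pm _ b3 b2 (ltW c1); rewrite -/c => H.
have {}H := H ltac:(lra); have [//|] := leP c 4; nra.
Qed.

End cstar_positivity.

(** * Positivity of [x^# ** x], monotonicity of the norm, Cauchy-Schwarz *)

Section cstar_star_positive.
Context (R : realType) (A : cstarAlgebra R).
Implicit Types (a b c h p q x y : A) (k : R[i]) (l M : R) (t : R * A).
Local Notation "a ** b" := (cs_mul a b) (at level 40, left associativity).
Local Notation "a ^#" := (cs_star a) (at level 2, format "a ^#").

Lemma bernoulli (d : R) n : 0 <= d -> 1 + n%:R * d <= (1 + d) ^+ n.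
Proof.
move=> d0; elim: n => [|n IH]; first by rewrite mul0r addr0 expr0.
rewrite exprS -natr1; have n0 : 0 <= n%:R * d by rewrite mulr_ge0.
have := ler_wpM2l (_ : 0 <= 1 + d) IH; rewrite addr_ge0 // => /(_ isT); nra.
Qed.

Lemma pow2_large (C : R) : exists m, C <= (2 ^ m)%:R.
Proof.
exists (Num.bound C); apply: le_trans (ler_norm C) _.
apply/ltW; apply: lt_le_trans (archi_boundP (normr_ge0 C)) _.
by rewrite ler_nat (leq_trans (ltnW (ltn_expl _ (ltnSn 1)))) // leq_pexp2l //
  /Num.bound normr_id.
Qed.

(** Bernoulli alone is only linear with slope [d]; its square is quadratic. For [N = 2^m >= 2 / d^2]
    one has [(1 + N d)^2 >= 1 + 2 N]. *)
Lemma pow2_growth (d : R) : 0 < d -> exists m, 1 + (2 ^ m)%:R <= (1 + d) ^+ (2 ^ m).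
Proof.
move=> d0; have [m hm] := pow2_large (2 / d ^+ 2); exists m.+1.
rewrite ler_pdivrMr ?exprn_gt0 // in hm.
rewrite expnSr exprM natrM; have B := bernoulli (2 ^ m) (ltW d0).
have : (1 + (2 ^ m)%:R * d) ^+ 2 <= ((1 + d) ^+ (2 ^ m)) ^+ 2.
  by rewrite ler_pXn2r // nnegrE ?exprn_ge0 ?addr_ge0 ?mulr_ge0 // ltW.
apply: le_trans; set N := (2 ^ m)%:R : R in hm *.
have N0 : 0 <= N by []; nra.
Qed.

Lemma pow2_le1 (c C : R) : 0 <= c -> (forall m, c ^+ (2 ^ m) <= C) -> c <= 1.
Proof.
move=> c0 cC; rewrite leNgt; apply/negP => c1.
have d0 : 0 < c - 1 by rewrite subr_gt0.
have [m hm] := pow2_large (C / (c - 1)); rewrite ler_pdivrMr // in hm.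
have := bernoulli (2 ^ m) (ltW d0); rewrite subrKC => B.
by have := cC m; lra.
Qed.

Fixpoint upow2 t (m : nat) : R * A :=
  if m is n.+1 then umul (upow2 t n) (upow2 t n) else t.

Lemma uapp_upow2 t m x : uapp (upow2 t m) x = iter (2 ^ m) (uapp t) x.
Proof.
elim: m x => [//|m IH] x; rewrite /= uapp_mul !IH -iterD.
by rewrite addnn -mul2n -expnS.
Qed.

Lemma upow2_star t m : t.2^# = t.2 -> (upow2 t m).2^# = (upow2 t m).2.
Proof. by move=> ts; elim: m => //= m IH; rewrite !cs_starD cs_starM !cs_starZr IH. Qed.

Lemma upow2_bound t m M : 0 <= M -> t.2^# = t.2 ->
  ubnd (upow2 t m) (M ^+ (2 ^ m)) -> ubnd t M.
Proof.
move=> M0 ts; elim: m => [|m IH] //= H; apply: IH.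
apply: ubnd_sq; rewrite ?exprn_ge0 ?upow2_star //.
by rewrite -exprM -expnSr.
Qed.

(* Kelley-Vaught: [(1 + k)^n = 1 - x^* (sum_(j < n) (1 - x x^* )^j) x] grows only
   linearly when [k = - x^* x] and [x x^*] are positive. *)
Lemma star_square_neg_small x : rnorm x <= 1 -> cpos (- (x^# ** x)) -> x = 0.
Proof.
move=> x1; set k := - (x^# ** x) => K; set p := x ** x^#.
have ps : p^# = p by rewrite cs_starM cs_starK.
have P : cpos p.
  (* [u] and [v] are, up to sign, twice the real and imaginary parts of [x], so
     [x x^# + x^# x = (u^2 + v^2) / 2] and [p] becomes a sum of positive elements. *)
  pose u := x + x^#; pose v := 'i *: (x - x^#).
  have us : u^# = u by rewrite cs_starD cs_starK addrC.
  have vs : v^# = v.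
    by rewrite cs_starZ conj_i cs_starB cs_starK scaleNr -scalerN opprB.
  rewrite (_ : p = 2^-1%:C *: (u ** u + v ** v) + k).
    by apply: cposD => //; apply: cposZ; [rewrite invr_ge0|apply: cposD; [exists u|exists v]].
  have i2 : ('i : R[i]) * 'i = -1 by rewrite -expr2 sqr_i.
  by rewrite /p /k /u /v !csE; module_pre R[i]; field: i2.
have pb : ubnd (1, - p) 1.
  apply: cpos_bound => //; apply: le_trans (cs_rnormM _ _) _.
  by rewrite cs_rnorm_star; have := rnorm_ge0 x; nra.
(* [V n] is the operator [sum_(j < n) (1 - p)^j]; as [1 - p] is contractive, its norm is at most
   [n]. *)
pose V n := iter n (fun v : A -> A => fun z => z + uapp (1, - p) (v z)) (fun=> 0).
have V_le n z : rnorm (V n z) <= n%:R * rnorm z.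
  elim: n => [|n IH] /=; first by rewrite rnorm0 mul0r.
  apply: le_trans (rnormD _ _) _; rewrite -natr1.
  by have := pb (V n z); rewrite -/(V n); lra.
have TV n y : iter n (uapp (1, k)) y = y - x^# ** V n (x ** y).
  elim: n => [|n IH]; first by rewrite /= cs0r subr0.
  rewrite iterS IH [V n.+1]/V iterS -/(V n) /uapp /= /k /p !(csE, cs_mulA).
  by rewrite rmorph1; lmodule R.
have Tb m : ubnd (upow2 (1, k) m) (1 + (2 ^ m)%:R).
  move=> y; rewrite uapp_upow2 TV; apply: le_trans (rnormB _ _) _.
  rewrite mulrDl mul1r lerD2l; apply: le_trans (cs_rnormM _ _) _.
  rewrite cs_rnorm_star; apply: (@le_trans _ _ (1 * rnorm (V (2 ^ m)%N (x ** y)))).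
    by rewrite ler_wpM2r // rnorm_ge0.
  rewrite mul1r (le_trans (V_le _ _)) // ler_wpM2l //.
  apply: le_trans (cs_rnormM _ _) _; have := rnorm_ge0 y; nra.
have T1 : ubnd (1, k) 1.
  move=> y; rewrite mul1r -subr_le0; apply: (@le0_small _ _ (rnorm y)) => d d0 _.
  have [m hm] := pow2_growth d0.
  have d1 : 0 <= 1 + d by lra.
  by have := @upow2_bound (1, k) m (1 + d) d1 (cpos_star K) (ubnd_le hm (Tb m)) y; lra.
have K' : cpos (- k).
  apply: (@bound_cpos _ _ _ 1) => //; last by rewrite opprK.
  by rewrite cs_starN (cpos_star K).
have /eqP := cpos_antisym K K'.
by rewrite oppr_eq0 -rnorm_eq0 cs_rnormC expf_eq0 /= rnorm_eq0 => /eqP.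
Qed.

Lemma star_square_neg x : cpos (- (x^# ** x)) -> x = 0.
Proof.
have [->//|x0] := eqVneq x 0; move=> P; exfalso.
have nx : 0 < rnorm x by rewrite lt_def rnorm_eq0 x0 rnorm_ge0.
have := @star_square_neg_small ((rnorm x)^-1%:C *: x).
rewrite rnormZr ger0_norm ?invr_ge0 ?(ltW nx) // mulVf ?gt_eqF // lexx.
rewrite cs_starZr csZl csZr scalerA -rmorphM -scalerN => /(_ isT) /= H.
have i0 : 0 <= (rnorm x)^-1 by rewrite invr_ge0 ltW.
have /H/eqP := cposZ (mulr_ge0 i0 i0) P; rewrite scaler_eq0 (negbTE x0) orbF.
by rewrite fmorph_eq0 invr_eq0 gt_eqF.
Qed.

(** Let [z = |h|] be the root of [h^2] and [c = z - h], twice the negative part of [h]. If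
    [w^2 = z], then [c h c = - (w c)^2], so [star_square_neg] applies to [x c] and gives [x c = 0].
    Hence [h c = z c = 0], so [c^2 = 0] and [h = z = w^2]. *)
Lemma star_square_pos_small x : rnorm x <= 1 -> cpos (x^# ** x).
Proof.
move=> x1; set h := x^# ** x; have hs : h^# = h by rewrite cs_starM cs_starK.
have h1 : rnorm h <= 1 by rewrite cs_rnormC; have := rnorm_ge0 x; nra.
have [|z [zs zE zb zc]] := sqrt_pos (h := h ** h) _ (square_bound hs h1).
  by rewrite cs_starM hs.
have hz : h ** z = z ** h by apply: zc; rewrite cs_mulA.
have [w [ws wE _ wc]] := sqrt_pos zs zb.
pose c := z - h; have cs : c^# = c by rewrite cs_starB zs hs.
have cz : c ** z = z ** c by rewrite !csE hz.
have cw : c ** w = w ** c by exact: wc.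
have hc : h ** c = - (z ** c) by rewrite !csE -zE hz; lmodule R.
have xc : x ** c = 0.
  apply: star_square_neg; exists (w ** c); first by rewrite cs_starM cs ws.
  rewrite cs_starM cs cs_mulA -(cs_mulA c _ x) -/h -(cs_mulA c h c) hc.
  by rewrite csNr opprK -wE !cs_mulA cw.
have hc0 : h ** c = 0 by rewrite /h -cs_mulA xc cs0r.
have zc0 : z ** c = 0 by apply: oppr_inj; rewrite -hc oppr0.
have /eqP : rnorm c ^+ 2 = 0 by rewrite -cs_rnormC cs csBl zc0 hc0 subr0 rnorm0.
rewrite sqrf_eq0 rnorm_eq0 subr_eq0 => /eqP <-.
by exists w.
Qed.

Lemma star_square_pos x : cpos (x^# ** x).
Proof.
have [->|x0] := eqVneq x 0; first by rewrite cs0r; exact: cpos0.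
have nx : 0 < rnorm x by rewrite lt_def rnorm_eq0 x0 rnorm_ge0.
have := @star_square_pos_small ((rnorm x)^-1%:C *: x).
rewrite rnormZr ger0_norm ?invr_ge0 ?(ltW nx) // mulVf ?gt_eqF // lexx.
move=> /(_ isT) /(cposZ (sqr_ge0 (rnorm x))).
rewrite cs_starZr csZl csZr !scalerA -!rmorphM /= (_ : _ * _ = 1); first by rewrite scale1r.
by field; rewrite gt_eqF.
Qed.

Lemma cpos_conj p x : cpos p -> cpos (x^# ** p ** x).
Proof.
move=> [y ys ->]; rewrite (_ : _ ** x = (y ** x)^# ** (y ** x)).
  exact: star_square_pos.
by rewrite cs_starM ys !cs_mulA.
Qed.

(** [1 - h = (1 - s)^2] by [small_sqrt], so the difference is [z^# ** z] with [z = (1 - s) x]. *)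
Lemma cpos_contract h x : h^# = h -> rnorm h <= 1 -> cpos (x^# ** x - x^# ** h ** x).
Proof.
move=> hs h1; have [s [ss sE _ _]] := small_sqrt hs h1.
rewrite (_ : _ - _ = (x - s ** x)^# ** (x - s ** x)); first exact: star_square_pos.
rewrite cs_starB cs_starM ss (_ : h = s *+ 2 - s ** s); last by rewrite sE addrK.
by rewrite mulr2n !(csE, cs_mulA); lmodule R.
Qed.

(** This is [w^(n+1)]: without a unit there is no zeroth power. Hence the shifts by one below. *)
Fixpoint cpow (w : A) (n : nat) : A := if n is m.+1 then w ** cpow w m else w.

Lemma cpow_add w m n : cpow w m ** cpow w n = cpow w (m + n).+1.
Proof. by elim: m => [//|m IH]; rewrite addSn /= -cs_mulA IH. Qed.

Lemma cpow_star w n : w^# = w -> (cpow w n)^# = cpow w n.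
Proof.
move=> ws; elim: n => [//|n IH] /=; rewrite cs_starM ws IH.
by have := cpow_add w n 0; rewrite /= addn0.
Qed.

Lemma rnorm_cpow w m : w^# = w -> rnorm (cpow w (2 ^ m).-1) = rnorm w ^+ (2 ^ m).
Proof.
move=> ws; elim: m => [|m IH]; first by rewrite expn0 expr1.
rewrite expnSr exprM -IH -cs_rnorm_sq ?cpow_star // cpow_add; congr (rnorm (cpow _ _)).
by have := expn_gt0 2 m; case: (2 ^ m)%N => // n _; rewrite muln2 /= addnn.
Qed.

(* [w^2 - w^(2n)] is positive when [w^2 + q <= 1]; hence the powers of [w] stay
   bounded. *)
Lemma cpos_norm_le1 p q : cpos p -> cpos q -> rnorm (p + q) <= 1 -> rnorm p <= 1.
Proof.
move=> [w ws ->] [v vs ->] pq.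
have step x : cpos (x^# ** x - x^# ** (w ** w) ** x).
  rewrite (_ : _ - _ = (x^# ** x - x^# ** (w ** w + v ** v) ** x) + x^# ** (v ** v) ** x).
    apply: cposD; last by apply: cpos_conj; exists v.
    by apply: cpos_contract; rewrite // cs_starD !cs_starM ws vs.
  by rewrite !(csE, cs_mulA); lmodule R.
(* [e n] is [w^(2 n + 2)]; the sequence decreases by [step]. *)
pose e n := cpow w n.*2.+1.
have eE n : e n = (cpow w n)^# ** cpow w n by rewrite cpow_star // cpow_add addnn.
have step_e n : cpos (e n - e n.+1).
  rewrite !eE; have := step (cpow w n); rewrite [cpow w n.+1]/= cs_starM ws.
  by rewrite !cs_mulA.
have e0n n : cpos (e 0%N - e n).
  elim: n => [|n IH]; first by rewrite subrr; exact: cpos0.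
  by rewrite (_ : _ - _ = (e 0%N - e n) + (e n - e n.+1)); [exact: cposD|lmodule R].
have e1 : rnorm (e 0%N) <= 4.
  by apply: cpos_norm4 pq; [exists w|exists v].
(* [e n] and [e 0 - e n] are positive with sum of norm at most 4; dividing by 4 allows [cpos_norm4],
   whence [16 = 4 * 4]. *)
have eb n : rnorm (e n) <= 16.
  have := @cpos_norm4 _ A (4^-1%:C *: e n) (4^-1%:C *: (e 0%N - e n)).
  rewrite -scalerDr subrKC !rnormZr ger0_norm ?invr_ge0 // => H.
  have : 4^-1 * rnorm (e n) <= 4; last by lra.
  apply: H; last by lra.
    by apply: cposZ; [rewrite invr_ge0|rewrite eE; exact: star_square_pos].
  by apply: cposZ; [rewrite invr_ge0|exact: e0n].
have w1 : rnorm w <= 1.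
  (* The first power of [w] is not among the [e n], so it enters the bound by itself; for [m > 0],
     [w^(2^m)] is [e (2^(m-1) - 1)]. *)
  apply: (@pow2_le1 _ (Num.max 16 (rnorm w))); first exact: rnorm_ge0.
  case=> [|m]; first by rewrite expn0 expr1 le_max lexx orbT.
  rewrite -rnorm_cpow // le_max; apply/orP; left.
  have := eb (2 ^ m).-1; rewrite /e; congr (rnorm (cpow _ _) <= _).
  by have := expn_gt0 2 m; rewrite expnSr; case: (2 ^ m)%N => // n _; rewrite muln2.
by rewrite cs_rnorm_sq //; have := rnorm_ge0 w; nra.
Qed.

(** [cpos_norm_le1] after division by [rnorm q + e], which is positive even for [q = 0]. *)
Lemma cpos_rnorm_le p q : cpos p -> cpos (q - p) -> rnorm p <= rnorm q.
Proof.
move=> P Q; apply/ler_addgt0Pr => e e0; have q0 := rnorm_ge0 q.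
have d0 : 0 < rnorm q + e by lra.
have i0 : 0 <= (rnorm q + e)^-1 by rewrite invr_ge0 ltW.
have := cpos_norm_le1 (cposZ i0 P) (cposZ i0 Q).
rewrite -scalerDr subrKC !rnormZr ger0_norm // mulrC ler_pdivrMr // mul1r.
by rewrite mulrC ler_pdivrMr // mul1r; apply; lra.
Qed.

(* Cauchy-Schwarz for [p = <x, x>], [q = <y, y>], [c = <x, y>], from the
   positivity of [<x a - y, x a - y>] at multiples [a] of [c]. *)
Lemma cauchy_schwarz_abs p q c : cpos p ->
  (forall a, cpos (a^# ** p ** a - a^# ** c - c^# ** a + q)) ->
  rnorm c ^+ 2 <= rnorm p * rnorm q.
Proof.
move=> P H; rewrite -cs_rnormC.
have key (t : R) : rnorm p < t -> rnorm (c^# ** c) <= t * rnorm q.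
  move=> pt; have t0 : 0 < t := le_lt_trans (rnorm_ge0 p) pt.
  suff : cpos (q - t^-1%:C *: (c^# ** c)).
    move=> /(cpos_rnorm_le (cposZ _ (star_square_pos c))).
    rewrite rnormZr ger0_norm ?invr_ge0 ?(ltW t0) // => /(_ isT).
    by rewrite mulrC ler_pdivrMr // mulrC.
  have i0 : 0 <= t^-1 by rewrite invr_ge0 ltW.
  (* At [a = c / t] the quadratic term is [t^-2 c^# p c]; by [C] it is at most [t^-1 c^# c], which
     cancels one of the two cross terms. *)
  have C : cpos (c^# ** c - c^# ** (t^-1%:C *: p) ** c).
    apply: cpos_contract; first by rewrite cs_starZr cpos_star.
    by rewrite rnormZr ger0_norm // mulrC ler_pdivrMr // mul1r ltW.
  have := cposD (H (t^-1%:C *: c)) (cposZ i0 C); congr cpos.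
  by rewrite cs_starZr !(csE, cs_mulA) !scalerA; module_pre R[i]; ring.
apply/ler_addgt0Pr => e e0; have q0 := rnorm_ge0 q.
have := key (rnorm p + e / (rnorm q + 1)); rewrite ltrDl divr_gt0 ?ltr_wpDl //.
move=> /(_ isT) /le_trans; apply.
rewrite mulrDl lerD2l -mulrA ler_piMr ?(ltW e0) //.
by rewrite mulrC ler_pdivrMr ?ltr_wpDl // mul1r lerDl.
Qed.

End cstar_star_positive.

(** * Fibres of a Fell bundle *)

Section groupoid_lemmas.
Context (G : etaleGroupoid).
Implicit Types a b c g x : G.

Lemma gmul_divr a b c : gmul a b = Some c -> gmul c (ginv b) = Some a.
Proof.
move=> ab; have := gmulA a b (ginv b); rewrite ab gmulgV /= => ->.
have /gmul_def <- : isSome (gmul a b) by rewrite ab.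
exact: gmulgs.
Qed.

Lemma gmul_divl a b c : gmul a b = Some c -> gmul (ginv a) c = Some b.
Proof.
move=> ab; have := gmulA (ginv a) a b; rewrite ab gmulVg /= => <-.
have /gmul_def -> : isSome (gmul a b) by rewrite ab.
exact: gmulrg.
Qed.

Lemma gmul_injl a a' b c : gmul a b = Some c -> gmul a' b = Some c -> a = a'.
Proof. by move=> /gmul_divr h /gmul_divr; rewrite h => -[]. Qed.

Lemma gmul_injr a b b' c : gmul a b = Some c -> gmul a b' = Some c -> b = b'.
Proof. by move=> /gmul_divl h /gmul_divl; rewrite h => -[]. Qed.

Lemma gmul_comp a b c : gmul a b = Some c -> gsrc a = grng b.
Proof. by move=> ab; apply/gmul_def; rewrite ab. Qed.

Lemma gmul_exists a b : gsrc a = grng b -> exists c, gmul a b = Some c.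
Proof. by move=> /gmul_def; case: gmul => // c _; exists c. Qed.

Lemma gmul_assoc' a b c ab bc abc : gmul a b = Some ab -> gmul b c = Some bc ->
  gmul a bc = Some abc -> gmul ab c = Some abc.
Proof. by move=> e1 e2 <-; have := gmulA a b c; rewrite e1 e2. Qed.

Lemma gunit_rng x : gunit x -> grng x = x.
Proof. by move=> ux; rewrite -{1}ux grng_src. Qed.

Lemma gunit_mul x : gunit x -> gmul x x = Some x.
Proof. by move=> ux; rewrite -{2}ux gmulgs. Qed.

Lemma gunit_inv x : gunit x -> ginv x = x.
Proof. by move=> ux; apply/esym/ginv_uniq; rewrite ux gunit_mul. Qed.

Lemma gmul_unitr g x : gsrc g = x -> gmul g x = Some g.
Proof. by move=> <-; exact: gmulgs. Qed.

Lemma gmul_inv a b c : gmul a b = Some c -> gmul (ginv b) (ginv a) = Some (ginv c).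
Proof. by move=> /gmul_divl/gmul_divr/gmul_divl. Qed.

End groupoid_lemmas.

Section fibre_lemmas.
Context (R : realType) (G : etaleGroupoid) (E : fellBundle R G).
Implicit Types a b c g h x : G.

Section product.
Context (a b c : G) (e : gmul a b = Some c).

Lemma fmulDl (u u' : E a) (v : E b) : fmul e (u + u') v = fmul e u v + fmul e u' v.
Proof. by have := fmul_linearl e 1 u u' v; rewrite !scale1r. Qed.

Lemma fmulDr (u : E a) (v v' : E b) : fmul e u (v + v') = fmul e u v + fmul e u v'.
Proof. by have := fmul_linearr e 1 u v v'; rewrite !scale1r. Qed.

Lemma fmul0l (v : E b) : fmul e 0 v = 0.
Proof. by apply: (addrI (fmul e 0 v)); rewrite -fmulDl !addr0. Qed.

Lemma fmul0r (u : E a) : fmul e u 0 = 0.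
Proof. by apply: (addrI (fmul e u 0)); rewrite -fmulDr !addr0. Qed.

Lemma fmulZl k (u : E a) (v : E b) : fmul e (k *: u) v = k *: fmul e u v.
Proof. by have := fmul_linearl e k u 0 v; rewrite addr0 fmul0l addr0. Qed.

Lemma fmulZr k (u : E a) (v : E b) : fmul e u (k *: v) = k *: fmul e u v.
Proof. by have := fmul_linearr e k u v 0; rewrite addr0 fmul0r addr0. Qed.

Lemma fmulNl (u : E a) (v : E b) : fmul e (- u) v = - fmul e u v.
Proof. by rewrite -scaleN1r fmulZl scaleN1r. Qed.

Lemma fmulNr (u : E a) (v : E b) : fmul e u (- v) = - fmul e u v.
Proof. by rewrite -scaleN1r fmulZr scaleN1r. Qed.

Lemma fmul_suml (I : Type) (r : seq I) (P : pred I) (F : I -> E a) (v : E b) :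
  fmul e (\sum_(i <- r | P i) F i) v = \sum_(i <- r | P i) fmul e (F i) v.
Proof. by elim/big_rec2: _ => [|i y x _ <-]; rewrite ?fmul0l ?fmulDl. Qed.

Lemma fmul_sumr (I : Type) (r : seq I) (P : pred I) (u : E a) (F : I -> E b) :
  fmul e u (\sum_(i <- r | P i) F i) = \sum_(i <- r | P i) fmul e u (F i).
Proof. by elim/big_rec2: _ => [|i y x _ <-]; rewrite ?fmul0r ?fmulDr. Qed.

Lemma rnorm_fmul (u : E a) (v : E b) : rnorm (fmul e u v) <= rnorm u * rnorm v.
Proof. by rewrite -lecR rmorphM /= -!rnormE; exact: fnormM. Qed.

End product.

Section involution.
Context (a b : G) (e : ginv a = b).

Lemma fstarD (u v : E a) : fstar e (u + v) = fstar e u + fstar e v.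
Proof. by have := fstar_antilinear e 1 u v; rewrite conjC1 !scale1r. Qed.

Lemma fstar0 : fstar e (0 : E a) = 0.
Proof. by apply: (addrI (fstar e 0)); rewrite -fstarD !addr0. Qed.

Lemma fstarZ k (u : E a) : fstar e (k *: u) = (k^* )%R *: fstar e u.
Proof. by have := fstar_antilinear e k u 0; rewrite addr0 fstar0 addr0. Qed.

Lemma fstarN (u : E a) : fstar e (- u) = - fstar e u.
Proof. by rewrite -scaleN1r fstarZ rmorphN1 scaleN1r. Qed.

Lemma fstar_sum (I : Type) (r : seq I) (P : pred I) (F : I -> E a) :
  fstar e (\sum_(i <- r | P i) F i) = \sum_(i <- r | P i) fstar e (F i).
Proof. by elim/big_rec2: _ => [|i y x _ <-]; rewrite ?fstar0 ?fstarD. Qed.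

End involution.

Lemma rnormC (a b c : G) (ea : ginv a = b) (e : gmul b a = Some c) (u : E a) :
  rnorm (fmul e (fstar ea u) u) = rnorm u ^+ 2.
Proof. by apply: complexI; rewrite rmorphXn /= -!rnormE fnormC_gen. Qed.

Lemma rnorm_fstar (a b : G) (e : ginv a = b) (u : E a) : rnorm (fstar e u) = rnorm u.
Proof.
have le a' b' (e' : ginv a' = b') (u' : E a') : rnorm u' <= rnorm (fstar e' u').
  apply: sqr_le_mul; rewrite ?rnorm_ge0 //.
  have e2 : gmul b' a' = Some (gsrc a') by rewrite -e' gmulVg.
  by rewrite -(rnormC e' e2) rnorm_fmul.
apply/le_anti; rewrite le andbT.
have e' : ginv b = a by rewrite -e ginvK.
by rewrite -[X in _ <= rnorm X](fstarK e e') le.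
Qed.

Lemma fstar_irr (a b : G) (e e' : ginv a = b) (u : E a) : fstar e u = fstar e' u.
Proof. by rewrite (Prop_irrelevance e e'). Qed.

Lemma fmul_irr (a b c : G) (e e' : gmul a b = Some c) (u : E a) (v : E b) :
  fmul e u v = fmul e' u v.
Proof. by rewrite (Prop_irrelevance e e'). Qed.

Definition unit_fibre (x : G) (ux : gunit x) : cstarAlgebra R.
Proof.
refine (@CstarAlgebra R (E x) (fmul (gunit_mul ux)) (fstar (gunit_inv ux))
  _ _ _ _ _ _ _ _).
- by move=> u v w; symmetry; exact: fmulA.
- exact: fmul_linearl.
- exact: fmul_linearr.
- exact: fstar_antilinear.
- by move=> u; exact: fstarK.
- by move=> u v; exact: fstarM.
- by move=> u v; exact: fnormM.
- by move=> u; exact: fnormC_gen.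
Defined.

(** The product of [u^*] and [v]. The source is a variable [x] with a proof, so that products formed
    at different elements with the same source lie in one fibre and can be added. *)
Definition ip (g x : G) (hx : gsrc g = x) (u v : E g) : E x :=
  fmul (etrans (gmulVg g) (congr1 Some hx)) (fstar erefl u) v.

Section inner_product.
Context (g x : G) (hx : gsrc g = x).

Lemma ipE (g' : G) (eg : ginv g = g') (e : gmul g' g = Some x) (u v : E g) :
  ip hx u v = fmul e (fstar eg u) v.
Proof. by subst g'; exact: fmul_irr. Qed.

Lemma ipDl (u u' v : E g) : ip hx (u + u') v = ip hx u v + ip hx u' v.
Proof. by rewrite /ip fstarD fmulDl. Qed.

Lemma ipDr (u v v' : E g) : ip hx u (v + v') = ip hx u v + ip hx u v'.
Proof. by rewrite /ip fmulDr. Qed.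

Lemma ipNl (u v : E g) : ip hx (- u) v = - ip hx u v.
Proof. by rewrite /ip fstarN fmulNl. Qed.

Lemma ipNr (u v : E g) : ip hx u (- v) = - ip hx u v.
Proof. by rewrite /ip fmulNr. Qed.

Lemma ipZr k (u v : E g) : ip hx u (k *: v) = k *: ip hx u v.
Proof. by rewrite /ip fmulZr. Qed.

Lemma ipZl k (u v : E g) : ip hx (k *: u) v = (k^* )%R *: ip hx u v.
Proof. by rewrite /ip fstarZ fmulZl. Qed.

Lemma ip0l (v : E g) : ip hx 0 v = 0.
Proof. by rewrite /ip fstar0 fmul0l. Qed.

Lemma ip0r (u : E g) : ip hx u 0 = 0.
Proof. by rewrite /ip fmul0r. Qed.

Lemma rnorm_ip_sq (u : E g) : rnorm (ip hx u u) = rnorm u ^+ 2.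
Proof. exact: rnormC. Qed.

Lemma ip_conj (ux : gunit x) (u v : E g) :
  fstar (gunit_inv ux) (ip hx u v) = ip hx v u.
Proof.
have e : gmul (ginv g) g = Some x by rewrite gmulVg hx.
rewrite (ipE erefl e) (fstarM e (ginvK g) erefl (gunit_inv ux) e).
by rewrite (fstarK erefl (ginvK g)) (ipE erefl e).
Qed.

End inner_product.

End fibre_lemmas.

Section fibre_positivity.
Context (R : realType) (G : etaleGroupoid) (E : fellBundle R G).
Implicit Types a b c g h p x : G.

(** The axiom [fpositive] enters the estimates here: it replaces [u], which may lie over a non-unit,
    by an element of the C*-algebra over [x], where [star_square_pos] holds. *)
Lemma ip_pos x (ux : gunit x) g (hg : gsrc g = x) (u : E g) :
  @cpos R (unit_fibre E ux) (ip hg u u).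
Proof.
have e : gmul (ginv g) g = Some x by rewrite gmulVg hg.
have [y yE] := fpositive_gen erefl e (gunit_inv ux) (gunit_mul ux) u.
rewrite (ipE _ erefl e) -yE.
exact: (@star_square_pos R (unit_fibre E ux) y).
Qed.

Lemma ip_adj x g h p p' (hg : gsrc g = x) (hh : gsrc h = x)
    (e : gmul p g = Some h) (ep : ginv p = p') (e' : gmul p' h = Some g)
    (m : E p) (u : E g) (w : E h) :
  ip hh (fmul e m u) w = ip hg u (fmul e' (fstar ep m) w).
Proof.
have e1 : gmul (ginv g) p' = Some (ginv h) by rewrite -ep; exact: gmul_inv.
have e2 : gmul (ginv h) h = Some x by rewrite gmulVg hh.
have e3 : gmul (ginv g) g = Some x by rewrite gmulVg hg.
by rewrite (ipE _ erefl e2) (ipE _ erefl e3) (fstarM e ep erefl erefl e1) (fmulA _ _ e' e3).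
Qed.

Lemma ip_mulr x (ux : gunit x) g (hg : gsrc g = x) (e : gmul g x = Some g)
    (u v : E g) (a : E x) :
  ip hg u (fmul e v a) = fmul (gunit_mul ux) (ip hg u v) a.
Proof.
have e3 : gmul (ginv g) g = Some x by rewrite gmulVg hg.
by rewrite !(ipE _ erefl e3) (fmulA _ _ e e3).
Qed.

Lemma ip_mull x (ux : gunit x) g (hg : gsrc g = x) (e : gmul g x = Some g)
    (u v : E g) (a : E x) :
  ip hg (fmul e u a) v = fmul (gunit_mul ux) (fstar (gunit_inv ux) a) (ip hg u v).
Proof.
rewrite -(ip_conj hg ux) (ip_mulr ux).
by rewrite (fstarM _ (gunit_inv ux) (gunit_inv ux) (gunit_inv ux) (gunit_mul ux)) ip_conj.
Qed.

(** In the C*-algebra over [grng g], the element [k = M^-2 m^* m] has norm at most 1, so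
    [1 - k = (1 - s)^2]. The difference is then [M^2 <z, z>] with [z = (1 - s) v]. *)
Lemma ip_contract x (ux : gunit x) g h p (hg : gsrc g = x) (hh : gsrc h = x)
    (e : gmul p g = Some h) (m : E p) (v : E g) (M : R) : rnorm m <= M ->
  @cpos R (unit_fibre E ux)
    ((M ^+ 2)%:C *: ip hg v v - ip hh (fmul e m v) (fmul e m v)).
Proof.
move=> mM; have [m0|m0] := eqVneq m 0.
  subst m; rewrite fmul0l ip0r subr0; apply: (@cposZ R (unit_fibre E ux)); first exact: sqr_ge0.
  exact: ip_pos.
have M0 : 0 < M.
  by apply: lt_le_trans mM; rewrite lt_def rnorm_eq0 m0 rnorm_ge0.
set y := grng g; have uy : gunit y by rewrite /gunit /= /y gsrc_rng.
have ey : gmul y g = Some g by exact: gmulrg.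
have e1 : gmul (ginv p) p = Some y by rewrite gmulVg (gmul_comp e).
have e2 : gmul (ginv p) h = Some g by exact: gmul_divl.
pose Ay := unit_fibre E uy.
pose k : Ay := (M ^- 2)%:C *: fmul e1 (fstar erefl m) m.
have ks : cs_star k = k.
  rewrite /k cs_starZr; congr (_ *: _); rewrite /=.
  by rewrite (fstarM e1 (ginvK p) erefl (gunit_inv uy) e1) (fstarK erefl (ginvK p)).
have k1 : rnorm k <= 1.
  rewrite /k rnormZr ger0_norm ?invr_ge0 ?sqr_ge0 // rnormC.
  by rewrite mulrC ler_pdivrMr ?exprn_gt0 // mul1r ler_sqr ?nnegrE ?rnorm_ge0 ?(ltW M0) //.
have [s [ss sE _ _]] := @small_sqrt R Ay k ks k1.
pose z := v - fmul ey s v.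
rewrite (_ : _ - _ = (M ^+ 2)%:C *: ip hg z z).
  by apply: (@cposZ R (unit_fibre E ux)); [exact: sqr_ge0|exact: ip_pos].
have adj (t : Ay) (w : E g) : cs_star t = t -> ip hg (fmul ey t w) v = ip hg w (fmul ey t v).
  move=> tt; rewrite (ip_adj hg hg ey (gunit_inv uy) ey).
  exact: (congr1 (fun r => ip hg w (fmul ey r v)) tt).
have -> : ip hh (fmul e m v) (fmul e m v) = (M ^+ 2)%:C *: ip hg v (fmul ey k v).
  rewrite (ip_adj hg hh e erefl e2) -ipZr -fmulZl /k scalerA -rmorphM /=.
  by rewrite divff ?expf_neq0 ?gt_eqF // scale1r (fmulA e1 ey e e2).
rewrite -scalerBr; congr (_ *: _).
have -> : fmul ey k v = fmul ey s v *+ 2 - fmul ey s (fmul ey s v).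
  rewrite -(fmulA (gunit_mul uy) ey ey ey) mulr2n -!fmulDl -fmulNl -fmulDl.
  by rewrite -mulr2n sE addrK.
rewrite /z mulr2n !(ipDl, ipDr, ipNl, ipNr) (adj s v ss).
have -> : ip hg (fmul ey s v) (fmul ey s v) = ip hg v (fmul ey s (fmul ey s v)).
  rewrite (ip_adj hg hg ey (gunit_inv uy) ey).
  exact: (congr1 (fun r => ip hg v (fmul ey r (fmul ey s v))) ss).
lmodule R.
Qed.

End fibre_positivity.

(** * The Hilbert modules of finite families of vectors over a unit *)

Section vector_families.
Context (R : realType) (G : etaleGroupoid) (E : fellBundle R G).
Context (I : finType) (gam : I -> G) (x : G) (ux : gunit x).
Context (hx : forall i, gsrc (gam i) = x).
Local Notation vec := (forall i, E (gam i)).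
Implicit Types (xi eta : vec).
Let A := unit_fibre E ux.

Definition hip xi eta : E x := \sum_i ip (hx i) (xi i) (eta i).

Definition hnorm xi : R := Num.sqrt (rnorm (hip xi xi)).

Lemma hnorm_ge0 xi : 0 <= hnorm xi.
Proof. exact: sqrtr_ge0. Qed.

Lemma hnorm_sq xi : hnorm xi ^+ 2 = rnorm (hip xi xi).
Proof. by rewrite sqr_sqrtr // rnorm_ge0. Qed.

Lemma hip_pos xi : @cpos R A (hip xi xi).
Proof. by apply: cpos_sum => i _; exact: ip_pos. Qed.

Lemma hip_conj xi eta : fstar (gunit_inv ux) (hip xi eta) = hip eta xi.
Proof. by rewrite fstar_sum; apply: eq_bigr => i _; rewrite ip_conj. Qed.

Lemma cauchy_schwarz xi eta : rnorm (hip xi eta) <= hnorm xi * hnorm eta.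
Proof.
rewrite -(@ler_pXn2r _ 2) ?nnegrE ?mulr_ge0 ?hnorm_ge0 ?rnorm_ge0 //.
rewrite exprMn !hnorm_sq.
apply: (@cauchy_schwarz_abs R A _ _ _ (hip_pos xi)) => a.
pose e i := gmul_unitr (hx i).
rewrite (_ : _ + _ = hip (fun i => fmul (e i) (xi i) a - eta i)
                         (fun i => fmul (e i) (xi i) a - eta i)); first exact: hip_pos.
rewrite /hip; transitivity (\sum_i (
  fmul (gunit_mul ux) (fmul (gunit_mul ux) (fstar (gunit_inv ux) a) (ip (hx i) (xi i) (xi i))) a
  - fmul (gunit_mul ux) (fstar (gunit_inv ux) a) (ip (hx i) (xi i) (eta i))
  - fmul (gunit_mul ux) (ip (hx i) (eta i) (xi i)) a
  + ip (hx i) (eta i) (eta i))).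
  rewrite big_split /= !sumrB; congr (_ - _ - _ + _).
  - by rewrite [in LHS]/= fmul_sumr fmul_suml.
  - by rewrite [in LHS]/= fmul_sumr.
  - by rewrite [in LHS]/= -/(hip xi eta) hip_conj fmul_suml.
apply: eq_bigr => i _.
rewrite !(ipDl, ipDr, ipNl, ipNr) !(ip_mull ux) !(ip_mulr ux).
rewrite (fmulA _ (gunit_mul ux) (gunit_mul ux) (gunit_mul ux)); lmodule R.
Qed.

Lemma hipDl xi xi' eta : hip (fun i => xi i + xi' i) eta = hip xi eta + hip xi' eta.
Proof. by rewrite -big_split; apply: eq_bigr => i _; rewrite ipDl. Qed.

Lemma hipDr xi eta eta' : hip xi (fun i => eta i + eta' i) = hip xi eta + hip xi eta'.
Proof. by rewrite -big_split; apply: eq_bigr => i _; rewrite ipDr. Qed.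

Lemma hnormD xi eta : hnorm (fun i => xi i + eta i) <= hnorm xi + hnorm eta.
Proof.
rewrite -(@ler_pXn2r _ 2) ?nnegrE ?addr_ge0 ?hnorm_ge0 // hnorm_sq hipDl !hipDr.
have h1 := rnormD (hip xi xi + hip xi eta) (hip eta xi + hip eta eta).
have h2 := rnormD (hip xi xi) (hip xi eta).
have h3 := rnormD (hip eta xi) (hip eta eta).
have := cauchy_schwarz xi eta; have := cauchy_schwarz eta xi.
by have := hnorm_sq xi; have := hnorm_sq eta; nra.
Qed.

Lemma hnormZ k xi : hnorm (fun i => k *: xi i) = complex.Re `|k| * hnorm xi.
Proof.
have kE : `|k| = (complex.Re `|k|)%:C.
  by have /ger0_Im := normr_ge0 k; case: `|k| => a b /= ->.
have k0 : 0 <= complex.Re `|k| by rewrite -lecR -kE; exact: normr_ge0.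
have -> : hnorm (fun i => k *: xi i) = Num.sqrt (rnorm ((complex.Re `|k| ^+ 2)%:C *: hip xi xi)).
  congr (Num.sqrt (rnorm _)); rewrite rmorphXn /= -kE normCK scaler_sumr.
  by apply: eq_bigr => i _; rewrite ipZl ipZr scalerA mulrC.
by rewrite rnormZr ger0_norm ?sqr_ge0 // sqrtrM ?sqr_ge0 // sqrtr_sqr ger0_norm.
Qed.

Lemma hnorm_le xi eta :
  @cpos R A (hip eta eta - hip xi xi) -> hnorm xi <= hnorm eta.
Proof.
move=> P; rewrite ler_wsqrtr //.
exact: (@cpos_rnorm_le R A _ _ (hip_pos xi) P).
Qed.

Lemma hnorm_sum xi : hnorm xi <= \sum_i rnorm (xi i).
Proof.
rewrite -(@ler_pXn2r _ 2) ?nnegrE ?hnorm_ge0 ?sumr_ge0 //; last first.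
  by move=> i _; exact: rnorm_ge0.
rewrite hnorm_sq (le_trans (rnorm_sum _ _ _)) // expr2 mulr_suml.
apply: ler_sum => i _; rewrite rnorm_ip_sq expr2 ler_wpM2l ?rnorm_ge0 //.
rewrite (bigD1 i) //= lerDl sumr_ge0 // => j _; exact: rnorm_ge0.
Qed.

Lemma rnorm_le_hnorm xi i : rnorm (xi i) <= hnorm xi.
Proof.
rewrite -(ger0_norm (rnorm_ge0 (xi i))) -sqrtr_sqr ler_wsqrtr //.
rewrite -(rnorm_ip_sq (hx i)); apply: (@cpos_rnorm_le R A); first exact: ip_pos.
rewrite /hip (bigD1 i) //= addrC addrK; apply: (@cpos_sum R A) => j _; exact: ip_pos.
Qed.

End vector_families.

Lemma hnorm_sub (R : realType) (G : etaleGroupoid) (E : fellBundle R G)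
    (I J : finType) (f : I -> J) (gam : J -> G) (x : G) (ux : gunit x)
    (hx : forall j, gsrc (gam j) = x) (eta : forall j, E (gam j)) :
  injective f ->
  hnorm (fun i => hx (f i)) (fun i => eta (f i)) <= hnorm hx eta.
Proof.
move=> finj; apply: ler_wsqrtr; rewrite ?rnorm_ge0 //.
apply: (@cpos_rnorm_le R (unit_fibre E ux)); first exact: hip_pos.
rewrite /hip (bigID (fun j => j \in codom f)) /=.
have -> : \sum_(i in codom f) ip (hx i) (eta i) (eta i) =
    \sum_i ip (hx (f i)) (eta (f i)) (eta (f i)).
  by rewrite -big_uniq /= ?big_image // map_inj_uniq ?enum_uniq.
rewrite addrC addrK; apply: (@cpos_sum R (unit_fibre E ux)) => j _; exact: ip_pos.
Qed.

(** * Matrices over a Fell bundle *)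

Lemma dep_single (I : eqType) (T : I -> Type) (z : forall i, T i) (j : I) (v : T j) :
  exists2 eta : forall i, T i, eta j = v & forall i, i != j -> eta i = z i.
Proof.
exists (fun i => match j =P i with ReflectT e => ecast i (T i) e v | ReflectF _ => z i end).
  by case: eqP => // e; rewrite eq_axiomK.
by move=> i ij; case: eqP => // e; rewrite e eqxx in ij.
Qed.

(** The model is [q i j = g_i g_j^-1] for elements [g_i] with a common source. Only the cocycle law
    is kept, because it passes to images under a functor ([pushed_sys]) and to subsets of indices
    ([block_sys]). *)
Record qsys (G : etaleGroupoid) (I : finType) := QSys {
  quo :> I -> I -> G ;
  quoM : forall i j k, gmul (quo i j) (quo j k) = Some (quo i k) }.

Section quotient_systems.
Context (G : etaleGroupoid) (I : finType) (q : qsys G I).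

Lemma quo_unit i : gunit (q i i).
Proof. exact: gmul_injr (gmulgs _) (quoM q i i i). Qed.

Lemma quo_src i j : gsrc (q i j) = q j j.
Proof. by rewrite (gmul_comp (quoM q i j j)) gunit_rng //; exact: quo_unit. Qed.

Lemma quo_inv i j : ginv (q i j) = q j i.
Proof. by apply/esym/ginv_uniq; rewrite quoM quo_src. Qed.

End quotient_systems.

Section fibre_faithful.
Context (R : realType) (G : etaleGroupoid) (E : fellBundle R G).

(** The test vector is [v = a^* a]: then [|a|^4 = |v v| = |a^* (a v)| <= |a| M |a|^2]. *)
Lemma fmul_faithful (p y : G) (e : gmul p y = Some p) (a : E p) (M : R) : gunit y ->
  0 <= M -> (forall v : E y, rnorm (fmul e a v) <= M * rnorm v) -> rnorm a <= M.
Proof.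
move=> uy M0 aM; have [->//|a0] := eqVneq (rnorm a) 0.
have {}a0 : 0 < rnorm a by rewrite lt_def a0 rnorm_ge0.
have py : gsrc p = y by rewrite (gmul_comp e) gunit_rng.
have e1 : gmul (ginv p) p = Some y by rewrite gmulVg py.
pose v : unit_fibre E uy := fmul e1 (fstar erefl a) a.
have vs : cs_star v = v.
  rewrite /v /=.
  by rewrite (fstarM e1 (ginvK p) erefl (gunit_inv uy) e1) (fstarK erefl (ginvK p)).
have vn : rnorm v = rnorm a ^+ 2 by exact: rnormC.
have := cs_rnorm_sq vs; rewrite vn => v2.
have : rnorm (cs_mul v v) <= rnorm a * (M * rnorm a ^+ 2).
  rewrite /v /= (fmulA e1 (gunit_mul uy) e e1).
  apply: le_trans (rnorm_fmul _ _ _) _; rewrite rnorm_fstar ler_wpM2l ?rnorm_ge0 //.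
  by rewrite -vn; exact: aM.
rewrite v2 => H; rewrite -(@ler_pM2r _ (rnorm a ^+ 3)) ?exprn_gt0 //.
by move: H; congr (_ <= _); ring.
Qed.

End fibre_faithful.

Section matrices.
Context (R : realType) (G : etaleGroupoid) (E : fellBundle R G).
Context (I : finType) (q : qsys G I).
Local Notation mat := (forall i j, E (q i j)).
Implicit Types (m T : mat) (M : R).

Definition mapp k m (eta : forall j, E (q j k)) (i : I) : E (q i k) :=
  \sum_j fmul (quoM q i j k) (m i j) (eta j).

Definition mmul m m' : mat := fun i k => mapp m (fun j => m' j k) i.

Definition mstar m : mat := fun i j => fstar (quo_inv q j i) (m j i).

Definition mhip k := @hip R G E I (fun i => q i k) (q k k) (fun i => quo_src q i k).

Definition mnorm k := @hnorm R G E I (fun i => q i k) (q k k) (fun i => quo_src q i k).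

Lemma mapp_adj k m (xi eta : forall j, E (q j k)) :
  mhip (mapp m xi) eta = mhip xi (mapp (mstar m) eta).
Proof.
rewrite /mhip /hip /mapp.
under eq_bigr => i _.
  rewrite /ip fstar_sum fmul_suml.
  under eq_bigr => j _ do rewrite -/(ip (quo_src q i k) _ _)
    (ip_adj (quo_src q j k) (quo_src q i k) (quoM q i j k) (quo_inv q i j) (quoM q j i k)).
  over.
rewrite exchange_big; apply: eq_bigr => j _ /=.
by rewrite /ip fmul_sumr.
Qed.

Lemma mapp_mul k m m' (eta : forall j, E (q j k)) i :
  mapp (mmul m m') eta i = mapp m (mapp m' eta) i.
Proof.
rewrite /mapp /mmul /mapp; under eq_bigr do rewrite fmul_suml.
rewrite exchange_big; apply: eq_bigr => j _ /=; rewrite fmul_sumr.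
by apply: eq_bigr => l _; exact: fmulA.
Qed.

Definition mbound k m M := forall eta : (forall j, E (q j k)),
  mnorm (mapp m eta) <= M * mnorm eta.

Lemma mbound_le k m M M' : M <= M' -> mbound k m M -> mbound k m M'.
Proof.
by move=> MM' mM eta; rewrite (le_trans (mM eta)) // ler_wpM2r ?hnorm_ge0.
Qed.

Lemma mnorm_sq k (xi : forall j, E (q j k)) : mnorm xi ^+ 2 = rnorm (mhip xi xi).
Proof. exact: hnorm_sq. Qed.

Lemma mcauchy_schwarz k (xi eta : forall j, E (q j k)) :
  rnorm (mhip xi eta) <= mnorm xi * mnorm eta.
Proof. by apply: cauchy_schwarz; exact: quo_unit. Qed.

Lemma mnorm_ext k (xi eta : forall j, E (q j k)) : (forall j, xi j = eta j) ->
  mnorm xi = mnorm eta.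
Proof.
move=> xe; congr (Num.sqrt (rnorm _)).
by apply: eq_bigr => i _; rewrite xe.
Qed.

(** The adjoint inherits the bound, since [|m^* xi|^2 = <m m^* xi, xi> <= M |m^* xi| |xi|]. *)
Lemma mbound_star_mul k m M : 0 <= M -> mbound k m M ->
  mbound k (mmul (mstar m) m) (M ^+ 2).
Proof.
move=> M0 mM eta; rewrite (mnorm_ext (mapp_mul _ _ _)).
rewrite expr2 -mulrA; apply: le_trans (ler_wpM2l M0 (mM eta)).
move: (mapp m eta) => {eta} xi; set zeta := mapp (mstar m) xi.
apply: sqr_le_mul; rewrite ?mulr_ge0 ?hnorm_ge0 //.
rewrite mnorm_sq -mapp_adj (le_trans (mcauchy_schwarz _ _)) //.
rewrite mulrAC; apply: ler_wpM2r; first exact: hnorm_ge0.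
exact: mM.
Qed.

Lemma mbound_sq k m M : 0 <= M -> mbound k (mmul (mstar m) m) (M ^+ 2) ->
  mbound k m M.
Proof.
move=> M0 mM eta.
rewrite -(@ler_pXn2r _ 2) ?nnegrE ?mulr_ge0 ?hnorm_ge0 //.
rewrite mnorm_sq mapp_adj (le_trans (mcauchy_schwarz _ _)) // exprMn.
by have := mM eta; rewrite (mnorm_ext (mapp_mul _ _ _)); have := hnorm_ge0 (fun i => quo_src q i k) eta; rewrite -/(mnorm eta); nra.
Qed.

(* The column based at [j] contains the unit [q j j], so it sees the entries of
   the [j]-th column of a matrix; other columns need not. *)
Lemma mbound_entry m M i j : 0 <= M -> mbound j m M -> rnorm (m i j) <= M.
Proof.
move=> M0 mM; apply: (fmul_faithful (e := quoM q i j j)) => // [|v].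
  exact: quo_unit.
have [eta etaj eta0] := @dep_single I (fun l => E (q l j)) (fun=> 0) j v.
have -> : fmul (quoM q i j j) (m i j) v = mapp m eta i.
  rewrite /mapp (bigD1 j) //= etaj big1 ?addr0 // => l lj.
  by rewrite eta0 // fmul0r.
have -> : rnorm v = mnorm eta.
  rewrite /mnorm /hnorm /hip (bigD1 j) //= etaj big1 => [|l lj].
    by rewrite addr0 rnorm_ip_sq sqrtr_sqr ger0_norm ?rnorm_ge0.
  by rewrite eta0 // ip0l.
apply: le_trans (mM eta).
by apply: (rnorm_le_hnorm (quo_unit q j) (fun l => quo_src q l j)).
Qed.

Lemma mbound_entries k m : mbound k m (\sum_i \sum_j rnorm (m i j)).
Proof.
move=> eta; apply: le_trans (hnorm_sum _ _) _; rewrite mulr_suml.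
apply: ler_sum => i _; apply: le_trans (rnorm_sum _ _ _) _; rewrite mulr_suml.
apply: ler_sum => j _; apply: le_trans (rnorm_fmul _ _ _) _.
rewrite ler_wpM2l ?rnorm_ge0 //.
by apply: (rnorm_le_hnorm (quo_unit q k) (fun l => quo_src q l k)).
Qed.

(* Applying the crude entrywise bound to the powers [(T^* T)^(2^n)] removes the
   constant. *)
Lemma mbound_power (Q : R -> mat -> Prop) (K : R) k :
  (forall M T, 0 <= M -> Q M T -> Q (M ^+ 2) (mmul (mstar T) T)) ->
  (forall M T i j, 0 <= M -> Q M T -> rnorm (T i j) <= K * M) ->
  forall M T, 0 <= M -> Q M T -> mbound k T M.
Proof.
move=> QM QK; pose C : R := \sum_(i : I) \sum_(j : I) K.
(* [c] is the loss still allowed. Passing from [T] to [T^* T] squares it, so after [n] squarings it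
   only has to exceed the crude constant [C] obtained by summing over all entries. Any [c = 1 + d]
   is reached in this way. *)
have key n c : 0 <= c -> C <= c ^+ (2 ^ n) ->
    forall M T, 0 <= M -> Q M T -> mbound k T (c * M).
  elim: n c => [|n IH] c c0 cC M T M0 QT.
    apply: (mbound_le _ (mbound_entries T)).
    apply: (@le_trans _ _ (C * M)); last by rewrite ler_wpM2r.
    rewrite mulr_suml; apply: ler_sum => i _; rewrite mulr_suml.
    by apply: ler_sum => j _; exact: QK.
  apply: mbound_sq; first exact: mulr_ge0.
  rewrite exprMn; apply: IH; rewrite ?exprn_ge0 //; last exact: QM.
  by rewrite -exprM -expnS.
move=> M T M0 QT eta; rewrite -subr_le0.
apply: (@le0_small _ _ (M * mnorm eta)) => d d0 _.
have [n hn] := pow2_large (C / d); rewrite ler_pdivrMr // in hn.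
have d1 : 0 <= 1 + d by lra.
have := key n (1 + d) d1 _ M T M0 QT eta.
have B := bernoulli (2 ^ n) (ltW d0).
have Cd : C <= (1 + d) ^+ (2 ^ n) by lra.
by move=> /(_ Cd); lra.
Qed.

End matrices.

(** * Sections and their convolution *)

Section finite_sums.
Context (R : realType) (V : normedModType R[i]) (J : choiceType).

Lemma totally_finite_sum (t : J -> V) (I : finType) (f : I -> J) : injective f ->
  (forall j, t j != 0 -> exists i, f i = j) ->
  partial_sum t @ totally --> \sum_i t (f i).
Proof.
move=> finj cov; apply: cvg_near_cst; first exact: totally_filter.
refine (ex_intro2 _ _ [fset f i | i in I]%fset Logic.I _) => A /= sub.
have -> : partial_sum t A = \sum_(j <- A) t j.
  by rewrite /partial_sum -(big_seq_fsetE _ _ xpredT t).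
rewrite -(big_fset_incl _ sub) /=.
  by rewrite big_imfset /= => [|? ? _ _ /finj//]; rewrite big_enum.
move=> j _ jA; apply/eqP; apply: contraNT jA => /cov[i <-].
by apply/imfsetP; exists i.
Qed.

End finite_sums.

Section convolution.
Context (R : realType) (G : etaleGroupoid) (E : fellBundle R G).
Implicit Types (a b c f : section E) (g h x : G).

(** A factorization of [g] is determined by its second factor. So it suffices that [gam] meets the
    second factors of all nonzero terms. *)
Lemma conv_cvgE a b g (I : finType) (p gam : I -> G)
    (e : forall i, gmul (p i) (gam i) = Some g) : injective gam ->
  (forall h k, gmul h k = Some g -> a h != 0 -> b k != 0 -> exists i, gam i = k) ->
  partial_sum (@conv_term R G E a b g) @ totally -->
    \sum_i fmul (e i) (a (p i)) (b (gam i)).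
Proof.
move=> ginj cov.
pose j (i : I) : factorizations g := @sub_elt (G * G) _ (p i, gam i) (e i).
have -> : \sum_i fmul (e i) (a (p i)) (b (gam i)) = \sum_i conv_term a b (j i).
  by apply: eq_bigr => i _; rewrite /conv_term /=; exact: fmul_irr.
apply: totally_finite_sum => [i i' /(congr1 (fun z => (set_val z).2))/ginj //|].
move=> z; rewrite /conv_term; move: (set_valP z) => /= ez.
have [a0|a0] := eqVneq (a (set_val z).1) 0; first by rewrite a0 fmul0l eqxx.
have [b0|b0] := eqVneq (b (set_val z).2) 0; first by rewrite b0 fmul0r eqxx.
move=> _; have [i iz] := cov _ _ ez a0 b0; exists i; apply: val_inj => /=.
have pz : p i = (set_val z).1 by apply: gmul_injl (e i) _; rewrite iz.
by rewrite pz iz -surjective_pairing.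
Qed.

Lemma conv_sumE a b g (I : finType) (p gam : I -> G)
    (e : forall i, gmul (p i) (gam i) = Some g) : injective gam ->
  (forall h k, gmul h k = Some g -> a h != 0 -> b k != 0 -> exists i, gam i = k) ->
  conv a b g = \sum_i fmul (e i) (a (p i)) (b (gam i)).
Proof.
move=> ginj cov; exact: (@cvg_lim (E g) (@norm_hausdorff _ (E g)) _ _ totally_filter _ _
  (conv_cvgE ginj cov)).
Qed.

(** The quotient [g h^-1]; the default [g] is returned only when the sources differ. *)
Definition quot g h : G := odflt g (gmul g (ginv h)).

Lemma quotP g h : gsrc g = gsrc h -> gmul (quot g h) h = Some g.
Proof.
move=> gh; have [k kP] : exists k, gmul g (ginv h) = Some k.
  by apply: gmul_exists; rewrite grngV.
by rewrite /quot kP /=; have := gmul_divr kP; rewrite ginvK.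
Qed.

Lemma quot_eq g h k : gmul k h = Some g -> quot g h = k.
Proof. by move=> e; apply: (gmul_injl (quotP _) e); rewrite (gmul_src e). Qed.

Definition col_support a x (F : {fset G}) :=
  (forall g, g \in F -> gsrc g = x) /\
  (forall g, gsrc g = x -> a g != 0 -> g \in F).

(** The class in which convolutions are finite sums. It contains the finitely supported sections and
    those supported in a slice, and it is closed under convolution. *)
Definition col_finite a := forall x, exists F, col_support a x F.

Lemma col_finite_sup a :
  (forall x, exists F : {fset G}, forall g, gsrc g = x -> a g != 0 -> g \in F) ->
  col_finite a.
Proof.
move=> h x; have [F hF] := h x.
exists [fset g in F | gsrc g == x]%fset; split=> g; rewrite !inE /=.
  by move=> /andP[_ /eqP].
by move=> gx ag; rewrite hF //= gx eqxx.
Qed.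

Lemma conv_colE a b g (F : {fset G}) (e : forall i : F, gmul (quot g (val i)) (val i) = Some g) :
  (forall k, gsrc k = gsrc g -> b k != 0 -> k \in F) ->
  conv a b g = \sum_(i : F) fmul (e i) (a (quot g (val i))) (b (val i)).
Proof.
move=> cov; apply: conv_sumE => [|h k hk _ bk]; first exact: val_inj.
by exists [` cov k (esym (gmul_src hk)) bk]%fset.
Qed.

Lemma conv_neq0 a b g : conv a b g != 0 -> col_finite b ->
  exists h k, [/\ gmul h k = Some g, a h != 0 & b k != 0].
Proof.
move=> ab bf; have [F [Fx Fb]] := bf (gsrc g).
have e (i : F) : gmul (quot g (val i)) (val i) = Some g.
  by apply: quotP; rewrite Fx // (valP i).
move: ab; rewrite (conv_colE _ e Fb); apply: contraPP => no.
apply/negP/negPn/eqP; apply: big1 => i _.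
have [a0|a0] := eqVneq (a (quot g (val i))) 0; first by rewrite a0 fmul0l.
have [b0|b0] := eqVneq (b (val i)) 0; first by rewrite b0 fmul0r.
by exfalso; apply: no; exists (quot g (val i)), (val i).
Qed.

Lemma product_support a (K : {fset G}) : col_finite a ->
  exists F : {fset G}, forall h k g, k \in K -> gmul h k = Some g -> a h != 0 -> g \in F.
Proof.
move=> /choice[Fa FaP].
exists (seq_fset tt [seq odflt k (gmul h k) | k <- enum_fset K, h <- enum_fset (Fa (grng k))]).
move=> h k g kK hk ah; rewrite seq_fsetE; apply/allpairsPdep.
exists k, h; split => //; last by rewrite hk.
by have [_] := FaP (grng k); apply => //; exact: gmul_comp hk.
Qed.

Lemma col_finite_conv a b : col_finite a -> col_finite b -> col_finite (conv a b).
Proof.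
move=> af bf; apply: col_finite_sup => x; have [K [Kx Kb]] := bf x.
have [F FP] := product_support K af; exists F => g gx /conv_neq0 /(_ bf)[h [k [hk ah bk]]].
by apply: (FP _ _ _ _ hk ah); apply: Kb => //; rewrite -(gmul_src hk).
Qed.

Lemma finite_supp_conv a f : col_finite a -> finite_set (supp f) ->
  col_finite f -> finite_set (supp (conv a f)).
Proof.
move=> af /finite_fsetP[K KE] ff; have [F FP] := product_support K af.
apply: (@sub_finite_set _ _ [set` F]); last exact: finite_fset.
move=> g /= /conv_neq0 /(_ ff)[h [k [hk ah fk]]]; apply: (FP _ _ _ _ hk ah).
by have : supp f k by []; rewrite KE.
Qed.

Lemma finite_supp_col f : finite_set (supp f) -> col_finite f.
Proof.
move=> /finite_fsetP[K KE]; apply: col_finite_sup => x; exists K => g _ fg.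
by have : supp f g by []; rewrite KE.
Qed.

Lemma conv_assoc a b c : col_finite b -> col_finite c ->
  conv (conv a b) c = conv a (conv b c).
Proof.
move=> bf cf; apply: functional_extensionality_dep => g.
have [K [Kx Kc]] := cf (gsrc g); have [F0 F0P] := product_support K bf.
(* Over the source of [g], [F] contains the supports of [c] and of [conv b c]. All three kinds of
   convolution become sums indexed by [F], and associativity is an exchange of two sums. *)
pose F := [fset h in (K `|` F0)%fset | gsrc h == gsrc g]%fset.
have FP h : h \in F -> gsrc h = gsrc g by rewrite !inE /= => /andP[_ /eqP].
have eg (i : F) : gmul (quot g (val i)) (val i) = Some g.
  by apply: quotP; rewrite (FP _ (valP i)).
have ei (i j : F) : gmul (quot (val i) (val j)) (val j) = Some (val i).
  by apply: quotP; rewrite !(FP _ (valP _)).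
have eij (i j : F) : gmul (quot g (val i)) (quot (val i) (val j)) = Some (quot g (val j)).
  have [k kP] : exists k, gmul (quot g (val i)) (quot (val i) (val j)) = Some k.
    by apply: gmul_exists; rewrite (gmul_comp (eg i)) -(gmul_rng (ei i j)).
  by rewrite kP; congr Some; apply/esym/quot_eq; apply: gmul_assoc' kP (ei i j) (eg i).
have covc k : gsrc k = gsrc g -> c k != 0 -> k \in F.
  by move=> kg ck; rewrite !inE /= kg eqxx Kc.
have bcE (i : F) : conv b c (val i) =
    \sum_(j : F) fmul (ei i j) (b (quot (val i) (val j))) (c (val j)).
  by apply: conv_colE => k; rewrite (FP _ (valP i)); exact: covc.
have -> : conv a (conv b c) g =
    \sum_(i : F) fmul (eg i) (a (quot g (val i))) (conv b c (val i)).
  apply: conv_colE => k kg /conv_neq0 /(_ cf)[h [l [hl bh cl]]].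
  have lg : gsrc l = gsrc g by rewrite -(gmul_src hl).
  by rewrite !inE /= kg eqxx andbT (F0P _ _ _ (Kc _ lg cl) hl bh) orbT.
rewrite (conv_colE _ eg covc).
under [RHS]eq_bigr do rewrite bcE fmul_sumr.
rewrite exchange_big; apply: eq_bigr => j _ /=.
have [c0|c0] := eqVneq (c (val j)) 0.
  by rewrite c0 fmul0r big1 // => i _; rewrite !fmul0r.
have -> : conv a b (quot g (val j)) =
    \sum_(i : F) fmul (eij i j) (a (quot g (val i))) (b (quot (val i) (val j))).
  apply: conv_sumE => [i i' ii'|h k hk _ bk].
    by apply: val_inj; have := ei i j; rewrite ii' (ei i' j) => -[].
  have [l lP] : exists l, gmul k (val j) = Some l.
    by apply: gmul_exists; rewrite -(gmul_src hk) (gmul_comp (eg j)).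
  have lF : l \in F.
    rewrite !inE /= (gmul_src lP) (FP _ (valP j)) eqxx andbT.
    by rewrite (F0P _ _ _ _ lP bk) ?orbT // Kc // (FP _ (valP j)).
  by exists [` lF]%fset; exact: quot_eq.
rewrite fmul_suml; apply: eq_bigr => i _; exact: fmulA.
Qed.

Lemma sec_starE a g h (e : ginv g = h) : sec_star a h = fstar e (a g).
Proof.
have key g' (e' : ginv g' = h) : fstar e' (a g') = fstar e (a g).
  have gg : g' = g by rewrite -[g']ginvK e' -e ginvK.
  by subst g'; exact: fstar_irr.
exact: key.
Qed.

Lemma sec_starK a : sec_star (sec_star a) = a.
Proof.
apply: functional_extensionality_dep => g.
by rewrite (sec_starE _ (ginvK g)) (sec_starE a erefl) fstarK.
Qed.

Lemma conv_star a b : col_finite b ->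
  sec_star (conv a b) = conv (sec_star b) (sec_star a).
Proof.
move=> bf; apply: functional_extensionality_dep => g.
have [F [Fx Fb]] := bf (gsrc (ginv g)).
have e (i : F) : gmul (quot (ginv g) (val i)) (val i) = Some (ginv g).
  by apply: quotP; rewrite (Fx _ (valP i)).
have e' (i : F) : gmul (ginv (val i)) (ginv (quot (ginv g) (val i))) = Some g.
  by rewrite (gmul_inv (e i)) ginvK.
rewrite (sec_starE _ (ginvK g)) (conv_colE _ e Fb) fstar_sum.
rewrite (conv_sumE e').
- apply: eq_bigr => i _; rewrite (fstarM _ erefl erefl _ (e' i)).
  by rewrite (sec_starE b erefl) (sec_starE a erefl).
- move=> i i' /(congr1 (@ginv G)); rewrite !ginvK => ii'.
  by apply: val_inj; have := e i; rewrite ii' => ei; exact: gmul_injr ei (e i').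
- move=> h k hk bh ak; have hk' := gmul_inv hk.
  have hF : ginv h \in F.
    apply: Fb; first by rewrite -(gmul_src hk').
    by apply: contraNneq bh => b0; rewrite (sec_starE b (ginvK h)) b0 fstar0.
  exists [` hF]%fset; rewrite /= (quot_eq hk') ginvK //.
Qed.

End convolution.

Lemma sum_le_single (R : realType) (I : finType) (P : pred I) (F : I -> R) (C : R) :
  0 <= C -> (forall i, P i -> F i <= C) -> (forall i j, P i -> P j -> i = j) ->
  \sum_(i | P i) F i <= C.
Proof.
move=> C0 FC PP; have [i Pi|noP] := pickP P; last by rewrite big_pred0.
rewrite (bigD1 i) //= big1 ?addr0; first exact: FC.
by move=> j /andP[Pj]; rewrite (PP j i) // eqxx.
Qed.

(** * Column norms and operator norms of sections *)

Section section_norms.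
Context (R : realType) (G : etaleGroupoid) (E : fellBundle R G).
Implicit Types (a b c f : section E) (g h x : G) (M N : R).

(* [col_bound a M] and [op_bound a M] are the inequalities [norm2 a <= M] and
   [normb a <= M], see [norm2P] and [normbP]. *)
Definition col_bound a M := forall x (ux : gunit x) (I : finType) (gam : I -> G)
  (hx : forall i, gsrc (gam i) = x), injective gam ->
  hnorm hx (fun i => a (gam i)) <= M.

Definition op_bound a M := forall f N, finite_set (supp f) -> 0 <= N ->
  col_bound f N -> col_bound (conv a f) (M * N).

Lemma col_bound_le a M M' : M <= M' -> col_bound a M -> col_bound a M'.
Proof. by move=> MM' aM x ux I gam hx inj; apply: le_trans (aM x ux I gam hx inj) MM'. Qed.

Lemma col_bound_entry a M g : col_bound a M -> rnorm (a g) <= M.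
Proof.
move=> aM; have ux : gunit (gsrc g) := gsrc_src g.
apply: le_trans (aM _ ux unit (fun=> g) (fun=> erefl) _); last by move=> [] [].
exact: (rnorm_le_hnorm ux (fun=> erefl) (fun=> a g) tt).
Qed.

Lemma col_bound_lin k a b M N : col_bound a M -> col_bound b N ->
  col_bound (fun g => k *: a g + b g) (complex.Re `|k| * M + N).
Proof.
move=> aM bN x ux I gam hx inj.
apply: le_trans (hnormD ux hx (fun i => k *: a (gam i)) (fun i => b (gam i))) _.
rewrite hnormZ lerD ?bN // ler_wpM2l ?aM //.
have kE : `|k| = (complex.Re `|k|)%:C.
  by have /ger0_Im := normr_ge0 k; case: `|k| => r s /= ->.
by rewrite -lecR -kE; exact: normr_ge0.
Qed.

Lemma col_bound_restrict a f M : col_bound a M ->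
  (forall g, f g = a g \/ f g = 0) -> col_bound f M.
Proof.
move=> aM fa x ux I gam hx inj; apply: (le_trans _ (aM x ux I gam hx inj)).
apply: (@hnorm_le R G E I gam x ux hx); rewrite /hip -sumrB; apply: (@cpos_sum R (unit_fibre E ux)) => i _.
have [->|->] := fa (gam i); first by rewrite subrr; exact: cpos0.
by rewrite ip0l subr0; exact: ip_pos.
Qed.

Lemma col_bound_finite f : finite_set (supp f) -> exists2 N, 0 <= N & col_bound f N.
Proof.
move=> /finite_fsetP[K KE]; exists (\sum_(k : K) rnorm (f (val k))).
  by apply: sumr_ge0 => k _; exact: rnorm_ge0.
move=> x ux I gam hx inj; apply: le_trans (hnorm_sum _ _) _.
have fK g : f g != 0 -> g \in K by move=> fg; have : supp f g by []; rewrite KE.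
apply: (@le_trans _ _ (\sum_i \sum_(k : K | val k == gam i) rnorm (f (val k)))).
  apply: ler_sum => i _; have [->|fi] := eqVneq (f (gam i)) 0.
    by rewrite rnorm0 sumr_ge0 // => k _; exact: rnorm_ge0.
  rewrite (bigD1 [` fK _ fi]%fset) //= lerDl sumr_ge0 // => k _; exact: rnorm_ge0.
rewrite (exchange_big_dep xpredT) //=; apply: ler_sum => k _.
apply: sum_le_single => //; first exact: rnorm_ge0.
by move=> i j /eqP ki /eqP kj; apply: inj; rewrite -ki -kj.
Qed.

Lemma col_bound_eq0 f g : col_bound f 0 -> f g = 0.
Proof.
by move=> /(@col_bound_entry _ _ g) f0; apply/eqP; rewrite -rnorm_eq0 eq_le f0 rnorm_ge0.
Qed.

Lemma finite_conv_sum a f g : finite_set (supp f) ->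
  exists (F : {fset G}) (e : forall i : F, gmul (quot g (val i)) (val i) = Some g),
    (forall k, k \in F -> gsrc k = gsrc g) /\
    (forall k, gsrc k = gsrc g -> f k != 0 -> k \in F) /\
    conv a f g = \sum_(i : F) fmul (e i) (a (quot g (val i))) (f (val i)).
Proof.
move=> /finite_supp_col/(_ (gsrc g))[F [Fx Ff]]; exists F.
have e (i : F) : gmul (quot g (val i)) (val i) = Some g.
  by apply: quotP; rewrite (Fx _ (valP i)).
by exists e; do 2!split => //; exact: conv_colE.
Qed.

Lemma conv_linl k a b c g : col_finite c ->
  conv (fun h => k *: a h + b h) c g = k *: conv a c g + conv b c g.
Proof.
move=> /(_ (gsrc g))[F [Fx Fc]].
have e (i : F) : gmul (quot g (val i)) (val i) = Some g.
  by apply: quotP; rewrite (Fx _ (valP i)).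
rewrite !(conv_colE _ e Fc) scaler_sumr -big_split; apply: eq_bigr => i _ /=.
by rewrite fmulDl fmulZl.
Qed.

Lemma conv_linr k a b c g : col_finite b -> col_finite c ->
  conv a (fun h => k *: b h + c h) g = k *: conv a b g + conv a c g.
Proof.
move=> /(_ (gsrc g))[F [Fx Fb]] /(_ (gsrc g))[F' [Fx' Fc]].
have FP h : h \in (F `|` F')%fset -> gsrc h = gsrc g.
  by rewrite inE => /orP[/Fx|/Fx'].
have e (i : (F `|` F')%fset) : gmul (quot g (val i)) (val i) = Some g.
  by apply: quotP; rewrite (FP _ (valP i)).
rewrite !(conv_colE _ e) => [|h hg ch|h hg bh|h hg kbc].
- rewrite scaler_sumr -big_split; apply: eq_bigr => i _ /=.
  by rewrite fmulDr fmulZr.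
- by rewrite inE Fc ?orbT.
- by rewrite inE Fb.
- rewrite inE; have [b0|b0] := eqVneq (b h) 0; last by rewrite Fb.
  by rewrite Fc ?orbT //; move: kbc; rewrite b0 scaler0 add0r.
Qed.

Lemma op_bound_lin k a b M N : op_bound a M -> op_bound b N ->
  op_bound (fun g => k *: a g + b g) (complex.Re `|k| * M + N).
Proof.
move=> aM bN f L ff L0 fL x ux I gam hx inj.
have := col_bound_lin k (aM f L ff L0 fL) (bN f L ff L0 fL).
rewrite mulrDl mulrA => /(_ x ux I gam hx inj); congr (_ <= _).
congr (Num.sqrt (rnorm _)); apply: eq_bigr => i _.
by rewrite conv_linl //; exact: finite_supp_col.
Qed.

Lemma op_bound_le a M M' : M <= M' -> op_bound a M -> op_bound a M'.
Proof.
move=> MM' aM f N ff N0 fN; apply: col_bound_le (aM f N ff N0 fN).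
by rewrite ler_wpM2r.
Qed.

Lemma hip_mulr x (ux : gunit x) (I : finType) (gam : I -> G)
    (hx : forall i, gsrc (gam i) = x) (e : forall i, gmul (gam i) x = Some (gam i))
    (xi : forall i, E (gam i)) (v : E x) :
  hip hx (fun i => fmul (e i) (xi i) v) (fun i => fmul (e i) (xi i) v) =
  fmul (gunit_mul ux) (fmul (gunit_mul ux) (fstar (gunit_inv ux) v) (hip hx xi xi)) v.
Proof.
rewrite /hip fmul_sumr fmul_suml; apply: eq_bigr => i _.
by rewrite (ip_mulr ux) (ip_mull ux).
Qed.

(* Testing [a] on a vector over the unit [x] recovers the column of [a] at [x]. *)
Lemma op_bound_col a M : 0 <= M -> op_bound a M -> col_bound a M.
Proof.
move=> M0 aM x ux I gam hx inj.
pose A := unit_fibre E ux; pose p : A := hip hx (fun i => a (gam i)) (fun i => a (gam i)).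
have P : cpos p := hip_pos ux hx _.
have ps : cs_star p = p := cpos_star P.
(* The test vector has the value [p = <a, a>] at [x], since the fibre may have no unit. Then
   [|a f|^2 = |p^3|], and [|p|^4 <= |p| |p^3| <= |p| M^2 |p|^2] yields [|p| <= M^2]. *)
have [f fx f0] := @dep_single G (fun g => E g) (fun=> 0) x (p : E x).
have ff : finite_set (supp f).
  apply: (@sub_finite_set _ _ [set x]); last exact: finite_set1.
  by move=> g /= fg; apply: contraTeq isT => gx; move: fg; rewrite /supp /= f0 ?eqxx.
have fb : col_bound f (rnorm p).
  move=> y uy J delta hy dinj; apply: le_trans (hnorm_sum _ _) _.
  rewrite (bigID (fun j => delta j == x)) /= [X in _ + X]big1 ?addr0; last first.
    by move=> j jx; rewrite f0 ?rnorm0.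
  apply: sum_le_single; first exact: rnorm_ge0.
    by move=> j /eqP ->; rewrite fx.
  by move=> i j /eqP ix /eqP jx; apply: dinj; rewrite ix.
have e i : gmul (gam i) x = Some (gam i) by exact: gmul_unitr.
have cE i : conv a f (gam i) = fmul (e i) (a (gam i)) (p : E x).
  rewrite (@conv_sumE R G E a f (gam i) unit (fun=> gam i) (fun=> x) (fun=> e i)).
  - by rewrite big_const cardT /= enumT unlock /= fx addr0.
  - by move=> [] [].
  - move=> h k hk _ fk; exists tt.
    by apply/eqP; rewrite eq_sym; apply: contraNT fk => kx; rewrite f0.
have := aM f _ ff (rnorm_ge0 p) fb x ux I gam hx inj.
rewrite -(@ler_pXn2r _ 2) ?nnegrE ?mulr_ge0 ?hnorm_ge0 ?rnorm_ge0 // hnorm_sq.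
have -> : hip hx (fun i => conv a f (gam i)) (fun i => conv a f (gam i)) =
    cs_mul (cs_mul p p) p.
  transitivity (cs_mul (cs_mul (cs_star p) p) p); last by rewrite ps.
  rewrite -[RHS](hip_mulr ux hx e (fun i => a (gam i)) p).
  by apply: eq_bigr => i _; rewrite !cE.
move=> H; have H3 : rnorm p ^+ 4 <= rnorm p * rnorm (cs_mul (cs_mul p p) p).
  have ps2 : cs_star (cs_mul p p) = cs_mul p p by rewrite cs_starM ps.
  rewrite -[4%N]/(2 * 2)%N exprM -!cs_rnorm_sq // cs_mulA mulrC.
  exact: cs_rnormM.
have pM : rnorm p <= M ^+ 2.
  have [->|p0] := eqVneq (rnorm p) 0; first exact: sqr_ge0.
  have {}p0 : 0 < rnorm p by rewrite lt_def p0 rnorm_ge0.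
  rewrite -(@ler_pM2r _ (rnorm p ^+ 3)) ?exprn_gt0 //.
  have H4 := le_trans H3 (ler_wpM2l (ltW p0) H).
  by move: H4; congr (_ <= _); ring.
by rewrite -(ger0_norm M0) -sqrtr_sqr ler_wsqrtr.
Qed.

Lemma op_bound_entry a M g : 0 <= M -> op_bound a M -> rnorm (a g) <= M.
Proof. by move=> M0 /(op_bound_col M0)/col_bound_entry. Qed.

(** A partial sum is the value at [g] of [conv a f], where [f] is [b] cut down to the finitely many
    second factors in [A]. This uniform bound is what makes infinite convolutions converge. *)
Lemma op_bound_partial a b M N g (A : {fset factorizations g}) :
  0 <= M -> 0 <= N -> op_bound a M -> op_bound b N ->
  rnorm (partial_sum (@conv_term R G E a b g) A) <= M * N.
Proof.
move=> M0 N0 aM bN.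
pose K : {fset G} := [fset (set_val z).2 | z in A]%fset.
pose f : section E := fun h => if h \in K then b h else 0.
have fb : col_bound f N.
  apply: col_bound_restrict (op_bound_col N0 bN) _ => h.
  by rewrite /f; case: ifP; [left|right].
have ff : finite_set (supp f).
  apply: (@sub_finite_set _ _ [set` K]); last exact: finite_fset.
  by move=> h; rewrite /supp /= /f; case: ifP => //; rewrite eqxx.
suff <- : conv a f g = partial_sum (@conv_term R G E a b g) A.
  by apply: col_bound_entry; exact: aM.
rewrite (@conv_sumE R G E a f g A (fun i => (set_val (val i)).1)
   (fun i => (set_val (val i)).2) (fun i => set_valP (val i))).
- apply: eq_bigr => i _; rewrite /conv_term /f ifT //.
  by apply/imfsetP; exists (val i) => //; exact: valP.
- move=> i j ij; apply/val_inj/val_inj.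
  have := set_valP (val i); have := set_valP (val j); rewrite /factorizations /=.
  rewrite -ij => ej ei; have e1 := gmul_injl ei ej.
  apply: etrans (surjective_pairing _) (etrans _ (esym (surjective_pairing _))).
  congr pair; [exact: e1|exact: ij].
- move=> h k hk _; rewrite /f; case: ifP => [/imfsetP[z /= zA ->] _|]; last by rewrite eqxx.
  by exists [` zA]%fset.
Qed.

End section_norms.

Section norm_characterizations.
Context (R : realType) (G : etaleGroupoid) (E : fellBundle R G).
Implicit Types (a b c f : section E) (g h x : G) (M N : R).

Lemma conv_small f g : finite_set (supp f) ->
  exists (S : seq G) (C : R), 0 <= C /\ forall (d : section E) (e : R), 0 <= e ->
    (forall h, h \in S -> rnorm (d h) <= e) -> rnorm (conv d f g) <= e * C.
Proof.
move=> /finite_supp_col/(_ (gsrc g))[F [Fx Ff]].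
have e (i : F) : gmul (quot g (val i)) (val i) = Some g.
  by apply: quotP; rewrite (Fx _ (valP i)).
exists [seq quot g k | k <- enum_fset F], (\sum_(i : F) rnorm (f (val i))); split.
  by apply: sumr_ge0 => i _; exact: rnorm_ge0.
move=> d r r0 dS; rewrite (conv_colE _ e Ff) mulr_sumr.
apply: le_trans (rnorm_sum _ _ _) _; apply: ler_sum => i _.
apply: le_trans (rnorm_fmul _ _ _) _; rewrite ler_wpM2r ?rnorm_ge0 //.
by apply: dS; apply/mapP; exists (val i) => //; exact: valP.
Qed.

(** For a fixed test section and finitely many rows, only finitely many values of [a] matter
    ([conv_small]). Hence operator bounds pass to pointwise limits. *)
Lemma op_bound_limit a M :
  (forall (S : seq G) (e : R), 0 < e ->
    exists2 a', op_bound a' M & forall g, g \in S -> rnorm (a g - a' g) <= e) ->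
  op_bound a M.
Proof.
move=> lim f N ff N0 fN x ux I gam hx inj.
have /choice[SC SCP] : forall i : I, exists p : seq G * R, 0 <= p.2 /\
    forall (d : section E) (e : R), 0 <= e ->
    (forall h, h \in p.1 -> rnorm (d h) <= e) -> rnorm (conv d f (gam i)) <= e * p.2.
  by move=> i; have [S [C SP]] := conv_small (gam i) ff; exists (S, C).
pose S := flatten [seq (SC i).1 | i : I].
rewrite -subr_le0; apply: (@le0_small _ _ (\sum_i (SC i).2)) => e e0 _.
have [a' a'M aa'] := lim S e e0.
pose d : section E := fun g => a g - a' g.
have dE i : conv a f (gam i) = conv a' f (gam i) + conv d f (gam i).
  rewrite -[conv a' f _]scale1r -conv_linl; last exact: finite_supp_col.
  suff <- : a = (fun g => 1 *: a' g + d g) by [].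
  apply: functional_extensionality_dep => g.
  by rewrite scale1r /d subrKC.
have -> : hnorm hx (fun i => conv a f (gam i)) =
    hnorm hx (fun i => conv a' f (gam i) + conv d f (gam i)).
  by congr (Num.sqrt (rnorm _)); apply: eq_bigr => i _; rewrite dE.
have H1 := hnormD ux hx (fun i => conv a' f (gam i)) (fun i => conv d f (gam i)).
have H2 := a'M f N ff N0 fN x ux I gam hx inj.
have H3 : hnorm hx (fun i => conv d f (gam i)) <= e * \sum_i (SC i).2.
  apply: le_trans (hnorm_sum _ _) _; rewrite mulr_sumr; apply: ler_sum => i _.
  have [_ H] := SCP i; apply: H; first exact: ltW.
  move=> h hS; apply: aa'; apply/flattenP; exists (SC i).1 => //.
  by apply/mapP; exists i => //; rewrite mem_enum.
by lra.
Qed.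

Lemma op_bound_conv a b M N : 0 <= N -> col_finite b ->
  op_bound a M -> op_bound b N -> op_bound (conv a b) (M * N).
Proof.
move=> N0 bf aM bN f L ff L0 fL; have ff' := finite_supp_col ff.
rewrite conv_assoc // -mulrA; apply: aM; [|exact: mulr_ge0|exact: bN].
exact: finite_supp_conv.
Qed.

Lemma hip_conv a b x (ux : gunit x) (I : finType) (gam : I -> G)
    (hx : forall i, gsrc (gam i) = x) : injective gam ->
  (forall g, gsrc g = x -> b g != 0 -> exists i, gam i = g) ->
  conv (sec_star a) b x = hip hx (fun i => a (gam i)) (fun i => b (gam i)).
Proof.
move=> inj cov; have e i : gmul (ginv (gam i)) (gam i) = Some x by rewrite gmulVg hx.
rewrite (conv_sumE e) // => [|h k hk _ bk].
  by apply: eq_bigr => i _; rewrite (sec_starE a erefl) (ipE _ erefl (e i)).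
by apply: cov => //; rewrite -(gmul_src hk).
Qed.

(* [|a f|^2 = <a f, a f> = <f, (a^* a) f>]. *)
Lemma op_bound_cstar a M : 0 <= M -> col_finite a -> col_finite (sec_star a) ->
  op_bound (conv (sec_star a) a) (M ^+ 2) -> op_bound a M.
Proof.
move=> M0 af asf aM f N ff N0 fN x ux I gam hx inj; have ff' := finite_supp_col ff.
have aff := col_finite_conv af ff'.
(* [hip_conv] requires a family exhausting the support over [x], so [gam] is enlarged to such a
   family, with [u] the inclusion of the indices. *)
have cover c : col_finite c -> exists (J : finType) (delta : J -> G)
    (hd : forall j, gsrc (delta j) = x) (u : I -> J),
    [/\ injective delta, forall i, delta (u i) = gam i &
        forall g, gsrc g = x -> c g != 0 -> exists j, delta j = g].
  move=> /(_ x)[F [Fx Fc]].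
  pose F' := (F `|` [fset gam i | i in I])%fset.
  have F'x (j : F') : gsrc (val j) = x.
    by have := valP j; rewrite inE => /orP[/Fx//|/imfsetP[i _ /= ->]].
  have uF i : gam i \in F' by rewrite inE; apply/orP; right; apply/imfsetP; exists i.
  exists F', val, F'x, (fun i => [` uF i]%fset); split=> [|//|g gx cg].
    exact: val_inj.
  have gF : g \in F' by rewrite inE Fc.
  by exists [` gF]%fset.
have [J [delta [hd [u [dinj du dcov]]]]] := cover _ aff.
apply: (@le_trans _ _ (hnorm hd (fun j => conv a f (delta j)))).
  have uinj : injective u by move=> i i' ii'; apply: inj; rewrite -!du ii'.
  have := hnorm_sub ux hd (fun j => conv a f (delta j)) uinj.
  congr (Num.sqrt (rnorm _) <= _); apply: eq_bigr => i _.
  by move: (hd (u i)) (hx i); rewrite du => h1 h2; rewrite (Prop_irrelevance h1 h2).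
rewrite -(@ler_pXn2r _ 2) ?nnegrE ?mulr_ge0 ?hnorm_ge0 // hnorm_sq.
rewrite -(hip_conv _ ux hd dinj dcov) conv_star // conv_assoc // -(conv_assoc _ af ff').
have asaf : col_finite (conv (conv (sec_star a) a) f).
  by apply: col_finite_conv ff'; exact: col_finite_conv.
have [J' [delta' [hd' [_ [dinj' _ dcov']]]]] := cover _ asaf.
rewrite (hip_conv _ ux hd' dinj' dcov'); apply: le_trans (cauchy_schwarz ux _ _ _) _.
have H1 := fN x ux J' delta' hd' dinj'.
have H2 := aM f N ff N0 fN x ux J' delta' hd' dinj'.
apply: le_trans (ler_pM (hnorm_ge0 _ _) (hnorm_ge0 _ _) H1 H2) _.
by rewrite le_eqVlt; apply/orP; left; apply/eqP; ring.
Qed.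

Lemma supremum0_le (A : set (\bar R)) (M : R) : 0 <= M ->
  (supremum0 A <= M%:E)%E <-> forall r, A r -> (r <= M%:E)%E.
Proof.
move=> M0; split=> [AM r Ar|AM].
  by apply: le_trans AM; apply: ereal_sup_ubound; right.
by apply: ge_ereal_sup => r [->|/AM//]; rewrite lee_fin.
Qed.

Lemma supremum0_ge0 (A : set (\bar R)) : (0 <= supremum0 A)%E.
Proof. by apply: ereal_sup_ubound; left. Qed.

Lemma norm2P a M : 0 <= M -> (norm2 a <= M%:E)%E <-> col_bound a M.
Proof.
move=> M0; rewrite /norm2 supremum0_le //; split=> [aM x ux I gam hx inj|aM r].
  pose j (i : I) : star_fibre x := @sub_elt G (star_fibre x) (gam i) (hx i).
  have jinj : injective j by move=> i i' /(congr1 set_val)/inj.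
  have := aM (hnorm hx (fun i => a (gam i)))%:E; rewrite lee_fin; apply.
  exists x => //; exists [fset j i | i in I]%fset; congr (Num.sqrt (rnorm _))%:E.
  rewrite /partial_sum -(big_seq_fsetE _ _ xpredT (@norm2_term R G E a x)) /=.
  rewrite big_imfset /= => [|? ? _ _ /jinj//]; rewrite big_enum /=.
  apply: eq_bigr => i _; rewrite /norm2_term /=; exact: fmul_irr.
move=> [x ux [F ->]]; rewrite lee_fin.
apply: (aM x ux F (fun i => set_val (val i)) (fun i => set_valP (val i))).
by move=> i i' /val_inj/val_inj.
Qed.

Lemma norm2_ge0 a : (0 <= norm2 a)%E.
Proof. exact: supremum0_ge0. Qed.

Lemma normb_ge0 a : (0 <= normb a)%E.
Proof. exact: supremum0_ge0. Qed.

Lemma norm2_finite f : finite_set (supp f) -> exists2 r : R, 0 <= r & norm2 f = r%:E.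
Proof.
move=> /col_bound_finite[N N0 /(norm2P _ N0)].
have := norm2_ge0 f; case: (norm2 f) => [r||//] r0 rN; last by rewrite leNgt ltry in rN.
by exists r.
Qed.

Lemma normbP a M : 0 <= M -> (normb a <= M%:E)%E <-> op_bound a M.
Proof.
move=> M0; rewrite /normb supremum0_le //; split=> [aM f N ff N0 fN|aM _ [f ff <-]].
  have [r r0 rE] := norm2_finite ff.
  (* If [norm2 f = 0], the quotient in [normb] says nothing, but then [f] and with it [conv a f]
     vanish. *)
  have [rz|rz] := eqVneq r 0.
    have f0 g : f g = 0 by apply: col_bound_eq0; apply/norm2P => //; rewrite rE rz.
    apply: (@col_bound_le _ _ _ _ 0); first exact: mulr_ge0.
    move=> x ux I gam hx inj; rewrite /hnorm /hip big1 ?rnorm0 ?sqrtr0 // => i _.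
    rewrite (_ : conv a f (gam i) = 0) ?ip0l //.
    have [F [e [_ [_ ->]]]] := finite_conv_sum a (gam i) ff.
    by rewrite big1 // => k _; rewrite f0 fmul0r.
  have {}r0 : 0 < r by rewrite lt_def rz.
  have := aM (norm2 (conv a f) / norm2 f)%E (ex_intro2 _ _ f ff erefl).
  rewrite rE inver (negbTE rz) => H.
  have rN : r <= N by have /(norm2P _ N0) := fN; rewrite rE lee_fin.
  apply/norm2P; first exact: mulr_ge0.
  apply: (@le_trans _ _ (M * r)%:E); last by rewrite lee_fin ler_wpM2l.
  by rewrite EFinM -lee_pdivrMr.
have [r r0 rE] := norm2_finite ff; rewrite rE.
have fr : col_bound f r by apply/norm2P => //; rewrite rE.
have H := aM f r ff r0 fr; have /(norm2P _ (mulr_ge0 M0 r0)) {}H := H.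
have [rz|rz] := eqVneq r 0.
  rewrite rz mulr0 in H; have := norm2_ge0 (conv a f).
  move=> H'; have -> : norm2 (conv a f) = 0%E by apply/eqP; rewrite eq_le H H'.
  by rewrite mul0e lee_fin.
have {}r0 : 0 < r by rewrite lt_def rz.
by rewrite inver (negbTE rz) lee_pdivrMr // -EFinM.
Qed.

Definition bnorm a : R := fine (normb a).

Definition bfinite a := exists2 M : R, 0 <= M & op_bound a M.

Lemma bnorm_ge0 a : 0 <= bnorm a.
Proof. by rewrite fine_ge0 // normb_ge0. Qed.

Lemma bfiniteP a : bfinite a <-> (normb a < +oo)%E.
Proof.
split=> [[M M0 /(normbP _ M0) aM]|aoo]; first exact: le_lt_trans aM (ltry _).
exists (bnorm a); first exact: bnorm_ge0.
by apply/normbP; rewrite ?bnorm_ge0 // fineK // ge0_fin_numE ?normb_ge0.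
Qed.

Lemma normbE a : bfinite a -> normb a = (bnorm a)%:E.
Proof. by move=> /bfiniteP aoo; rewrite fineK // ge0_fin_numE ?normb_ge0. Qed.

Lemma bnorm_bound a : bfinite a -> op_bound a (bnorm a).
Proof. by move=> /normbE aE; apply/normbP; rewrite ?bnorm_ge0 // aE. Qed.

Lemma bnorm_le a M : 0 <= M -> op_bound a M -> bnorm a <= M.
Proof.
move=> M0 aM; have af : bfinite a by exists M.
by rewrite -lee_fin -normbE //; exact/normbP.
Qed.

Lemma bnorm_entry a g : bfinite a -> rnorm (a g) <= bnorm a.
Proof. by move=> af; apply: op_bound_entry; [exact: bnorm_ge0|exact: bnorm_bound]. Qed.

(** [|a|^2 <= |a^* a| <= |a^*| |a|], the first inequality being [op_bound_cstar]. *)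
Lemma bnorm_cstar a : col_finite a -> col_finite (sec_star a) -> bfinite a ->
  bfinite (sec_star a) -> bnorm a <= bnorm (sec_star a).
Proof.
move=> af asf ab asb; have n0 := bnorm_ge0 a; have ns0 := bnorm_ge0 (sec_star a).
set s := bnorm (sec_star a) * bnorm a; have s0 : 0 <= s := mulr_ge0 ns0 n0.
have s2 := sqr_sqrtr s0.
have H : bnorm a <= Num.sqrt s.
  apply: bnorm_le; first exact: sqrtr_ge0.
  apply: (op_bound_cstar (sqrtr_ge0 s) af asf); rewrite s2.
  exact: (op_bound_conv n0 af (bnorm_bound asb) (bnorm_bound ab)).
apply: (sqr_le_mul n0 ns0); rewrite -/s -s2.
exact: (lerXn2r 2 n0 (sqrtr_ge0 s) H).
Qed.

Lemma bnorm_star a : col_finite a -> col_finite (sec_star a) -> bfinite a ->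
  bfinite (sec_star a) -> bnorm (sec_star a) = bnorm a.
Proof.
move=> af asf ab asb; apply/le_anti/andP; split; last exact: bnorm_cstar.
by rewrite -{2}(sec_starK a) bnorm_cstar ?sec_starK.
Qed.

End norm_characterizations.

(** * Compactly supported sections *)

Section etale_topology.
Context (G : etaleGroupoid).
Implicit Types (g h x : G) (K L O U : set G).

Lemma grng_continuous : continuous (@grng G).
Proof.
move=> g W gW; have [[A B] /= [gA gB] AB] :=
  @gmul_continuous G (g, ginv g) _ (gmulgV g) _ gW.
apply: filterS (filterI gA (ginv_continuous gB)) => h [Ah Bh].
exact: (AB (h, ginv h) (conj Ah Bh) _ (gmulgV h)).
Qed.

Lemma gsrc_continuous : continuous (@gsrc G).
Proof.
move=> g W gW; have [[A B] /= [gA gB] AB] :=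
  @gmul_continuous G (ginv g, g) _ (gmulVg g) _ gW.
have gA' : nbhs g (@ginv G @^-1` A) := ginv_continuous gA.
apply: filterS (filterI gA' gB) => h [Ah Bh].
exact: (AB (ginv h, h) (conj Ah Bh) _ (gmulVg h)).
Qed.

Lemma ginv_image U : @ginv G @` U = @ginv G @^-1` U.
Proof.
apply/seteqP; split=> [_ [g Ug <-]|g Ug] /=; first by rewrite ginvK.
by exists (ginv g) => //; exact: ginvK.
Qed.

Lemma ginv_open U : open U -> open (@ginv G @` U).
Proof. by move=> oU; rewrite ginv_image; apply: open_comp => // g _; exact: ginv_continuous. Qed.

Lemma gsrc_ginv U : @gsrc G @` (@ginv G @` U) = @grng G @` U.
Proof.
apply/seteqP; split=> [_ [_ [g Ug <-] <-]|_ [g Ug <-]].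
  by exists g => //; rewrite gsrcV.
by exists (ginv g); [exists g|exact: gsrcV].
Qed.

Lemma grng_ginv U : @grng G @` (@ginv G @` U) = @gsrc G @` U.
Proof.
apply/seteqP; split=> [_ [_ [g Ug <-] <-]|_ [g Ug <-]].
  by exists g => //; rewrite grngV.
by exists (ginv g); [exists g|exact: grngV].
Qed.

Lemma grng_open U : open U -> open (@grng G @` U).
Proof. by move=> oU; rewrite -gsrc_ginv; apply: gsrc_open; exact: ginv_open. Qed.

Lemma slice_src O g h : slice O -> O g -> O h -> gsrc g = gsrc h -> g = h.
Proof. by move=> [inj _] Og Oh; apply: inj; rewrite inE. Qed.

Lemma slice_rng O g h : slice O -> O g -> O h -> grng g = grng h -> g = h.
Proof. by move=> [_ inj] Og Oh; apply: inj; rewrite inE. Qed.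

Lemma slice_ginv O : slice O -> slice (@ginv G @` O).
Proof.
move=> sO; split=> g h; rewrite !inE => -[g' Og <-] [h' Oh <-].
  by rewrite !gsrcV => /(slice_rng sO Og Oh) ->.
by rewrite !grngV => /(slice_src sO Og Oh) ->.
Qed.

Lemma bicompact_ginv K : bicompact K -> bicompact (@ginv G @` K).
Proof.
move=> [[sK rK] cK [ O [oO sO KO]]]; split.
- by rewrite /biclosed gsrc_ginv grng_ginv.
- apply: continuous_compact cK; apply: continuous_subspaceT.
  exact: ginv_continuous.
- exists (@ginv G @` O); split; [exact: ginv_open|exact: slice_ginv|].
  by move=> _ [g /KO Og <-]; exists g.
Qed.

Definition gprod K L : set G :=
  [set g | exists a b, [/\ K a, L b & gmul a b = Some g]].

Lemma gprod_ginv K L : @ginv G @` gprod K L = gprod (@ginv G @` L) (@ginv G @` K).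
Proof.
apply/seteqP; split=> [y [g [a [b [Ka Lb ab]]] gy]|g].
  by subst y; exists (ginv b), (ginv a); split; [exists b|exists a|exact: gmul_inv].
move=> [x [y [[b Lb bx] [a Ka ay] ba]]]; subst x y.
exists (ginv g); last exact: ginvK.
by exists a, b; split => //; have := gmul_inv ba; rewrite !ginvK.
Qed.

Lemma slice_gprod O U : slice O -> slice U -> slice (gprod O U).
Proof.
move=> sO sU; split=> g h; rewrite !inE => -[a [b [Oa Ub ab]]] [c [d [Oc Ud cd]]].
  rewrite (gmul_src ab) (gmul_src cd) => /(slice_src sU Ub Ud) bd; subst d.
  have ac : a = c by apply: (slice_src sO Oa Oc); rewrite (gmul_comp ab) (gmul_comp cd).
  by subst c; move: cd; rewrite ab => -[].
rewrite (gmul_rng ab) (gmul_rng cd) => /(slice_rng sO Oa Oc) ac; subst c.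
have bd : b = d by apply: (slice_rng sU Ub Ud); rewrite -(gmul_comp ab) -(gmul_comp cd).
by subst d; move: cd; rewrite ab => -[].
Qed.

(** The range map is open, so any [h] near [g] has the range of some [a'] near [a]; then
    [b' = a'^-1 h] is near [b] by continuity. *)
Lemma near_factorization a b g (V W : set G) : gmul a b = Some g ->
  nbhs a V -> nbhs b W ->
  \forall h \near g, exists a' b', [/\ V a', W b' & gmul a' b' = Some h].
Proof.
move=> ab aV bW; have [[A B] /= [aA gB] AB] :=
  @gmul_continuous G (ginv a, g) _ (gmul_divl ab) _ bW.
have : nbhs a (V `&` @ginv G @^-1` A) by apply: filterI => //; exact: ginv_continuous.
rewrite nbhsE => -[V' [oV' V'a] V'V].
have gV' : nbhs g (@grng G @^-1` (@grng G @` V')).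
  apply: grng_continuous; apply: open_nbhs_nbhs; split; first exact: grng_open.
  by exists a => //; rewrite (gmul_rng ab).
apply: filterS (filterI gV' gB) => h [/= [a' V'a' ah] Bh].
have [Va' Aa'] := V'V _ V'a'.
have [b' a'h] : exists b', gmul (ginv a') h = Some b'.
  by apply: gmul_exists; rewrite gsrcV ah.
exists a', b'; split => //; first exact: (AB (ginv a', h) (conj Aa' Bh) _ a'h).
by have := gmul_divl a'h; rewrite ginvK.
Qed.

Lemma open_gprod O U : open O -> open U -> open (gprod O U).
Proof.
move=> oO oU; rewrite openE => g [a [b [Oa Ub ab]]].
have := near_factorization ab (open_nbhs_nbhs (conj oO Oa)) (open_nbhs_nbhs (conj oU Ub)).
by apply: filterS => h [a' [b' [? ? ?]]]; exists a', b'.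
Qed.

(* On an open slice the source map is a homeomorphism onto an open set. *)
Lemma slice_compact O K : open O -> slice O -> K `<=` O ->
  compact (@gsrc G @` K) -> compact K.
Proof.
move=> oO sO KO cK F FF FK.
have sFK : (@gsrc G @ F) (@gsrc G @` K).
  exact: (filterS (@preimage_image _ _ (@gsrc G) K) FK).
have [_ [[g Kg <-] gF]] := cK _ _ sFK.
exists g; split=> // A B FA gB.
have : nbhs g (B `&` O).
  by apply: filterI => //; apply: open_nbhs_nbhs; split => //; exact: KO.
rewrite nbhsE => -[V [oV Vg] VBO].
have sFA : (@gsrc G @ F) (@gsrc G @` (A `&` K)).
  exact: (filterS (@preimage_image _ _ (@gsrc G) (A `&` K)) (filterI FA FK)).
have gV : nbhs (gsrc g) (@gsrc G @` V).
  by apply: open_nbhs_nbhs; split; [exact: gsrc_open|exists g].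
have [_ [[h [Ah Kh] <-] [h' Vh' hh']]] := gF _ _ sFA gV.
have [Bh' Oh'] := VBO _ Vh'; have h'h := slice_src sO Oh' (KO _ Kh) hh'.
by exists h; split => //; rewrite -h'h.
Qed.

(** A unit [x] in the closure is the source of some [b] in [L], and the point is that [grng b] lies
    in [s[K]]. Otherwise the elements of the open slice [U] whose range avoids [CK] have sources
    forming a neighbourhood of [x]. It meets [s[KL]], and injectivity of the source on [U] gives an
    element of [L] whose range is both in and outside [CK]. *)
Lemma gprod_src_closed K L : bicompact K -> bicompact L ->
  closed_in (@gunit G) (@gsrc G @` gprod K L).
Proof.
move=> [[[CK cCK KE] _] _ _] [[[CL cCL LE] _] _ [U [oU sU LU]]].
exists (closure (@gsrc G @` gprod K L)); first exact: closed_closure.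
apply/seteqP; split=> [y KLy|x [ux clx]].
  split; last exact: subset_closure.
  by case: KLy => g _ <-; exact: gsrc_src.
have [b Lb bx] : (@gsrc G @` L) x.
  rewrite LE; split=> //; apply: cCL; apply: closure_subset clx => _ [g [a [b [Ka Lb ab]]] <-].
  have : (@gsrc G @` L) (gsrc g) by exists b => //; rewrite (gmul_src ab).
  by rewrite LE => -[].
suff [a Ka ab] : (@gsrc G @` K) (grng b).
  have [g gP] := gmul_exists ab.
  by exists g; [exists a, b|rewrite (gmul_src gP)].
rewrite KE; split; first exact: gsrc_rng.
apply: contrapT => nC.
pose V := U `&` (@grng G @^-1` ~` CK).
have oV : open V.
  apply: openI => //; apply: open_comp; last exact: closed_openC.
  by move=> h _; exact: grng_continuous.
have xV : nbhs x (@gsrc G @` V).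
  by apply: open_nbhs_nbhs; split; [exact: gsrc_open|exists b => //; split=> //; exact: LU].
have [_ [[g [a' [b'' [Ka' Lb'' ab'']]] <-] [b' [Ub' nCb'] b'g]]] := clx _ xV.
have b'b'' : b' = b''.
  by apply: (slice_src sU Ub' (LU _ Lb'')); rewrite b'g (gmul_src ab'').
apply: nCb'; rewrite b'b'' -(gmul_comp ab'').
have : (@gsrc G @` K) (gsrc a') by exists a'.
by rewrite KE => -[].
Qed.

(** The range is handled by inversion. Compactness comes from [slice_compact], as the source of the
    product is a closed part of the compact set [s[L]]. *)
Lemma gprod_bicompact K L : bicompact K -> bicompact L -> bicompact (gprod K L).
Proof.
move=> bK bL; have sKL := gprod_src_closed bK bL.
have rKL := gprod_src_closed (bicompact_ginv bL) (bicompact_ginv bK).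
rewrite -gprod_ginv gsrc_ginv in rKL.
have [_ cK [ O [oO sO KO]]] := bK; have [_ cL [U [oU sU LU]]] := bL.
have KLOU : gprod K L `<=` gprod O U.
  by move=> g [a [b [/KO Oa /LU Ub ab]]]; exists a, b.
split => //; last first.
  by exists (gprod O U); split; [exact: open_gprod|exact: slice_gprod|].
apply: (slice_compact (open_gprod oO oU) (slice_gprod sO sU) KLOU).
have [C cC CE] := sKL; rewrite (_ : _ @` _ = (@gsrc G @` L) `&` C).
  apply: compact_closedI => //; apply: continuous_compact cL.
  by apply: continuous_subspaceT; exact: gsrc_continuous.
apply/seteqP; split=> [y KLy|_ [[b Lb <-] Cy]].
  split; last by move: KLy; rewrite CE => -[].
  by case: KLy => g [a [b [Ka Lb ab]]] <-; exists b => //; rewrite (gmul_src ab).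
by rewrite CE; split => //; exact: gsrc_src.
Qed.

End etale_topology.

(** * Sections supported in bicompact sets and their span *)

Section slice_sections.
Context (R : realType) (G : etaleGroupoid) (E : fellBundle R G).
Implicit Types (a b c f : section E) (g h x : G) (K L O : set G) (M N : R).

Definition elementary K a := bicompact K /\ @continuous_on R G E K a.

Lemma supp_sub a K g : supp a `<=` K -> a g != 0 -> K g.
Proof. by move=> aK ag; exact: aK. Qed.

Lemma slice_col_finite O a : slice O -> supp a `<=` O -> col_finite a.
Proof.
move=> sO aO; apply: col_finite_sup => x.
have [[g [gx ag]]|no] := pselect (exists g, gsrc g = x /\ a g != 0).
  exists [fset g]%fset => h hx ah; rewrite inE; apply/eqP.
  by apply: (slice_src sO (supp_sub aO ah) (supp_sub aO ag)); rewrite hx.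
by exists fset0 => h hx ah; exfalso; apply: no; exists h.
Qed.

Lemma elementary_col_finite K a : elementary K a -> col_finite a.
Proof.
move=> [[_ _ [ U [_ sU KU]]] [aK _]]; apply: (slice_col_finite sU).
exact: subset_trans aK KU.
Qed.

(** Upper semicontinuity of the norm suffices: the open sets where the norm is below [n] increase
    with [n] and cover the compact set. *)
Lemma elementary_bounded K a : elementary K a ->
  exists2 M, 0 <= M & forall g, rnorm (a g) <= M.
Proof.
move=> [[_ cK _] [aK ca]].
pose P (n : nat) (g : G) : Prop := rnorm (a g) < n%:R.
have : \forall n \near \oo, K `<=` P n.
  move/compact_near_coveringP: cK; apply => g Kg.
  pose n0 := Num.bound (rnorm (a g)).
  have gn0 : rnorm (a g) < n0%:R by exact: archi_boundP (rnorm_ge0 _).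
  have bn : nbhs (tot (a g) : tspace E) [set b | tnorm b < n0%:R].
    apply: open_nbhs_nbhs; split; last exact: gn0.
    exact: (tnorm_usc (fell_banach E)).
  exists ((fun h => tot (a h) : tspace E) @^-1` [set b | tnorm b < n0%:R],
          [set n | (n0 <= n)%N]) => /=.
    split; first exact: (ca _ Kg).
    by exists n0.
  move=> [h n] /= [ah nn]; apply: lt_le_trans ah _.
  by rewrite ler_nat.
move=> [n _ /(_ n (leqnn n)) Kn]; exists n%:R => // g.
have [->|ag] := eqVneq (a g) 0; first by rewrite rnorm0.
by apply: ltW; apply: Kn; exact: supp_sub ag.
Qed.

Lemma ip_sum_single x g (hg : gsrc g = x) (I : finType) (t : I -> E g) :
  (forall i j, t i != 0 -> t j != 0 -> i = j) ->
  ip hg (\sum_i t i) (\sum_i t i) = \sum_i ip hg (t i) (t i).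
Proof.
move=> ti; have [i ti0|t0] := pickP (fun i => t i != 0).
  have tj j : j != i -> t j = 0.
    by move=> ji; apply/eqP; apply: contraNT ji => tj; apply/eqP; exact: ti.
  rewrite (bigD1 i) //= [X in _ + X]big1 ?addr0 => [|j /tj//].
  rewrite [RHS](bigD1 i) //= big1 ?addr0 // => j /tj ->.
  by rewrite ip0l.
have {}t0 i : t i = 0 by apply/eqP/negbFE/t0.
by rewrite !big1 ?ip0l // => i _; rewrite t0 // ip0l.
Qed.

(* A section supported in a slice acts by a partial injection on each column. *)
Lemma slice_op_bound O a M : slice O -> supp a `<=` O -> 0 <= M ->
  (forall g, rnorm (a g) <= M) -> op_bound a M.
Proof.
move=> sO aO M0 aM f N ff N0 fN x ux I gam hx inj.
have [F [Fx Ff]] := finite_supp_col ff x.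
have Fx' (k : F) : gsrc (val k) = x by rewrite Fx // (valP k).
have e i (k : F) : gmul (quot (gam i) (val k)) (val k) = Some (gam i).
  by apply: quotP; rewrite hx Fx'.
pose t i (k : F) := fmul (e i k) (a (quot (gam i) (val k))) (f (val k)).
have cE i : conv a f (gam i) = \sum_(k : F) t i k.
  by apply: conv_colE => k; rewrite hx; exact: Ff.
have tO i k : t i k != 0 -> O (quot (gam i) (val k)).
  move=> tik; apply: (supp_sub aO); apply: contraNneq tik => a0.
  by rewrite /t a0 fmul0l.
(* Since [O] is a slice, the matrix [t] has at most one nonzero entry in each row, and by [tcol] in
   each column. So no cross terms arise and [ip_contract] applies entry by entry. *)
have trow i k k' : t i k != 0 -> t i k' != 0 -> k = k'.
  move=> /tO Ok /tO Ok'; apply: val_inj.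
  have q : quot (gam i) (val k) = quot (gam i) (val k').
    by apply: (slice_rng sO) => //; rewrite -(gmul_rng (e i k)) -(gmul_rng (e i k')).
  by apply: (gmul_injr (e i k)); rewrite q.
have tcol i i' k : t i k != 0 -> t i' k != 0 -> i = i'.
  move=> /tO Oi /tO Oi'; apply: inj.
  have q : quot (gam i) (val k) = quot (gam i') (val k).
    by apply: (slice_src sO) => //; rewrite (gmul_comp (e i k)) (gmul_comp (e i' k)).
  by have := e i k; rewrite q (e i' k) => -[].
apply: (@le_trans _ _ (M * hnorm Fx' (fun k => f (val k)))); last first.
  by rewrite ler_wpM2l //; apply: (fN x ux F (fun k => val k) Fx'); exact: val_inj.
have -> : M * hnorm Fx' (fun k => f (val k)) = Num.sqrt (rnorm
    ((M ^+ 2)%:C *: hip Fx' (fun k => f (val k)) (fun k => f (val k)))).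
  by rewrite rnormZr ger0_norm ?sqr_ge0 // sqrtrM ?sqr_ge0 // sqrtr_sqr ger0_norm.
apply: ler_wsqrtr; apply: (@cpos_rnorm_le R (unit_fibre E ux)); first exact: hip_pos.
rewrite (_ : hip hx _ _ = \sum_(k : F) \sum_i ip (hx i) (t i k) (t i k)); last first.
  rewrite exchange_big; apply: eq_bigr => i _ /=.
  by rewrite cE ip_sum_single //; exact: trow.
rewrite /hip scaler_sumr -sumrB; apply: (@cpos_sum R (unit_fibre E ux)) => k _.
have [i tik|t0] := pickP (fun i => t i k != 0); last first.
  rewrite big1 => [|i _]; last by rewrite (eqP (negbFE (t0 i))) ip0l.
  rewrite subr0; apply: (@cposZ R (unit_fibre E ux)); [exact: sqr_ge0|exact: ip_pos].
rewrite (bigD1 i) //= [X in _ - (_ + X)]big1 => [|j ji]; last first.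
  suff -> : t j k = 0 by rewrite ip0l.
  by apply/eqP; apply: contraNT ji => tj; apply/eqP; exact: tcol tj tik.
by rewrite addr0; exact: ip_contract.
Qed.

Lemma elementary_bfinite K a : elementary K a -> bfinite a.
Proof.
move=> eK; have [M M0 aM] := elementary_bounded eK.
have [[_ _ [ U [_ sU KU]]] [aK _]] := eK.
exists M => //; apply: (slice_op_bound sU) => //.
exact: subset_trans aK KU.
Qed.

Lemma elementary_star K a : elementary K a ->
  elementary (@ginv G @` K) (sec_star a).
Proof.
move=> [bK [aK ca]]; split; first exact: bicompact_ginv.
split=> [g sg|g [k Kk kg]].
  exists (ginv g); last exact: ginvK.
  by apply: aK; apply: contraNneq sg => a0; rewrite /sec_star a0 fstar0.
have totE (p q : G) (e : ginv p = q) (y : E p) :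
    tot (fstar e y) = tot (fstar erefl y) :> tspace E by subst q.
rewrite (_ : (fun h => _) = (fun b : tspace E => tot (fstar erefl (vec b)) : tspace E) \o
    (fun h => tot (a h) : tspace E) \o @ginv G); last first.
  by apply/funext => h /=; rewrite /sec_star totE.
have gk : ginv g = k by rewrite -kg ginvK.
apply: continuous_comp; first exact: ginv_continuous.
apply: continuous_comp; first by rewrite gk; exact: ca.
exact: fstar_continuous.
Qed.

Lemma conv_slice O a b p q h (e : gmul p q = Some h) : slice O -> supp a `<=` O ->
  O p -> conv a b h = fmul e (a p) (b q).
Proof.
move=> sO aO Op.
rewrite (@conv_sumE R G E a b h unit (fun=> p) (fun=> q) (fun=> e)).
- by rewrite big_const cardT /= enumT unlock /= addr0.
- by move=> [] [].
move=> p' q' e' ap' _; exists tt.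
have pp : p = p' by apply: (slice_rng sO Op (supp_sub aO ap')); rewrite -(gmul_rng e) -(gmul_rng e').
by subst p'; exact: gmul_injr e e'.
Qed.

(** Near a point of the product set, the convolution reduces to the single product [a p' b q'] for a
    factorization supplied by [near_factorization]. Its first factor lies in the slice [U], which
    makes it the only one to contribute. *)
Lemma elementary_conv K L a b : elementary K a -> elementary L b ->
  elementary (gprod K L) (conv a b).
Proof.
move=> eK eL; have bf := elementary_col_finite eL.
have [bK [aK ca]] := eK; have [bL [bL' cb]] := eL.
have [_ _ [ U [oU sU KU]]] := bK; have aU := subset_trans aK KU.
split; first exact: gprod_bicompact.
split=> [g /conv_neq0 /(_ bf)[p [q [pq ap bq]]]|g [p [q [Kp Lq pq]]]].
  by exists p, q; split => //; [exact: aK|exact: bL'].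
move=> W; rewrite (conv_slice b pq sU aU (KU _ Kp)) => gW.
have [[A B] /= [apA bqB] AB] := @fmul_continuous _ _ E (tot (a p), tot (b q)) _
  (ex_intro _ p (ex_intro _ q (ex_intro _ g (ex_intro _ pq
    (ex_intro _ (a p) (ex_intro _ (b q) (conj erefl erefl))))))) _ gW.
have pA := ca _ Kp _ apA; have qB := cb _ Lq _ bqB.
have pU := open_nbhs_nbhs (conj oU (KU _ Kp)).
have pAU : nbhs p ((fun h => tot (a h) : tspace E) @^-1` A `&` U) by exact: filterI.
apply: filterS (near_factorization pq pAU qB) => h [p' [q' [[Ap' Up'] Bq' e']]].
rewrite /= (conv_slice b e' sU aU Up').
apply: (AB (tot (a p'), tot (b q')) (conj Ap' Bq')).
by exists p', q', h, e', (a p'), (b q').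
Qed.

Local Notation N := (@compact_sections R G E).

Lemma compact_sections_cons k K a b : elementary K a -> N b ->
  N (fun g => k *: a g + b g).
Proof.
move=> eK [n [l [L [f [Lf bE]]]]].
exists n.+1, (fun i => if unlift ord0 i is Some j then l j else k),
  (fun i => if unlift ord0 i is Some j then L j else K),
  (fun i => if unlift ord0 i is Some j then f j else a); split.
  by move=> i; case: (unlift ord0 i).
move=> g; rewrite big_ord_recl unlift_none bE; congr (_ + _).
by apply: eq_bigr => i _; rewrite liftK.
Qed.

Lemma compact_sections_ind (P : section E -> Prop) :
  P (fun=> 0) ->
  (forall k K a b, elementary K a -> P b -> P (fun g => k *: a g + b g)) ->
  forall a, N a -> P a.
Proof.
move=> P0 PS a [n]; elim: n a => [|n IH] a [l [L [f [Lf aE]]]].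
  rewrite (_ : a = (fun=> 0)) //; apply: functional_extensionality_dep => g.
  by rewrite aE big_ord0.
rewrite (_ : a = (fun g => l ord0 *: f ord0 g + \sum_(i < n) l (lift ord0 i) *: f (lift ord0 i) g)).
  apply: (PS _ (L ord0)); first exact: Lf.
  apply: IH; exists (fun i => l (lift ord0 i)), (fun i => L (lift ord0 i)),
    (fun i => f (lift ord0 i)); split => // i; exact: Lf.
by apply: functional_extensionality_dep => g; rewrite aE big_ord_recl.
Qed.

Lemma compact_sections0 : N (fun=> 0).
Proof.
exists 0%N, (fun=> 0), (fun=> set0), (fun=> fun=> 0); split; first by case.
by move=> g; rewrite big_ord0.
Qed.

Lemma compact_sections_lin k a b : N a -> N b -> N (fun g => k *: a g + b g).
Proof.
move=> Na Nb; elim/compact_sections_ind: Na => [|l K e c eK IH].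
  rewrite (_ : (fun g => _) = b) //.
  by apply: functional_extensionality_dep => g; rewrite scaler0 add0r.
rewrite (_ : (fun g => _) = (fun g => (k * l) *: e g + (k *: c g + b g))).
  exact: compact_sections_cons eK IH.
by apply: functional_extensionality_dep => g; rewrite scalerDr scalerA addrA.
Qed.

Lemma compact_sections_elementary K a : elementary K a -> N a.
Proof.
move=> eK; rewrite (_ : a = (fun g => 1 *: a g + 0)).
  exact: compact_sections_cons eK compact_sections0.
by apply: functional_extensionality_dep => g; rewrite scale1r addr0.
Qed.

Lemma compact_sections_col_finite a : N a -> col_finite a.
Proof.
elim/compact_sections_ind => [|k K e b eK bf].
  by apply: col_finite_sup => x; exists fset0 => g _; rewrite eqxx.
apply: col_finite_sup => x; have [F [_ Fe]] := elementary_col_finite eK x.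
have [F' [_ Fb]] := bf x; exists (F `|` F')%fset => g gx; rewrite inE.
have [b0|b0] := eqVneq (b g) 0; last by rewrite (Fb g gx b0) orbT.
rewrite b0 addr0 => ke; rewrite Fe //.
by apply: contraNneq ke => ->; rewrite scaler0.
Qed.

Lemma compact_sections_bfinite a : N a -> bfinite a.
Proof.
elim/compact_sections_ind => [|k K e b eK [M M0 bM]].
  exists 0 => //; apply: (@slice_op_bound set0) => //.
  - by split=> ? ?; rewrite !inE.
  - by move=> g; rewrite /supp /= eqxx.
  - by move=> g; rewrite rnorm0.
have [L L0 eL] := elementary_bfinite eK.
exists (complex.Re `|k| * L + M); last exact: op_bound_lin.
rewrite addr_ge0 // mulr_ge0 //.
have kE : `|k| = (complex.Re `|k|)%:C.
  by have /ger0_Im := normr_ge0 k; case: `|k| => r s /= ->.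
by rewrite -lecR -kE; exact: normr_ge0.
Qed.

Lemma sec_star_lin k a b :
  sec_star (fun g => k *: a g + b g) = (fun g => (k^* )%R *: sec_star a g + sec_star b g).
Proof.
apply: functional_extensionality_dep => g.
by rewrite /sec_star fstar_antilinear.
Qed.

Lemma compact_sections_star a : N a -> N (sec_star a).
Proof.
elim/compact_sections_ind => [|k K e b eK Nb].
  rewrite (_ : sec_star _ = (fun=> 0)); first exact: compact_sections0.
  by apply: functional_extensionality_dep => g; rewrite /sec_star fstar0.
by rewrite sec_star_lin; exact: compact_sections_cons (elementary_star eK) Nb.
Qed.

Lemma conv0l b : col_finite b -> conv (fun=> 0) b = (fun=> 0).
Proof.
move=> bf; apply: functional_extensionality_dep => g; apply/eqP/negPn/negP.
by move=> /conv_neq0 /(_ bf)[h [? [_ ]]]; rewrite eqxx.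
Qed.

Lemma conv0r a : conv a (fun=> 0) = (fun=> 0).
Proof.
apply: functional_extensionality_dep => g; apply/eqP/negPn/negP.
by move=> /conv_neq0 /(_ (compact_sections_col_finite compact_sections0))[h [? [_ _]]]; rewrite eqxx.
Qed.

Lemma compact_sections_conv a b : N a -> N b -> N (conv a b).
Proof.
move=> Na Nb; have bf := compact_sections_col_finite Nb.
elim/compact_sections_ind: Na => [|k K e c eK Nc].
  by rewrite conv0l //; exact: compact_sections0.
rewrite (_ : conv _ _ = (fun g => k *: conv e b g + conv c b g)); last first.
  by apply: functional_extensionality_dep => g; exact: conv_linl.
apply: compact_sections_lin Nc => {c}.
(* The induction on [b] must carry [N b] along, because [conv_linr] asks for column-finite
   summands. *)
suff [_] : N b /\ N (conv e b) by exact.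
elim/compact_sections_ind: Nb {bf} => [|l L d c eL [Nc Nec]].
  by rewrite conv0r; split; exact: compact_sections0.
split; first exact: compact_sections_cons eL Nc.
rewrite (_ : conv _ _ = (fun g => l *: conv e d g + conv e c g)).
  exact: compact_sections_cons (elementary_conv eK eL) Nec.
apply: functional_extensionality_dep => g; apply: conv_linr.
  exact: elementary_col_finite eL.
exact: compact_sections_col_finite.
Qed.

End slice_sections.

(** * The reduced algebra *)

#[local] Existing Instance totally_filter.

Section approximable_sections.
Context (R : realType) (G : etaleGroupoid) (E : fellBundle R G).
Implicit Types (a b c d f : section E) (g h x : G) (L M : R).
Local Notation N := (@compact_sections R G E).
Local Notation sub a c := (fun g => a g - c g).
Local Notation add a c := (fun g => a g + c g).

Lemma Re_norm_ge0 (k : R[i]) : 0 <= complex.Re `|k|.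
Proof.
have kE : `|k| = (complex.Re `|k|)%:C.
  by have /ger0_Im := normr_ge0 k; case: `|k| => r s /= ->.
by rewrite -lecR -kE; exact: normr_ge0.
Qed.

Lemma section_eq a b : (forall g, a g = b g) -> a = b.
Proof. exact: functional_extensionality_dep. Qed.

Lemma op_boundB a b L M : op_bound a L -> op_bound b M -> op_bound (sub a b) (L + M).
Proof.
move=> aL bM; have := op_bound_lin (-1) bM aL.
rewrite normrN normr1 mul1r addrC; congr op_bound.
by apply: section_eq => g; rewrite scaleN1r addrC.
Qed.

Lemma op_boundD a b L M : op_bound a L -> op_bound b M -> op_bound (add a b) (L + M).
Proof.
move=> aL bM; have := op_bound_lin 1 aL bM.
rewrite normr1 mul1r; congr op_bound.
by apply: section_eq => g; rewrite scale1r.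
Qed.

Lemma op_bound_eps a M C :
  (forall e : R, 0 < e -> e <= 1 -> op_bound a (M + e * C)) -> op_bound a M.
Proof.
move=> aM f N' ff N0 fN x ux I gam hx inj; rewrite -subr_le0.
apply: (@le0_small _ _ (C * N')) => e e0 e1.
by have := aM e e0 e1 f N' ff N0 fN x ux I gam hx inj; lra.
Qed.

(** The closure of [N] without the conditions of [bounded_sections]: those turn out to be automatic,
    so this is membership in [reduced_sections] ([reducedP]). *)
Definition approximable a := forall e : R, 0 < e -> exists2 c, N c & op_bound (sub a c) e.

Lemma compact_approximable a : N a -> approximable a.
Proof.
move=> Na e e0; exists a => //; apply: op_bound_le (ltW e0) _.
apply: (@slice_op_bound _ _ _ set0) => //.
- by split=> ? ?; rewrite !inE.
- by move=> g; rewrite /supp /= subrr eqxx.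
- by move=> g; rewrite subrr rnorm0.
Qed.

Lemma approximable_lin k a b : approximable a -> approximable b ->
  approximable (fun g => k *: a g + b g).
Proof.
move=> aa ab e e0; set K := complex.Re `|k|; have K0 : 0 <= K := Re_norm_ge0 k.
have e1 : 0 < e / (2 * (K + 1)) by rewrite divr_gt0 // mulr_gt0 // ltr_wpDl.
have e2 : 0 < e / 2 by rewrite divr_gt0.
have [c Nc ac] := aa _ e1; have [d Nd bd] := ab _ e2.
exists (fun g => k *: c g + d g); first exact: compact_sections_lin.
rewrite (_ : (fun g => _) = (fun g => k *: (a g - c g) + (b g - d g))).
  apply: op_bound_le (op_bound_lin k ac bd); rewrite -/K.
  have : K * (e / (2 * (K + 1))) <= e / 2; last by lra.
  rewrite mulrA ler_pdivrMr ?mulr_gt0 ?ltr_wpDl //.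
  by have := ltW e0; nra.
by apply: section_eq => g; lmodule R.
Qed.

Lemma approximable_sub a b : approximable a -> approximable b -> approximable (sub a b).
Proof.
move=> aa ab; have := approximable_lin (-1) ab aa; congr approximable.
by apply: section_eq => g; rewrite scaleN1r addrC.
Qed.

Lemma approximable_bfinite a : approximable a -> bfinite a.
Proof.
move=> /(_ 1 ltr01)[c /compact_sections_bfinite[M M0 cM] ac].
exists (1 + M); first exact: addr_ge0.
have := op_boundD ac cM; congr op_bound.
by apply: section_eq => g; rewrite subrK.
Qed.

Lemma approx_bound a c M e : op_bound a M -> op_bound (sub a c) e -> op_bound c (M + e).
Proof.
move=> aM ac; have := op_boundB aM ac; congr op_bound.
by apply: section_eq => g; rewrite subKr.
Qed.

Lemma compact_star_bound c M : N c -> 0 <= M -> op_bound c M -> op_bound (sec_star c) M.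
Proof.
move=> Nc M0 cM; have Ns := compact_sections_star Nc.
have cf := compact_sections_col_finite Nc; have sf := compact_sections_col_finite Ns.
have cb := compact_sections_bfinite Nc; have sb := compact_sections_bfinite Ns.
apply: op_bound_le (bnorm_bound sb); rewrite (bnorm_star cf sf cb sb).
exact: bnorm_le.
Qed.

Lemma sec_starB a b : sec_star (sub a b) = sub (sec_star a) (sec_star b).
Proof. by apply: section_eq => g; rewrite /sec_star fstarD fstarN. Qed.

(** The involution is isometric on [N] by [bnorm_star]. As operator bounds dominate values,
    [sec_star a] is a pointwise limit of adjoints of approximants, and [op_bound_limit] applies. *)
Lemma approx_star_bound a M : 0 <= M -> approximable a -> op_bound a M ->
  op_bound (sec_star a) M.
Proof.
move=> M0 aa aM; apply: (@op_bound_eps _ _ 1) => e e0 _; rewrite mulr1.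
apply: op_bound_limit => S r r0.
have m0 : 0 < Num.min e r by rewrite lt_min e0.
have [c Nc ac] := aa _ m0; exists (sec_star c).
  apply: op_bound_le (compact_star_bound Nc _ (approx_bound aM ac)).
    by rewrite lerD2l ge_min lexx.
  by rewrite addr_ge0 // ltW.
move=> g _; have := op_bound_entry (ginv g) (ltW m0) ac.
rewrite /sec_star -fstarN -fstarD rnorm_fstar => /le_trans; apply.
by rewrite ge_min lexx orbT.
Qed.

Lemma approximable_star a : approximable a -> approximable (sec_star a).
Proof.
move=> aa e e0; have [c Nc ac] := aa e e0.
exists (sec_star c); first exact: compact_sections_star.
rewrite -sec_starB; apply: approx_star_bound => //; first exact: ltW.
exact: approximable_sub (compact_approximable Nc).
Qed.

Lemma compact_conv_defined c d g : N d ->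
  partial_sum (@conv_term R G E c d g) @ totally --> conv c d g.
Proof.
move=> /compact_sections_col_finite/(_ (gsrc g))[F [Fx Fd]].
have e (i : F) : gmul (quot g (val i)) (val i) = Some g.
  by apply: quotP; rewrite Fx // (valP i).
rewrite (conv_colE c e Fd); apply: conv_cvgE; first exact: val_inj.
by move=> h k hk _ dk; exists [` Fd k (esym (gmul_src hk)) dk]%fset.
Qed.

Lemma conv_term_split a b c d g (z : factorizations g) :
  conv_term a b z = conv_term (sub a c) b z + conv_term c (sub b d) z + conv_term c d z.
Proof. by rewrite /conv_term !(fmulDl, fmulDr, fmulNl, fmulNr); lmodule R. Qed.

Lemma partial_sumD (J : choiceType) (V : zmodType) (t u : J -> V) A :
  partial_sum (fun z => t z + u z) A = partial_sum t A + partial_sum u A.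
Proof. exact: big_split. Qed.

Lemma partial_sum_dist a b c d g L M e A :
  0 <= L -> 0 <= M -> 0 <= e ->
  op_bound b L -> op_bound c M -> op_bound (sub a c) e -> op_bound (sub b d) e ->
  rnorm (partial_sum (@conv_term R G E a b g) A - partial_sum (@conv_term R G E c d g) A)
    <= e * (L + M).
Proof.
move=> L0 M0 e0 bL cM ac bd.
have -> : @conv_term R G E a b g =
    (fun z => conv_term (sub a c) b z + conv_term c (sub b d) z + conv_term c d z).
  by apply/funext => z; exact: conv_term_split.
rewrite partial_sumD addrK partial_sumD; apply: le_trans (rnormD _ _) _.
have := op_bound_partial A e0 L0 ac bL; have := op_bound_partial A M0 e0 cM bd.
by lra.
Qed.

Lemma approx_pair a b e : approximable a -> approximable b -> 0 < e ->
  exists c d, [/\ N c, N d, op_bound (sub a c) e & op_bound (sub b d) e].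
Proof.
move=> aa ab e0; have [c Nc ac] := aa _ e0; have [d Nd bd] := ab _ e0.
by exists c, d.
Qed.

(** By [partial_sum_dist] the partial sums are uniformly close to those for approximants in [N],
    which converge; so they are Cauchy. *)
Lemma approx_conv_defined a b : approximable a -> approximable b -> conv_defined a b.
Proof.
move=> aa ab g; apply/cauchy_cvgP/cauchy_exP => -[r r'] /=.
rewrite ltcE /= => /andP[/eqP -> r0].
have [L L0 bL] := approximable_bfinite ab; have [M M0 aM] := approximable_bfinite aa.
pose e := Num.min 1 (r / 2 / (L + M + 2)).
have LM : 0 < L + M + 2 by rewrite addrC ltr_pwDl // addr_ge0.
have e0 : 0 < e by rewrite lt_min ltr01 !divr_gt0.
have [c [d [Nc Nd ac bd]]] := approx_pair aa ab e0.
have cM := approx_bound aM ac.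
have e1 : e <= 1 by rewrite ge_min lexx.
have eLM : e * (L + (M + e)) < r.
  have : e * (L + M + 2) <= r / 2 by rewrite -ler_pdivlMr // ge_min lexx orbT.
  by have := ltW e0; nra.
exists (conv c d g).
have /cvgrPdist_lt/(_ (r - e * (L + (M + e)))%:C) := @compact_conv_defined c d g Nd.
rewrite ltcR subr_gt0 => /(_ eLM).
apply: filterS => A; rewrite -ball_normE /= !rnormE !ltcR => cA.
apply: le_lt_trans (rnorm_tri (partial_sum (@conv_term R G E c d g) A) _ _) _.
rewrite (rnorm_distC (partial_sum (@conv_term R G E c d g) A)).
have Me : 0 <= M + e by rewrite addr_ge0 // ltW.
by have := partial_sum_dist A L0 Me (ltW e0) bL cM ac bd; lra.
Qed.

Lemma conv_defined_cvg a b g : conv_defined a b ->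
  partial_sum (@conv_term R G E a b g) @ totally --> conv a b g.
Proof. by move=> /(_ g). Qed.

Lemma rnorm_closed (V : normedModType R[i]) (J : choiceType) (u : {fset J} -> V)
    (l v : V) C :
  u @ totally --> l -> (forall A, rnorm (u A - v) <= C) -> rnorm (l - v) <= C.
Proof.
move=> ul uC; apply/ler_addgt0Pr => e e0.
have /cvgrPdist_lt/(_ e%:C) := ul; rewrite ltcR => /(_ e0)[A _ hA].
have := hA A (fsubset_refl A); rewrite /= rnormE ltcR => lA.
apply: le_trans (rnorm_tri (u A) _ _) _.
by have := uC A; lra.
Qed.

Lemma conv_cvg_lin k a b c g : conv_defined a c -> conv_defined b c ->
  conv (fun h => k *: a h + b h) c g = k *: conv a c g + conv b c g.
Proof.
move=> ac bc; apply: (@cvg_lim (E g) (@norm_hausdorff _ (E g)) _ _ totally_filter).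
rewrite (_ : partial_sum _ = (fun A => k *: partial_sum (@conv_term R G E a c g) A
    + partial_sum (@conv_term R G E b c g) A)).
  apply: cvgD; last exact: conv_defined_cvg.
  by apply: cvgZr; exact: conv_defined_cvg.
apply/funext => A; rewrite /partial_sum scaler_sumr -big_split; apply: eq_bigr => i _ /=.
by rewrite /conv_term fmul_linearl.
Qed.

Lemma conv_cvg_linr k a b c g : conv_defined a b -> conv_defined a c ->
  conv a (fun h => k *: b h + c h) g = k *: conv a b g + conv a c g.
Proof.
move=> ab ac; apply: (@cvg_lim (E g) (@norm_hausdorff _ (E g)) _ _ totally_filter).
rewrite (_ : partial_sum _ = (fun A => k *: partial_sum (@conv_term R G E a b g) A
    + partial_sum (@conv_term R G E a c g) A)).
  apply: cvgD; last exact: conv_defined_cvg.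
  by apply: cvgZr; exact: conv_defined_cvg.
apply/funext => A; rewrite /partial_sum scaler_sumr -big_split; apply: eq_bigr => i _ /=.
by rewrite /conv_term fmul_linearr.
Qed.

Lemma conv_split a b c d g : approximable a -> approximable b -> approximable c ->
  approximable d ->
  conv a b g - conv c d g = conv (sub a c) b g + conv c (sub b d) g.
Proof.
move=> aa ab ac ad.
have -> : conv (sub a c) b g = (-1) *: conv c b g + conv a b g.
  rewrite -conv_cvg_lin; [|exact: approx_conv_defined..].
  suff -> : sub a c = (fun h => -1 *: c h + a h) by [].
  by apply: section_eq => h; rewrite scaleN1r addrC.
have -> : conv c (sub b d) g = (-1) *: conv c d g + conv c b g.
  rewrite -conv_cvg_linr; [|exact: approx_conv_defined..].
  suff -> : sub b d = (fun h => -1 *: d h + b h) by [].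
  by apply: section_eq => h; rewrite scaleN1r addrC.
by lmodule R.
Qed.

Lemma conv_entry_bound a b L M g : 0 <= L -> 0 <= M -> conv_defined a b ->
  op_bound a L -> op_bound b M -> rnorm (conv a b g) <= L * M.
Proof.
move=> L0 M0 ab aL bM; rewrite -[conv a b g]subr0.
apply: (rnorm_closed (@conv_defined_cvg a b g ab)) => A; rewrite subr0.
exact: op_bound_partial.
Qed.

Lemma conv_dist a b c d L M e g : 0 <= L -> 0 <= M -> 0 <= e ->
  approximable a -> approximable b -> approximable c -> approximable d ->
  op_bound b L -> op_bound c M -> op_bound (sub a c) e -> op_bound (sub b d) e ->
  rnorm (conv a b g - conv c d g) <= e * (L + M).
Proof.
move=> L0 M0 e0 aa ab ac ad bL cM ace bde.
have acs := approximable_sub aa ac; have bds := approximable_sub ab ad.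
rewrite conv_split // mulrDr (mulrC e M); apply: le_trans (rnormD _ _) _; apply: lerD.
  by apply: conv_entry_bound => //; exact: approx_conv_defined.
by apply: conv_entry_bound => //; exact: approx_conv_defined.
Qed.

Lemma approx_conv_bound a b L M : 0 <= L -> 0 <= M -> approximable a -> approximable b ->
  op_bound a L -> op_bound b M -> op_bound (conv a b) (L * M).
Proof.
move=> L0 M0 aa ab aL bM; apply: (@op_bound_eps _ _ (L + M + 1)) => e e0 e1.
apply: op_bound_limit => S r r0.
have C0 : 0 < L + M + 1 by lra.
pose m := Num.min e (r / (L + M + 1)).
have m0 : 0 < m by rewrite lt_min e0 divr_gt0.
have me : m <= e by rewrite ge_min lexx.
have mr : m * (L + M + 1) <= r by rewrite -ler_pdivlMr // ge_min lexx orbT.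
have [c [d [Nc Nd ac bd]]] := approx_pair aa ab m0.
have cL := approx_bound aL ac; have dM := approx_bound bM bd.
have Lm : 0 <= L + m by lra.
have Mm : 0 <= M + m by lra.
exists (conv c d).
  apply: op_bound_le (op_bound_conv Mm (compact_sections_col_finite Nd) cL dM).
  by nra.
move=> g _; apply: le_trans (conv_dist g M0 Lm (ltW m0) aa ab _ _ bM cL ac bd) _;
  [exact: compact_approximable..|].
by nra.
Qed.

Lemma conv_dist_bound a b c d L M e : 0 <= L -> 0 <= M -> 0 <= e ->
  approximable a -> approximable b -> approximable c -> approximable d ->
  op_bound b L -> op_bound c M -> op_bound (sub a c) e -> op_bound (sub b d) e ->
  op_bound (sub (conv a b) (conv c d)) (e * (L + M)).
Proof.
move=> L0 M0 e0 aa ab ac ad bL cM ace bde.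
have acs := approximable_sub aa ac; have bds := approximable_sub ab ad.
have -> : sub (conv a b) (conv c d) = add (conv (sub a c) b) (conv c (sub b d)).
  by apply: section_eq => g; exact: conv_split.
rewrite mulrDr (mulrC e M); apply: op_boundD; exact: approx_conv_bound.
Qed.

Lemma approximable_conv a b : approximable a -> approximable b -> approximable (conv a b).
Proof.
move=> aa ab r r0.
have [L L0 bL] := approximable_bfinite ab; have [M M0 aM] := approximable_bfinite aa.
have C0 : 0 < L + M + 1 by lra.
pose e := Num.min 1 (r / (L + M + 1)).
have e0 : 0 < e by rewrite lt_min ltr01 divr_gt0.
have e1 : e <= 1 by rewrite ge_min lexx.
have er : e * (L + M + 1) <= r by rewrite -ler_pdivlMr // ge_min lexx orbT.
have [c [d [Nc Nd ac bd]]] := approx_pair aa ab e0.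
exists (conv c d); first exact: compact_sections_conv.
have Me : 0 <= M + e by lra.
apply: op_bound_le (conv_dist_bound L0 Me (ltW e0) aa ab _ _ bL (approx_bound aM ac) ac bd);
  [|exact: compact_approximable..].
by nra.
Qed.

End approximable_sections.

(** * Algebraic identities and the C*-identity in the limit *)

Section approximable_algebra.
Context (R : realType) (G : etaleGroupoid) (E : fellBundle R G).
Implicit Types (a b c d f : section E) (g h x : G) (L M : R).
Local Notation N := (@compact_sections R G E).
Local Notation sub a c := (fun g => a g - c g).

(** This is how identities are extended from [N]: both sides are compared, value by value, with the
    same expression in approximants. *)
Lemma sec_eq_small a b (C : R) :
  (forall g (e : R), 0 < e -> e <= 1 -> rnorm (a g - b g) <= e * C) -> a = b.
Proof.
move=> h; apply: section_eq => g; apply/eqP; rewrite -subr_eq0; apply/eqP.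
exact: (rnorm_eq_small (h g)).
Qed.

Lemma approx_star_dist a c (e : R) : 0 <= e -> approximable a -> approximable c ->
  op_bound (sub a c) e -> op_bound (sub (sec_star a) (sec_star c)) e.
Proof.
move=> e0 aa ca ac; rewrite -sec_starB.
exact: (approx_star_bound e0 (approximable_sub aa ca) ac).
Qed.

Lemma approx_conv_star a b : approximable a -> approximable b ->
  sec_star (conv a b) = conv (sec_star b) (sec_star a).
Proof.
move=> aa ab.
have [L L0 bL] := approximable_bfinite ab; have [M M0 aM] := approximable_bfinite aa.
apply: (@sec_eq_small _ _ (2 * (L + M + 1))) => g e e0 e1.
have [c [d [Nc Nd ac bd]]] := approx_pair aa ab e0.
have ca := compact_approximable Nc; have da := compact_approximable Nd.
have Me : 0 <= M + e by lra.
have Le : 0 <= L + e by lra.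
have e0' := ltW e0.
have h1 := conv_dist (ginv g) L0 Me e0' aa ab ca da bL (approx_bound aM ac) ac bd.
have as' := approximable_star aa; have bs' := approximable_star ab.
have cs' := approximable_star ca; have ds' := approximable_star da.
have sac := approx_star_dist e0' aa ca ac; have sbd := approx_star_dist e0' ab da bd.
have sM := approx_star_bound M0 aa aM; have sL := approx_star_bound L0 ab bL.
have h2 := conv_dist g M0 Le e0' bs' as' ds' cs' sM (approx_bound sL sbd) sbd sac.
rewrite -(conv_star c (compact_sections_col_finite Nd)) rnorm_distC in h2.
apply: le_trans (rnorm_tri (sec_star (conv c d) g) _ _) _.
have h3 : rnorm (sec_star (conv a b) g - sec_star (conv c d) g) <= e * (L + (M + e)).
  by rewrite /sec_star -fstarN -fstarD rnorm_fstar.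
by nra.
Qed.

Lemma approx_conv_assoc a b c : approximable a -> approximable b -> approximable c ->
  conv (conv a b) c = conv a (conv b c).
Proof.
move=> aa ab ac; have [L L0 aL] := approximable_bfinite aa.
have [M M0 bM] := approximable_bfinite ab; have [K K0 cK] := approximable_bfinite ac.
(* The constant is the sum of the bounds [h1] and [h2]. The factors [L + M + 2] and [M + K + 2]
   bound the errors of [conv a b] and [conv b c]; the other two bound the factors they are
   multiplied with, using [e <= 1]. *)
apply: (@sec_eq_small _ _ ((L + M + 2) * (K + (L + 1) * (M + 1)) + (M + K + 2) * (M * K + L + 1))) => g e e0 e1.
have [a' Na aa'] := aa _ e0; have [b' Nb bb'] := ab _ e0; have [c' Nc cc'] := ac _ e0.
have aa1 := compact_approximable Na; have ab1 := compact_approximable Nb.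
have ac1 := compact_approximable Nc.
have e0' := ltW e0.
have Le : 0 <= L + e by lra.
have Me : 0 <= M + e by lra.
have Ke : 0 <= K + e by lra.
have a'L := approx_bound aL aa'; have b'M := approx_bound bM bb'; have c'K := approx_bound cK cc'.
have dab := conv_dist_bound M0 Le e0' aa ab aa1 ab1 bM a'L aa' bb'.
have dbc := conv_dist_bound K0 Me e0' ab ac ab1 ac1 cK b'M bb' cc'.
pose e1' := e * (L + M + 2); pose e2' := e * (M + K + 2).
have e1'0 : 0 <= e1' by rewrite mulr_ge0 //; lra.
have e2'0 : 0 <= e2' by rewrite mulr_ge0 //; lra.
have {}dab : op_bound (sub (conv a b) (conv a' b')) e1'.
  by apply: op_bound_le dab; rewrite /e1' ler_wpM2l //; lra.
have {}dbc : op_bound (sub (conv b c) (conv b' c')) e2'.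
  by apply: op_bound_le dbc; rewrite /e2' ler_wpM2l //; lra.
have dc1 : op_bound (sub c c') e1'.
  by apply: op_bound_le cc'; rewrite /e1' ler_peMr //; lra.
have da2 : op_bound (sub a a') e2'.
  by apply: op_bound_le aa'; rewrite /e2' ler_peMr //; lra.
have ab'B := approx_conv_bound Le Me aa1 ab1 a'L b'M.
have bcB := approx_conv_bound M0 K0 ab ac bM cK.
have h1 := conv_dist g K0 (mulr_ge0 Le Me) e1'0 (approximable_conv aa ab) ac
  (approximable_conv aa1 ab1) ac1 cK ab'B dab dc1.
have h2 := conv_dist g (mulr_ge0 M0 K0) Le e2'0 aa (approximable_conv ab ac)
  aa1 (approximable_conv ab1 ac1) bcB a'L da2 dbc.
rewrite (conv_assoc a' (compact_sections_col_finite Nb) (compact_sections_col_finite Nc)) in h1.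
apply: le_trans (rnorm_tri (conv a' (conv b' c') g) _ _) _.
rewrite rnorm_distC in h2.
apply: (@le_trans _ _ (e1' * (K + (L + 1) * (M + 1)) + e2' * (M * K + L + 1))); last first.
  by rewrite /e1' /e2' le_eqVlt; apply/orP; left; apply/eqP; ring.
apply: lerD.
  apply: le_trans h1 _; rewrite ler_wpM2l // lerD2l ler_pM //; lra.
by apply: le_trans h2 _; rewrite ler_wpM2l //; lra.
Qed.

(** [op_bound_cstar] holds for an approximant [c] at distance [e], with [K' = K + e (2 n + e)] in
    place of [K], so [n <= e + sqrt K']. *)
Lemma approx_cstar a K : approximable a -> 0 <= K ->
  op_bound (conv (sec_star a) a) K -> bnorm a ^+ 2 <= K.
Proof.
move=> aa K0 aK; have ab := approximable_bfinite aa; have n0 := bnorm_ge0 a.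
have nb := bnorm_bound ab; set n := bnorm a in n0 nb *.
(* For [n > e], [(n - e)^2 <= K'] gives [n^2 - K <= 4 n e]; for [n <= e], [n^2 <= e n]. The constant
   [4 n + 3] covers both. *)
rewrite -subr_le0; apply: (@le0_small _ _ (4 * n + 3)) => e e0 e1.
have e0' := ltW e0; have [c Nc ac] := aa e e0.
have ca := compact_approximable Nc.
have as' := approximable_star aa; have cs' := approximable_star ca.
have ne : 0 <= n + e by lra.
have sac := approx_star_dist e0' aa ca ac.
have sn := approx_star_bound n0 aa nb.
have d := conv_dist_bound n0 ne e0' as' aa cs' ca nb (approx_bound sn sac) sac ac.
have cK := approx_bound aK d; set K' := K + _ in cK.
have K'0 : 0 <= K' by rewrite /K' addr_ge0 // mulr_ge0 //; lra.
have cb : op_bound c (Num.sqrt K').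
  have Ns := compact_sections_star Nc.
  apply: (op_bound_cstar (sqrtr_ge0 _) (compact_sections_col_finite Nc)
    (compact_sections_col_finite Ns)).
  by rewrite (sqr_sqrtr K'0).
have H : op_bound a (e + Num.sqrt K').
  have := op_boundD ac cb; congr op_bound.
  by apply: section_eq => g; rewrite subrK.
have nK : n <= e + Num.sqrt K' by apply: bnorm_le H; rewrite addr_ge0 ?sqrtr_ge0.
have s0 := sqrtr_ge0 K'; have s2 := sqr_sqrtr K'0.
have K'E : K' = K + e * (n + (n + e)) by [].
have [ne'|ne'] := leP n e.
  have : n ^+ 2 <= e * n by rewrite expr2 ler_wpM2r.
  by nra.
have : (n - e) ^+ 2 <= K' by rewrite -s2 ler_pXn2r ?nnegrE //; lra.
by rewrite K'E; nra.
Qed.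

Lemma reducedP a : reduced_sections a <-> approximable a.
Proof.
split=> [[_ ra] e e0|aa].
  have [c Nc ac] := ra e e0; exists c => //.
  by apply/(normbP _ (ltW e0)); exact: ltW.
have as' := approximable_star aa; split.
  split; first by apply/bfiniteP; exact: approximable_bfinite.
    exact: approx_conv_defined.
  exact: approx_conv_defined.
move=> e e0; have e2 : 0 < e / 2 by rewrite divr_gt0.
have [c Nc ac] := aa _ e2; exists c => //.
have /(normbP _ (ltW e2)) H := ac.
by apply: le_lt_trans H _; rewrite lte_fin; lra.
Qed.

End approximable_algebra.

(** * The Banach space of approximable sections and its C*-structure *)

Section reduced_type.
Context (R : realType) (G : etaleGroupoid) (E : fellBundle R G).

Record rsect := RSect { rval : section E ; rvalP : approximable rval }.

Lemma rsect_eq (u v : rsect) : (forall g, rval u g = rval v g) -> u = v.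
Proof.
case: u v => [a aP] [b bP] /= /section_eq ab; subst b.
by rewrite (Prop_irrelevance aP bP).
Qed.

HB.instance Definition _ := gen_eqMixin rsect.
HB.instance Definition _ := gen_choiceMixin rsect.

Definition rlin (k : R[i]) (u v : rsect) : rsect :=
  RSect (approximable_lin k (rvalP u) (rvalP v)).

Definition rzero : rsect := RSect (compact_approximable (compact_sections0 E)).

Definition radd (u v : rsect) := rlin 1 u v.
Definition ropp (u : rsect) := rlin (-1) u rzero.
Definition rscale (k : R[i]) (u : rsect) := rlin k u rzero.

Lemma raddE u v g : rval (radd u v) g = rval u g + rval v g.
Proof. by rewrite /= scale1r. Qed.

Lemma roppE u g : rval (ropp u) g = - rval u g.
Proof. by rewrite /= scaleN1r addr0. Qed.

Lemma rscaleE k u g : rval (rscale k u) g = k *: rval u g.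
Proof. by rewrite /= addr0. Qed.

Lemma raddA : associative radd.
Proof. by move=> u v w; apply: rsect_eq => g; rewrite !raddE addrA. Qed.

Lemma raddC : commutative radd.
Proof. by move=> u v; apply: rsect_eq => g; rewrite !raddE addrC. Qed.

Lemma radd0 : left_id rzero radd.
Proof. by move=> u; apply: rsect_eq => g; rewrite raddE add0r. Qed.

Lemma raddN : left_inverse rzero ropp radd.
Proof. by move=> u; apply: rsect_eq => g; rewrite raddE roppE addNr. Qed.

HB.instance Definition _ := GRing.isZmodule.Build rsect raddA raddC radd0 raddN.

Lemma rscaleA k l u : rscale k (rscale l u) = rscale (k * l) u.
Proof. by apply: rsect_eq => g; rewrite !rscaleE scalerA. Qed.

Lemma rscale1 : left_id 1 rscale.
Proof. by move=> u; apply: rsect_eq => g; rewrite rscaleE scale1r. Qed.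

Lemma rscaleDr : right_distributive rscale +%R.
Proof. by move=> k u v; apply: rsect_eq => g; rewrite !(raddE, rscaleE) scalerDr. Qed.

Lemma rscaleDl u : {morph rscale^~ u : k l / k + l}.
Proof. by move=> k l; apply: rsect_eq => g; rewrite !(raddE, rscaleE) scalerDl. Qed.

HB.instance Definition _ := GRing.Zmodule_isLmodule.Build R[i] rsect
  rscaleA rscale1 rscaleDr rscaleDl.

Lemma rsect_bfinite u : bfinite (rval u).
Proof. exact: approximable_bfinite (rvalP u). Qed.

Definition rsect_norm (u : rsect) : R[i] := (bnorm (rval u))%:C.

Lemma rsect_normD u v : rsect_norm (u + v) <= rsect_norm u + rsect_norm v.
Proof.
rewrite /rsect_norm -rmorphD lecR; apply: bnorm_le.
  by rewrite addr_ge0 ?bnorm_ge0.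
have := op_boundD (bnorm_bound (rsect_bfinite u)) (bnorm_bound (rsect_bfinite v)).
by congr op_bound; apply: section_eq => g; rewrite -raddE.
Qed.

Lemma bnormZ_le k u : bnorm (rval (k *: u)) <= complex.Re `|k| * bnorm (rval u).
Proof.
apply: bnorm_le; first by rewrite mulr_ge0 ?bnorm_ge0 // Re_norm_ge0.
have z : op_bound (rval rzero) 0.
  apply: (@slice_op_bound _ _ _ set0) => //.
  - by split=> ? ?; rewrite !inE.
  - by move=> g; rewrite /supp /= eqxx.
  - by move=> g; rewrite rnorm0.
by have := op_bound_lin k (bnorm_bound (rsect_bfinite u)) z; rewrite addr0.
Qed.

Lemma Re_norm (k : R[i]) : `|k| = (complex.Re `|k|)%:C.
Proof. by have /ger0_Im := normr_ge0 k; case: `|k| => r s /= ->. Qed.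

Lemma rsect_normZ k u : rsect_norm (k *: u) = `|k| * rsect_norm u.
Proof.
rewrite /rsect_norm Re_norm -rmorphM; congr (_%:C); apply/le_anti.
rewrite bnormZ_le andTb; have [->|k0] := eqVneq k 0.
  by rewrite normr0 mul0r bnorm_ge0.
have := bnormZ_le k^-1 (k *: u); rewrite scalerA mulVf // scale1r.
have kk : complex.Re `|k| * complex.Re `|k^-1| = 1.
  by apply: complexI; rewrite rmorphM /= -!Re_norm -normrM divff // normr1.
move=> /(ler_wpM2l (Re_norm_ge0 k)); rewrite mulrA kk mul1r //.
Qed.

Lemma rsect_norm0_eq0 u : rsect_norm u = 0 -> u = 0.
Proof.
move=> /(congr1 (@complex.Re R)) /= u0; apply: rsect_eq => g.
have := bnorm_entry g (rsect_bfinite u); rewrite u0 => ug.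
by apply/eqP; rewrite -rnorm_eq0 eq_le ug rnorm_ge0.
Qed.

HB.instance Definition _ := Lmodule_isNormed.Build R[i] rsect
  rsect_normD rsect_normZ rsect_norm0_eq0.

Lemma rsect_subE u v g : rval (u - v) g = rval u g - rval v g.
Proof. by rewrite raddE roppE. Qed.

Lemma rsect_dist u v : op_bound (fun g => rval u g - rval v g) (rnorm (u - v)).
Proof.
have := bnorm_bound (rsect_bfinite (u - v)); congr op_bound.
by apply: section_eq => g; rewrite rsect_subE.
Qed.

(** The norm dominates every value, so a Cauchy filter has a pointwise limit [a]. By
    [op_bound_limit] a norm estimate valid along the filter holds for [a], which makes [a]
    approximable and the convergence one in norm. *)
Lemma rsect_complete (F : set_system rsect) : ProperFilter F -> cauchy F -> cvg F.
Proof.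
move=> FF /cauchyP Fc.
have Fe (e : R) : 0 < e -> exists u : rsect, F [set v | rnorm (u - v) < e].
  move=> e0; have := Fc e%:C; rewrite ltcR => /(_ e0)[u uF]; exists u.
  by apply: filterS uF => v; rewrite -ball_normE /= rnormE ltcR.
have evc g : cvg ((fun u => rval u g) @ F).
  apply/cauchy_cvgP/cauchy_exP => -[e e'] /=; rewrite ltcE /= => /andP[/eqP -> e0].
  have [u uF] := Fe e e0; exists (rval u g); apply: filterS uF => v uv.
  rewrite -ball_normE /= rnormE ltcR -rsect_subE.
  exact: le_lt_trans (bnorm_entry g (rsect_bfinite _)) uv.
pose a : section E := fun g => lim ((fun u => rval u g) @ F).
have aF g (e : R) : 0 < e -> F [set v | rnorm (a g - rval v g) <= e].
  move=> e0; have /cvgrPdist_le/(_ e%:C) := evc g; rewrite ltcR => /(_ e0).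
  by apply: filterS => v; rewrite /= rnormE lecR.
have near u (e : R) : F [set v | rnorm (u - v) < e] -> op_bound (fun g => a g - rval u g) e.
  move=> uF; apply: op_bound_limit => S r r0.
  have FS : F [set v | forall g, g \in S -> rnorm (a g - rval v g) <= r].
    elim: S => [|g S IH]; first by apply: filterS filterT => v _ g.
    apply: filterS (filterI (aF g r r0) IH) => v [vg vS] h.
    by rewrite inE => /orP[/eqP ->//|/vS].
  have [v [vS uv]] := filter_ex (filterI FS uF).
  exists (fun g => rval v g - rval u g).
    by apply: op_bound_le (rsect_dist v u); rewrite rnorm_distC ltW.
  by move=> g gS /=; rewrite opprB addrA subrK; exact: vS.
have aP : approximable a.
  move=> e e0; have e2 : 0 < e / 2 by rewrite divr_gt0.
  have [u uF] := Fe _ e2; have [c Nc uc] := rvalP u e2.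
  exists c => //; have := op_boundD (near u _ uF) uc; rewrite -splitr; congr op_bound.
  by apply: section_eq => g; rewrite addrA subrK.
apply/cvg_ex; exists (RSect aP).
apply/cvgrPdist_lt => -[e e'] /=; rewrite ltcE /= => /andP[/eqP -> e0].
have e2 : 0 < e / 2 by rewrite divr_gt0.
have [u uF] := Fe _ e2; apply: filterS (uF) => v uv.
have uv' : rnorm (u - v) < e / 2 := uv.
rewrite rnormE ltcR; apply: le_lt_trans (rnorm_tri u _ _) _.
rewrite [e]splitr; apply: ler_ltD uv'.
apply: bnorm_le; first exact: ltW.
have := near u _ uF; congr op_bound.
by apply: section_eq => g; rewrite rsect_subE.
Qed.

HB.instance Definition _ := Uniform_isComplete.Build rsect rsect_complete.

End reduced_type.

Section reduced_algebra.
Context (R : realType) (G : etaleGroupoid) (E : fellBundle R G).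
Local Notation T := (rsect E).
Implicit Types (u v w : T).

Lemma rlinE (k : R[i]) u v :
  rval (k *: u + v) = (fun g => k *: rval u g + rval v g).
Proof. by apply: section_eq => g; rewrite raddE rscaleE. Qed.

Definition rmul u v : T := RSect (approximable_conv (rvalP u) (rvalP v)).

Definition rstar u : T := RSect (approximable_star (rvalP u)).

Lemma rvalM u v : rval (rmul u v) = conv (rval u) (rval v).
Proof. by []. Qed.

Lemma rval_star u : rval (rstar u) = sec_star (rval u).
Proof. by []. Qed.

Lemma rmulA : associative rmul.
Proof.
move=> u v w; apply: rsect_eq => g /=.
by rewrite (approx_conv_assoc (rvalP u) (rvalP v) (rvalP w)).
Qed.

Lemma rmul_linearl (k : R[i]) u v w : rmul (k *: u + v) w = k *: rmul u w + rmul v w.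
Proof.
apply: rsect_eq => g; rewrite !(rlinE, rvalM).
by apply: conv_cvg_lin; exact: approx_conv_defined (rvalP _) (rvalP _).
Qed.

Lemma rmul_linearr (k : R[i]) u v w : rmul u (k *: v + w) = k *: rmul u v + rmul u w.
Proof.
apply: rsect_eq => g; rewrite !(rlinE, rvalM).
by apply: conv_cvg_linr; exact: approx_conv_defined (rvalP _) (rvalP _).
Qed.

Lemma rstar_antilinear (k : R[i]) u v :
  rstar (k *: u + v) = (k^* )%R *: rstar u + rstar v.
Proof. by apply: rsect_eq => g; rewrite !(rlinE, rval_star) sec_star_lin. Qed.

Lemma rstarK : involutive rstar.
Proof. by move=> u; apply: rsect_eq => g /=; rewrite sec_starK. Qed.

Lemma rstarM u v : rstar (rmul u v) = rmul (rstar v) (rstar u).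
Proof.
by apply: rsect_eq => g /=; rewrite (approx_conv_star (rvalP u) (rvalP v)).
Qed.

Lemma rmul_bnorm u v : bnorm (rval (rmul u v)) <= bnorm (rval u) * bnorm (rval v).
Proof.
apply: bnorm_le; first by rewrite mulr_ge0 ?bnorm_ge0.
exact: (approx_conv_bound (bnorm_ge0 _) (bnorm_ge0 _) (rvalP u) (rvalP v)
  (bnorm_bound (rsect_bfinite u)) (bnorm_bound (rsect_bfinite v))).
Qed.

Lemma rmul_norm u v : `|rmul u v| <= `|u| * `|v|.
Proof. by rewrite !rnormE -rmorphM lecR; exact: rmul_bnorm. Qed.

Lemma rstar_bnorm u : bnorm (rval (rstar u)) = bnorm (rval u).
Proof.
have le w : bnorm (rval (rstar w)) <= bnorm (rval w).
  apply: bnorm_le; first exact: bnorm_ge0.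
  exact: (approx_star_bound (bnorm_ge0 _) (rvalP w) (bnorm_bound (rsect_bfinite w))).
have le' := le (rstar u); rewrite (rstarK u) in le'.
exact: (le_anti (introT andP (conj (le u) le'))).
Qed.

Lemma rstar_normC u : `|rmul (rstar u) u| = `|u| ^+ 2.
Proof.
rewrite !rnormE -rmorphXn; congr (_%:C); apply/le_anti/andP; split.
  by apply: le_trans (rmul_bnorm _ _) _; rewrite rstar_bnorm expr2.
exact: (approx_cstar (rvalP u) (bnorm_ge0 _) (bnorm_bound (rsect_bfinite (rmul (rstar u) u)))).
Qed.

Definition reduced_cstar : cstarAlgebra R :=
  @CstarAlgebra R T rmul rstar rmulA rmul_linearl rmul_linearr rstar_antilinear
    rstarK rstarM rmul_norm rstar_normC.

Definition reduced_algebra : reducedAlgebra E.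
Proof.
refine (@ReducedAlgebra R G E reduced_cstar (@rval R G E) _ _ _ _ _ _).
- by move=> u v uv; apply: rsect_eq => g; rewrite uv.
- apply/seteqP; split=> [_ [u _ <-]|a /reducedP aP]; first exact/reducedP/rvalP.
  by exists (RSect aP).
- by move=> k u v g; rewrite rlinE.
- by move=> u v; split=> //; exact: approx_conv_defined (rvalP u) (rvalP v).
- by [].
- by move=> u; rewrite (normbE (rsect_bfinite u)).
Defined.

End reduced_algebra.

(** * Functoriality *)

Section systems_and_norms.
Context (R : realType) (G : etaleGroupoid) (E : fellBundle R G).
Implicit Types (a b f : section E) (g h x : G) (M N : R).

Lemma hnorm_transport a (I : finType) (gam gam' : I -> G) x x'
    (hx : forall i, gsrc (gam i) = x) (hx' : forall i, gsrc (gam' i) = x') :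
  (forall i, gam i = gam' i) ->
  hnorm hx (fun i => a (gam i)) = hnorm hx' (fun i => a (gam' i)).
Proof.
move=> /funext gg; subst gam'; have [i _|noI] := pickP (@predT I).
  have xx : x = x' by rewrite -(hx i) -(hx' i).
  by subst x'; rewrite (Prop_irrelevance hx hx').
by rewrite /hnorm /hip !big_pred0 ?rnorm0 // => i; have := noI i.
Qed.

Lemma hip_fset a (I : finType) (gam : I -> G) x (hx : forall i, gsrc (gam i) = x) :
  injective gam -> exists F : {fset star_fibre x},
    hip hx (fun i => a (gam i)) (fun i => a (gam i)) = \sum_(z <- F) norm2_term a z /\
    forall z, (z \in F) <-> exists i, gam i = set_val z.
Proof.
move=> inj; pose j (i : I) : star_fibre x := @sub_elt G (star_fibre x) (gam i) (hx i).
have jinj : injective j by move=> i i' /(congr1 set_val)/inj.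
exists [fset j i | i in I]%fset; split.
  rewrite big_imfset /= => [|? ? _ _ /jinj//]; rewrite big_enum /=.
  by apply: eq_bigr => i _; rewrite /norm2_term /=; exact: fmul_irr.
move=> z; split=> [/imfsetP[i _ ->]|[i iz]]; first by exists i.
by apply/imfsetP; exists i => //; apply: val_inj.
Qed.

Lemma col_bound_support f (I : finType) (gam : I -> G) x (ux : gunit x)
    (hx : forall i, gsrc (gam i) = x) : injective gam ->
  (forall g, f g != 0 -> exists i, gam i = g) ->
  col_bound f (hnorm hx (fun i => f (gam i))).
Proof.
move=> inj cov y uy J delta hy dinj; have [xy|xy] := pselect (y = x); last first.
  rewrite /hnorm /hip big1 ?rnorm0 ?sqrtr0 ?sqrtr_ge0 // => j _.
  suff -> : f (delta j) = 0 by rewrite ip0l.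
  apply/eqP/negPn/negP => /cov[i ij]; apply: xy.
  by rewrite -(hy j) -ij hx.
subst y; have [F [FE FP]] := hip_fset f hx inj.
have [F' [FE' FP']] := hip_fset f hy dinj.
apply: ler_wsqrtr; rewrite FE FE'.
have t0 z : z \notin F -> norm2_term f z = 0.
  move=> zF; have [fz|fz] := eqVneq (f (set_val z)) 0.
    by rewrite /norm2_term fz fmul0r.
  by exfalso; move/negP: zF; apply; apply/FP; exact: cov.
have pos (H : {fset star_fibre x}) :
    @cpos R (unit_fibre E ux) (\sum_(z <- H) norm2_term f z).
  by apply: (@cpos_sum R (unit_fibre E ux)) => z _; exact: ip_pos.
have -> : \sum_(z <- F') norm2_term f z =
    \sum_(z <- [fset z in F | z \in F']%fset) norm2_term f z.
  symmetry; apply: big_fset_incl => [|z zF' zFF'].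
    by apply/fsubsetP => z; rewrite !inE /= => /andP[].
  by apply: t0; apply: contraNN zFF' => zF; rewrite !inE /= zF.
apply: (@cpos_rnorm_le R (unit_fibre E ux)); first exact: pos.
rewrite (big_fsetID _ (fun z => z \in F') F) /= addrC addrK; exact: pos.
Qed.

Lemma extend_section (I : finType) (gam : I -> G) (eta : forall i, E (gam i)) :
  injective gam ->
  exists2 f : section E, forall i, f (gam i) = eta i &
    forall g, f g != 0 -> exists i, gam i = g.
Proof.
move=> inj.
have H g : exists v : E g, (forall i (e : gam i = g), eq_rect _ (fun k => E k : Type) (eta i) _ e = v)
    /\ (v != 0 -> exists i, gam i = g).
  have [[i ig]|no] := pselect (exists i, gam i = g).
    subst g; exists (eta i); split; last by exists i.
    move=> i' e; have ii := inj _ _ e; subst i'.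
    by rewrite (Prop_irrelevance e erefl).
  exists 0; split; last by rewrite eqxx.
  by move=> i e; exfalso; apply: no; exists i.
exists (fun g => projT1 (cid (H g))).
  by move=> i; case: (cid (H (gam i))) => v [/= vP _]; rewrite -(vP i erefl).
by move=> g; case: (cid (H g)) => v [/= _].
Qed.

(** With its converse [mbound_op_bound], this expresses the operator norm by finite matrices: a
    column vector is read as a finitely supported section, on which convolution by [a] acts as the
    matrix. *)
Lemma op_bound_mbound a M (I : finType) (q : qsys G I) k : 0 <= M ->
  (forall k, injective (q^~ k)) -> op_bound a M ->
  mbound k (fun i j => a (q i j)) M.
Proof.
move=> M0 qinj aM eta; have [f fE fsup] := extend_section eta (qinj k).
have uk := quo_unit q k.
have fb := col_bound_support uk (fun i => quo_src q i k) (qinj k) fsup.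
have ff : finite_set (supp f).
  apply: (@sub_finite_set _ _ [set` [fset q i k | i in I]%fset]); last exact: finite_fset.
  by move=> g /= /fsup[i <-]; apply/imfsetP; exists i.
have := aM f _ ff (hnorm_ge0 _ _) fb _ uk I (q^~ k) (fun i => quo_src q i k) (qinj k).
rewrite (_ : hnorm _ (fun i => f (q i k)) = mnorm eta); last first.
  by apply: mnorm_ext => i; exact: fE.
congr (_ <= _); apply: mnorm_ext => i; rewrite (conv_sumE (quoM q i ^~ k)).
- by apply: eq_bigr => j _; rewrite fE.
- exact: qinj.
- by move=> h l _ _ /fsup[j jl]; exists j.
Qed.

Lemma mbound_op_bound b M : 0 <= M ->
  (forall (I : finType) (q : qsys G I), (forall k, injective (q^~ k)) ->
    forall k, mbound k (fun i j => b (q i j)) M) ->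
  op_bound b M.
Proof.
move=> M0 bM f N ff N0 fN x ux I gam hx inj.
have [F0 [F0x F0f]] := finite_supp_col ff x.
(* The unit [x] is included so that the column based at it, [q i k] with [k = x], consists of the
   elements of [F] themselves. *)
pose F := (x |` (F0 `|` [fset gam i | i in I]))%fset.
have Fx (i : F) : gsrc (val i) = x.
  have := valP i; rewrite !inE => /orP[/eqP ->|/orP[/F0x//|/imfsetP[j _ -> //]]].
  exact: ux.
have e (i j : F) : gmul (quot (val i) (val j)) (val j) = Some (val i).
  by apply: quotP; rewrite !Fx.
have qM (i j k : F) : gmul (quot (val i) (val j)) (quot (val j) (val k)) = Some (quot (val i) (val k)).
  have [l lP] : exists l, gmul (quot (val i) (val j)) (quot (val j) (val k)) = Some l.
    by apply: gmul_exists; rewrite (gmul_comp (e i j)) (gmul_rng (e j k)).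
  by rewrite lP; congr Some; apply/esym/quot_eq; apply: gmul_assoc' lP (e j k) (e i j).
pose q : qsys G F := QSys qM.
have qinj k : injective (q^~ k).
  by move=> i j /= ij; apply: val_inj; have := e i k; rewrite ij (e j k) => -[].
have xF : x \in F by rewrite !inE eqxx.
pose k : F := [` xF]%fset.
have qk (i : F) : q i k = val i by apply: quot_eq; exact: gmul_unitr.
have gF i : gam i \in F by rewrite !inE; apply/orP; right; apply/orP; right; apply/imfsetP; exists i.
pose u i : F := [` gF i]%fset.
have uinj : injective u by move=> i i' /(congr1 val)/inj.
have uk := quo_unit q k.
have := bM F q qinj k (fun i => f (q i k)).
have -> : mnorm (mapp (fun i j => b (q i j)) (fun i => f (q i k))) =
    hnorm (fun i => quo_src q i k) (fun i => conv b f (q i k)).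
  apply: mnorm_ext => i; rewrite (conv_sumE (quoM q i ^~ k)); [by []|exact: qinj|].
  move=> h l hl _ fl.
  have lF : l \in F.
    rewrite !inE F0f ?orbT // -(gmul_src hl) (quo_src q i k) qk //.
  by exists [` lF]%fset; rewrite qk.
have H := hnorm_sub uk (fun i => quo_src q i k) (fun i => conv b f (q i k)) uinj.
move=> H2; rewrite (@hnorm_transport _ I gam (fun i => q (u i) k) x (q k k) hx
  (fun i => quo_src q (u i) k)); last by move=> i; rewrite qk.
apply: le_trans H (le_trans H2 _); rewrite ler_wpM2l //.
exact: (fN _ uk F (q^~ k) (fun i => quo_src q i k) (qinj k)).
Qed.

End systems_and_norms.

Section block_matrices.
Context (R : realType) (G : etaleGroupoid) (E : fellBundle R G).
Context (I : finType) (q : qsys G I) (D : set G) (sD : is_subgroupoid D).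

(** Where the units [q i i] lie in [D], membership of [q i j] in [D] is an equivalence relation and
    this is the class of [k]. It is empty when [q k k] lies outside [D]. *)
Definition block (k : I) : pred I := fun i => `[< D (q i k) >].

Definition block_sys (k : I) : qsys G {i | block k i} :=
  @QSys G {i | block k i} (fun i j => q (val i) (val j))
    (fun i j l => quoM q (val i) (val j) (val l)).

(* A matrix supported in a subgroupoid is block diagonal. *)
Lemma mbound_block M (T : forall i j, E (q i j)) k : 0 <= M ->
  (forall i j, T i j != 0 -> D (q i j)) ->
  (forall k (j : {i | block k i}),
    @mbound R G E _ (block_sys k) j (fun i j => T (val i) (val j)) M) ->
  mbound k T M.
Proof.
move=> M0 TD TM; have [Dinv Dmul] := sD.
pose Q M (T : forall i j, E (q i j)) := (forall i j, T i j != 0 -> D (q i j)) /\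
  forall k (j : {i | block k i}),
    @mbound R G E _ (block_sys k) j (fun i j => T (val i) (val j)) M.
(* The blocks are not summed as orthogonal pieces. Bounds on blocks give bounds on entries and
   survive the passage to [T^* T], so [mbound_power] applies with the constant 1. *)
apply: (@mbound_power R G E I q Q 1 k _ _ M T M0 (conj TD TM)) => {M T M0 TD TM}.
  move=> M T M0 [TD TM]; split=> [i j|k' j eta].
    apply: contraPP => nD; apply/negP/negPn/eqP; rewrite /mmul /mapp big1 // => l _.
    have [l0|/TD Dli] := eqVneq (T l i) 0; first by rewrite /mstar l0 fstar0 fmul0l.
    have [l0|/TD Dlj] := eqVneq (T l j) 0; first by rewrite l0 fmul0r.
    by exfalso; apply: nD; apply: Dmul (quoM q i l j) => //; rewrite -(quo_inv q l i); exact: Dinv.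
  have := mbound_star_mul M0 (TM k' j) eta.
  congr (_ <= _); apply: mnorm_ext => i; apply: eq_bigr => l _; congr (fmul _ _ _).
  rewrite /mmul /mapp [RHS](bigID (block k')) /= [X in _ + X]big1 ?addr0; last first.
    move=> m /asboolPn nD; have [m0|/TD Dmi] := eqVneq (T m (val i)) 0.
      by rewrite /mstar m0 fstar0 fmul0l.
    exfalso; apply: nD; apply: Dmul Dmi _ (quoM q m (val i) k').
    by have /asboolP := valP i.
  rewrite (big_sub (block k')) /=; apply: eq_bigr => m _; congr (fmul _ _ _).
  exact: fstar_irr.
move=> M T i j M0 [TD TM]; rewrite mul1r.
have [->|/TD Dij] := eqVneq (T i j) 0; first by rewrite rnorm0.
have Djj : D (q j j).
  by apply: Dmul (quoM q j i j) => //; rewrite -(quo_inv q i j); exact: Dinv.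
have bi : block j i by apply/asboolP.
have bj : block j j by apply/asboolP.
exact: (@mbound_entry R G E _ (block_sys j) _ M (Sub i bi) (Sub j bj) M0 (TM j (Sub j bj))).
Qed.

End block_matrices.

(** * The map on sections induced by a morphism *)

Section fell_morphism.
Context (R : realType) (X X' : fellObject R) (f : fellMorphism X X').
Let G := fgpd X.
Let G' := fgpd X'.
Let D := fdom f.
Let H := sub_groupoid D.
Let phi := fphi f.
Let beta := fbeta f.
Implicit Types (a b c : section X) (M : R).

Definition fell_section a : section X' :=
  fibre_section beta (pullback_section phi a).

Lemma betaD (x : H) (u v : X (phi x)) : beta x (u + v) = beta x u + beta x v.
Proof. by have := bfun_linear beta 1 (u : pullback phi X x) v; rewrite !scale1r. Qed.

Lemma beta0 (x : H) : beta x (0 : X (phi x)) = 0.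
Proof. by apply: (addrI (beta x (0 : X (phi x)))); rewrite -betaD !addr0. Qed.

Lemma betaZ (x : H) k (u : X (phi x)) : beta x (k *: u) = k *: beta x u.
Proof.
by have := bfun_linear beta k (u : pullback phi X x) 0; rewrite addr0 beta0 addr0.
Qed.

Lemma beta_sum (x : H) (I : Type) (r : seq I) (P : pred I) (F : I -> X (phi x)) :
  beta x (\sum_(i <- r | P i) F i) = \sum_(i <- r | P i) beta x (F i).
Proof. by elim/big_rec2: _ => [|i y z _ <-]; rewrite ?beta0 ?betaD. Qed.

Lemma fell_sectionE a (g : G') (Dg : nset D g) :
  fell_section a g = beta (sub_elt Dg) (a (phi (sub_elt Dg))).
Proof.
rewrite /fell_section /fibre_section; case: pselect => // Dg'.
by rewrite (Prop_irrelevance Dg' Dg).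
Qed.

Lemma fell_section_out a (g : G') : ~ nset D g -> fell_section a g = 0.
Proof. by move=> nD; rewrite /fell_section /fibre_section; case: pselect. Qed.

Lemma fell_section_val a (x : H) :
  fell_section a (set_val x) = beta x (a (phi x)).
Proof.
case: x => g gD; have Dg : nset D g := set_mem gD.
rewrite [LHS](fell_sectionE a Dg) /sub_elt.
by rewrite (bool_irrelevance (mem_set Dg) gD).
Qed.

(* [beta] is continuous for the topology of the total space, which on a fibre is
   coarser than that of the norm. *)
Lemma beta_bounded (x : H) : exists2 K : R, 0 <= K &
  forall v : X (phi x), rnorm (beta x v) <= K * rnorm v.
Proof.
pose C := pullback phi X.
have nW : nbhs (tot (beta x (0 : C x)) : tspace X') [set b | tnorm b < 1].
  apply: open_nbhs_nbhs; split; first exact: (tnorm_usc (fell_banach X')).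
  by rewrite /= /tnorm /= beta0 rnorm0.
have nU := @bfun_continuous _ _ _ _ _ beta (tot (0 : C x)) _ nW.
(* [F] is the filter of norm neighbourhoods of zero in the fibre, pushed to the total space. The
   axiom [tnorm_cvg0] says that it converges to zero there, so norm balls fall into the given
   neighbourhood. *)
pose F : set_system (tspace C) := fun U => exists2 d : R, 0 < d &
  forall v : C x, rnorm v < d -> U (tot v).
have FF : Filter F.
  split; first by exists 1.
    move=> U V [d d0 Ud] [d' d0' Vd']; exists (Num.min d d'); first by rewrite lt_min d0.
    by move=> v; rewrite lt_min => /andP[/Ud ? /Vd' ?].
  by move=> U V UV [d d0 Ud]; exists d => // v /Ud /UV.
have [||d d0 dU] := @tnorm_cvg0 _ _ _ (fell_banach C) x F FF _ _ _ nU.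
- by move=> U /nbhs_singleton Ux; exists 1 => // v _.
- move=> U /nbhs_ballP[e /= e0 eU]; exists e => // v ve; apply: eU.
  by rewrite -ball_normE /= sub0r normrN ger0_norm // rnorm_ge0.
(* A nonzero [v] is rescaled to norm [d / 2], where its image has norm below 1. *)
exists (2 / d) => [|v]; first by rewrite divr_ge0 ?ltW.
have [->|v0] := eqVneq v 0; first by rewrite beta0 !rnorm0 mulr0.
have nv : 0 < rnorm v by rewrite lt_def rnorm_eq0 v0 rnorm_ge0.
have k0 : 0 < d / 2 / rnorm v by rewrite !divr_gt0.
have := dU ((d / 2 / rnorm v)%:C *: v : C x).
rewrite rnormZr (gtr0_norm k0) divfK ?gt_eqF // => /(_ _).
rewrite ltr_pdivrMr // ltr_pMr // ltr1n => /(_ isT).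
rewrite /tnorm /= betaZ rnormZr (gtr0_norm k0) mulrC.
rewrite -ltr_pdivlMr // mul1r => /ltW; congr (_ <= _).
by field; rewrite !gt_eqF.
Qed.

End fell_morphism.

Section fell_morphism_norm.
Context (R : realType) (X X' : fellObject R) (f : fellMorphism X X').
Let G := fgpd X.
Let G' := fgpd X'.
Let D := fdom f.
Let H := sub_groupoid D.
Let phi := fphi f.
Let beta := fbeta f.
Implicit Types (a b c : section X) (M : R).

Lemma phi_inj (x y : H) : gsrc x = gsrc y -> phi x = phi y -> x = y.
Proof.
move=> xy pxy; have ux : gunit (gsrc x) := gsrc_src x.
have e : phi (gsrc x) = gsrc (phi x) by exact: efun_src.
have [z [_ zU]] := efun_star ux e.
by rewrite -(zU x) // -(zU y).
Qed.

Section one_block.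
Context (J : finType) (q : qsys G' J) (Dq : forall i j, nset D (q i j)).
Let s i j : H := sub_elt (Dq i j).

Lemma s_mul i j k : gmul (s i j) (s j k) = Some (s i k).
Proof. by apply/sub_mulE; exact: quoM. Qed.

Definition pushed_sys : qsys G J := QSys (fun i j k => efun_mul phi (s_mul i j k)).

Lemma pushed_inj : (forall k, injective (q^~ k)) -> forall k, injective (pushed_sys^~ k).
Proof.
move=> qinj k i j ij; apply: (qinj k).
suff /(congr1 set_val) : s i k = s j k by [].
apply: phi_inj => //; apply: val_inj.
by change (gsrc (q i k) = gsrc (q j k)); rewrite !quo_src.
Qed.

(** Each entry has its own constant from [beta_bounded]; there are finitely many, so their sum
    serves for all. The class [Q] is stable because [beta] maps [m^* m] to [T^* T]. *)
Lemma mbound_beta (m : forall i j, X (pushed_sys i j)) M k : 0 <= M ->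
  (forall k, mbound k m M) ->
  @mbound R G' X' J q k (fun i j => beta (s i j) (m i j)) M.
Proof.
move=> M0 mM; have /choice[K KP] : forall p : J * J, exists K : R, 0 <= K /\
    forall v : X (pushed_sys p.1 p.2), rnorm (beta (s p.1 p.2) v) <= K * rnorm v.
  by move=> p; have [K K0 KP] := beta_bounded (s p.1 p.2); exists K.
(* All columns of [m] are bounded, not just the one based at [k]: [mbound_entry] reads the entry
   [(i, j)] off the column based at [j]. *)
pose Q M (T : forall i j, X' (q i j)) := exists m : forall i j, X (pushed_sys i j),
  (forall k, mbound k m M) /\ forall i j, T i j = beta (s i j) (m i j).
apply: (@mbound_power R G' X' J q Q (\sum_p K p) k) => //; last by exists m.
  move=> {M M0 m mM} M T M0 [m [mM TE]]; exists (mmul (mstar m) m); split.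
    by move=> l; exact: mbound_star_mul.
  move=> i l; rewrite /mmul /mapp beta_sum; apply: eq_bigr => j _.
  rewrite /mstar !TE.
  have e1 : ginv (s j i) = s i j by apply: val_inj; exact: (quo_inv q j i).
  rewrite (fstar_irr (quo_inv pushed_sys j i) (efun_invE phi e1)).
  rewrite -(bfun_star beta e1 (quo_inv q j i)).
  rewrite -(bfun_mul beta (s_mul i j l) (quoM q i j l)).
  by apply: (congr1 (beta (s i l))); exact: fmul_irr.
move=> {M M0 m mM} M T i j M0 [m [mM ->]].
have [K0 /(_ (m i j)) H1] := KP (i, j).
apply: le_trans H1 _; apply: ler_pM => //; first exact: rnorm_ge0.
  rewrite (bigD1 (i, j)) //= lerDl sumr_ge0 // => p _; by have [] := KP p.
exact: mbound_entry.
Qed.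

End one_block.

Lemma fell_section_bound a M : 0 <= M -> op_bound a M -> op_bound (fell_section f a) M.
Proof.
move=> M0 aM; apply: mbound_op_bound => // I q qinj k.
have sD := nset_subgpd D; have [Dinv Dmul] := sD.
apply: (mbound_block sD) => //.
  move=> i j; apply: contraPP => nD; apply/negP/negPn/eqP; exact: fell_section_out.
move=> {k} k j; have Dq (i i' : {i | block q D k i}) : nset D (block_sys q D k i i').
  have /asboolP Di := valP i; have /asboolP Di' := valP i'.
  apply: Dmul Di _ (quoM q (val i) k (val i')).
  by rewrite -(quo_inv q (val i') k); exact: Dinv.
have binj : forall l, injective ((block_sys q D k)^~ l).
  by move=> l i i' /= /qinj /val_inj.
have H1 := fun l => op_bound_mbound (k := l) M0 (pushed_inj (Dq := Dq) binj) aM.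
have := mbound_beta (Dq := Dq) (k := j) M0 H1; congr mbound.
apply: functional_extensionality_dep => i; apply: functional_extensionality_dep => i'.
exact: (esym (fell_section_val (f := f) a (sub_elt (Dq i i')))).
Qed.

Lemma fell_section_lin k a b :
  fell_section f (fun g => k *: a g + b g) =
  (fun g => k *: fell_section f a g + fell_section f b g).
Proof.
apply: section_eq => g; have [Dg|nD] := pselect (nset D g).
  by rewrite !(fell_sectionE _ Dg) betaD betaZ.
by rewrite !fell_section_out // scaler0 addr0.
Qed.

Lemma fell_section_star a : fell_section f (sec_star a) = sec_star (fell_section f a).
Proof.
apply: section_eq => g; have [Dinv _] := nset_subgpd D.
have [Dg|nD] := pselect (nset D g).
  pose x : H := sub_elt Dg.
  rewrite -[LHS]/(fell_section f (sec_star a) (set_val x)) fell_section_val.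
  rewrite (sec_starE a (efun_invE phi (ginvK x))) .
  rewrite -[RHS]/(sec_star (fell_section f a) (set_val x)).
  rewrite (@sec_starE _ _ _ (fell_section f a) (set_val (ginv x)) (set_val x) (ginvK g)).
  rewrite fell_section_val.
  exact: (@bfun_star _ _ _ _ _ beta (ginv x) x (ginvK x) (ginvK g)
    (a (phi (ginv x)) : pullback phi X (ginv x))).
rewrite fell_section_out // /sec_star fell_section_out ?fstar0 // => Dg.
by apply: nD; rewrite -[g]ginvK; exact: Dinv.
Qed.

(* Star-bijectivity makes the factorizations of [phi x] correspond to those of [x]. *)
Lemma fell_section_conv a b : col_finite b -> col_finite (fell_section f b) ->
  fell_section f (conv a b) = conv (fell_section f a) (fell_section f b).
Proof.
move=> bf fbf; have [Dinv Dmul] := nset_subgpd D.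
apply: section_eq => g; have [Dg|nD] := pselect (nset D g); last first.
  rewrite fell_section_out //; apply/esym/eqP/negPn/negP.
  move=> /conv_neq0 /(_ fbf)[h [l [hl fh fl]]]; apply: nD; apply: Dmul hl.
    by apply: contrapT => nD; move: fh; rewrite fell_section_out // eqxx.
  by apply: contrapT => nD; move: fl; rewrite fell_section_out // eqxx.
pose x : H := sub_elt Dg.
have [F [Fx Fb]] := bf (gsrc (phi x)).
have lift (i : F) : exists d : H, gsrc d = gsrc x /\ phi d = val i.
  have [d [dP _]] := @efun_star _ _ phi (gsrc x) (val i) (gsrc_src x)
    (etrans (efun_src phi x) (esym (Fx _ (valP i)))).
  by exists d.
have [d dP] := choice lift.
have d_src i : gsrc (d i) = gsrc x by case: (dP i).
have d_phi i : phi (d i) = val i by case: (dP i).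
have e i : gmul (quot x (d i)) (d i) = Some x by apply: quotP; rewrite d_src.
have dinj : injective d by move=> i i' ii; apply: val_inj; rewrite -!d_phi ii.
have e' i : gmul (set_val (quot x (d i))) (set_val (d i)) = Some (set_val x).
  by apply/sub_mulE; exact: e.
rewrite -[LHS]/(fell_section f (conv a b) (set_val x)) fell_section_val.
rewrite (conv_sumE (fun i => efun_mul phi (e i))); last 2 first.
- by move=> i i' /=; rewrite !d_phi => /val_inj.
- move=> h l hl _ bl.
  by exists [` Fb l (esym (gmul_src hl)) bl]%fset; rewrite d_phi.
rewrite -[RHS]/(conv (fell_section f a) (fell_section f b) (set_val x)).
rewrite (conv_sumE e'); last 2 first.
- by move=> i i' /val_inj/dinj.
- move=> h l hl _ fl.
  have Dl : nset D l by apply: contrapT => nD; move: fl; rewrite fell_section_out // eqxx.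
  pose y : H := sub_elt Dl.
  have yx : gsrc y = gsrc x by apply: val_inj; exact: (esym (gmul_src hl)).
  have by0 : b (phi y) != 0.
    by apply: contraNneq fl => b0; rewrite (fell_sectionE b Dl) b0 beta0.
  have yF : phi y \in F by apply: Fb => //; rewrite -!efun_src yx.
  exists [` yF]%fset; rewrite -[l]/(set_val y); congr set_val.
  by apply: phi_inj; rewrite ?d_src ?d_phi.
rewrite beta_sum; apply: eq_bigr => i _.
rewrite !fell_section_val -(bfun_mul beta (e i) (e' i)).
by [].
Qed.

End fell_morphism_norm.

(** * Preimages of bicompact sets and extension to the closure *)

Section fell_morphism_compact.
Context (R : realType) (X X' : fellObject R) (f : fellMorphism X X').
Let G := fgpd X.
Let G' := fgpd X'.
Let D := fdom f.
Let H := sub_groupoid D.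
Let phi : etaleMorphism H G := fphi f.
Let beta := fbeta f.
Implicit Types (a b c : section X) (K O : set G) (x y : H).

Definition pulled K : set G' := set_val @` (phi @^-1` K).

Lemma phi_rng x : phi (grng x) = grng (phi x).
Proof. by rewrite -gsrcV efun_src efun_inv gsrcV. Qed.

Lemma pulled_ginv K : pulled (@ginv G @` K) = @ginv G' @` pulled K.
Proof.
rewrite ginv_image; apply/seteqP; split=> [_ [x Kx <-]|_ [_ [x Kx <-] <-]].
  exists (set_val (ginv x)); last exact: ginvK.
  by exists (ginv x) => //=; rewrite efun_inv.
by exists (ginv x) => //=; rewrite efun_inv ginvK.
Qed.

Lemma pulled_slice O : slice O -> slice (pulled O).
Proof.
move=> sO; split=> g h; rewrite !inE => -[x Ox <-] [y Oy <-] e.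
  have xy : gsrc x = gsrc y by exact: val_inj.
  congr set_val; apply: phi_inj => //; apply: (slice_src sO Ox Oy).
  by rewrite -!efun_src xy.
have xy : grng x = grng y by exact: val_inj.
have pxy : phi x = phi y by apply: (slice_rng sO Ox Oy); rewrite -!phi_rng xy.
apply: (congr1 set_val); apply: (inv_inj (@ginvK H)); apply: phi_inj.
  by rewrite !gsrcV.
by rewrite !efun_inv pxy.
Qed.

Lemma pulled_open O : open O -> open (pulled O).
Proof.
move=> oO; apply: open_set_type; first exact: nset_open.
by move/continuousP: (@efun_continuous _ _ phi); apply.
Qed.

Lemma pulled_compact K : compact K -> compact (pulled K).
Proof.
move=> cK; apply: continuous_compact; last exact: efun_proper.
by apply: continuous_subspaceT; exact: set_val_continuous.
Qed.

(** The nontrivial inclusion is star-surjectivity: an element of [K] whose source is [phi x] lifts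
    to one with source [x]. *)
Lemma pulled_src K : @gsrc G' @` pulled K =
  (nset D `&` @gunit G') `&` pulled (@gsrc G @` K).
Proof.
apply/seteqP; split=> [_ [_ [x Kx <-] <-]|g [[_ ux] [x [k Kk kx] xg]]].
  split; first by split; [exact: (set_valP (gsrc x))|exact: gsrc_src].
  by exists (gsrc x) => //=; rewrite efun_src; exists (phi x).
have ux' : gunit x by apply: val_inj; rewrite -xg in ux.
have [d [[dx dk] _]] := efun_star ux' (esym kx).
exists (set_val d); first by exists d => //=; rewrite dk.
by rewrite -xg -dx.
Qed.

(** Niceness of the domain is used here. The set is compact, by properness of [phi], and closed
    among the units of the domain, being there the preimage of a closed set; niceness makes it
    closed among all units. *)
Lemma pulled_src_closed K : bicompact K -> closed_in (@gunit G') (@gsrc G' @` pulled K).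
Proof.
move=> [[[C cC KC] _] cK _]; apply: nset_closed.
  apply: continuous_compact (pulled_compact cK).
  by apply: continuous_subspaceT; exact: gsrc_continuous.
exists (~` pulled (~` C)).
  by apply: open_closedC; apply: pulled_open; exact: closed_openC.
rewrite pulled_src KC; apply/seteqP; split=> [g [Dg [x [_ Cx] xg]]|g [[Dg ug] nC]].
  split; first exact: Dg.
  by move=> [y nCy yg]; apply: nCy; rewrite (val_inj (etrans yg (esym xg))).
split=> //; exists (sub_elt Dg) => //; split.
  by apply: efun_unit; exact: val_inj.
by apply: contrapT => nCx; apply: nC; exists (sub_elt Dg).
Qed.

Lemma pulled_bicompact K : bicompact K -> bicompact (pulled K).
Proof.
move=> bK; have [_ cK [ O [oO sO KO]]] := bK; split.
- split; first exact: pulled_src_closed.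
  by rewrite -gsrc_ginv -pulled_ginv; apply: pulled_src_closed; exact: bicompact_ginv.
- exact: pulled_compact.
- exists (pulled O); split; [exact: pulled_open|exact: pulled_slice|].
  by move=> _ [x /KO Ox <-]; exists x.
Qed.

Lemma fell_section_elementary K a : elementary K a ->
  elementary (pulled K) (fell_section f a).
Proof.
move=> [bK [aK ca]]; split; first exact: pulled_bicompact.
split=> [g fg|_ [x Kx <-] W].
  have Dg : nset D g by apply: contrapT => nD; move: fg; rewrite /supp /= fell_section_out // eqxx.
  exists (sub_elt Dg) => //; apply: aK; apply: contraNneq fg => a0.
  by rewrite (fell_sectionE a Dg) a0 beta0.
rewrite fell_section_val => xW.
have /nbhs_pullback[A [B [xA aB AB]]] :=
  @bfun_continuous _ _ _ _ _ beta (tot (a (phi x) : pullback phi X x)) _ xW.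
have xB : nbhs x (phi @^-1` ((fun h => tot (a h) : tspace X) @^-1` B)).
  exact: (@efun_continuous _ _ phi x _ (ca _ Kx _ aB)).
have [V xV VU] := proj1 (@nbhs_set_type G' (nset D) x _) (filterI xA xB).
(* The domain is open, so continuity on it is continuity in the whole groupoid. *)
have xD : nbhs (set_val x) (nset D).
  by apply: open_nbhs_nbhs; split; [exact: nset_open|exact: set_valP].
apply: filterS (filterI xV xD) => g [Vg Dg] /=.
rewrite (fell_sectionE a Dg).
have [Ag Bg] := VU (sub_elt Dg) Vg.
exact: (AB (sub_elt Dg) (a (phi (sub_elt Dg))) Ag Bg).
Qed.

Lemma fell_section_compact a : @compact_sections R G X a ->
  @compact_sections R G' X' (fell_section f a).
Proof.
move: a; apply: compact_sections_ind => [|k K a b eK Nb].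
  have -> : fell_section f (fun=> 0) = (fun=> 0).
    apply: section_eq => g; have [Dg|nD] := pselect (nset D g).
      by rewrite (fell_sectionE _ Dg) beta0.
    by rewrite fell_section_out.
  exact: compact_sections0.
rewrite fell_section_lin; apply: compact_sections_lin => //.
exact: compact_sections_elementary (fell_section_elementary eK).
Qed.

Lemma fell_section_dist a c (e : R) : 0 <= e -> op_bound (fun g => a g - c g) e ->
  op_bound (fun g => fell_section f a g - fell_section f c g) e.
Proof.
move=> e0 /(fell_section_bound f e0); congr op_bound.
have -> : (fun g => a g - c g) = (fun g => (-1) *: c g + a g).
  by apply: section_eq => g; rewrite scaleN1r addrC.
by rewrite fell_section_lin; apply: section_eq => g; rewrite scaleN1r addrC.
Qed.

Lemma fell_section_approximable a : approximable a -> approximable (fell_section f a).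
Proof.
move=> aP e e0; have [c Nc ac] := aP e e0.
exists (fell_section f c); first exact: fell_section_compact.
exact: (fell_section_dist (ltW e0) ac).
Qed.

Lemma fell_section_approx_conv a b : approximable a -> approximable b ->
  fell_section f (conv a b) = conv (fell_section f a) (fell_section f b).
Proof.
move=> aa ab.
have [L L0 bL] := approximable_bfinite ab; have [M M0 aM] := approximable_bfinite aa.
apply: (@sec_eq_small _ _ _ _ _ (2 * (L + M + 1))) => g e e0 e1.
have [c [d [Nc Nd ac bd]]] := approx_pair aa ab e0.
have ca := compact_approximable Nc; have da := compact_approximable Nd.
have Me : 0 <= M + e by lra.
have e0' := ltW e0; have cM := approx_bound aM ac.
have h1 := fell_section_dist (mulr_ge0 e0' (addr_ge0 L0 Me))
  (conv_dist_bound L0 Me e0' aa ab ca da bL cM ac bd).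
have h2 := op_bound_entry g (mulr_ge0 e0' (addr_ge0 L0 Me)) h1.
have h3 := conv_dist g L0 Me e0' (fell_section_approximable aa)
  (fell_section_approximable ab) (fell_section_approximable ca)
  (fell_section_approximable da) (fell_section_bound f L0 bL)
  (fell_section_bound f Me cM) (fell_section_dist e0' ac) (fell_section_dist e0' bd).
rewrite -(fell_section_conv c (compact_sections_col_finite Nd)
  (compact_sections_col_finite (fell_section_compact Nd))) rnorm_distC in h3.
apply: le_trans (rnorm_tri (fell_section f (conv c d) g) _ _) _.
by nra.
Qed.

End fell_morphism_compact.

(** The induced map depends only on the underlying data of a morphism. In this form the equations of
    [fell_unit] and [fell_product], which are between data, can be rewritten without comparing
    proofs or transporting types. *)
Definition data_section (R : realType) (X X' : fellObject R) (d : fellData X X')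
    (a : section X) : section X' :=
  fun g => match pselect (ddom d g) with
           | left Dg => dbeta (x := sub_elt Dg) (a (dphi (sub_elt Dg)))
           | right _ => 0
           end.

Lemma fell_section_data (R : realType) (X X' : fellObject R) (f : fellMorphism X X') :
  fell_section f = data_section (fell_data f).
Proof. by []. Qed.

Lemma data_section_id (R : realType) (X : fellObject R) (a : section X) :
  data_section (id_data X) a = a.
Proof. by apply: section_eq => g; rewrite /data_section; case: pselect => // /(_ I). Qed.

Lemma data_section_comp (R : realType) (X X' X'' : fellObject R)
    (g : fellMorphism X' X'') (f : fellMorphism X X') (a : section X) :
  data_section (comp_data (fell_data g) (fell_data f)) a =
  fell_section g (fell_section f a).
Proof.
apply: section_eq => x; have [Dx|nDx] := pselect (nset (fdom g) x); last first.
  rewrite fell_section_out // /data_section; case: pselect => // Cx.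
  by exfalso; exact: nDx (comp_dom_fst Cx).
rewrite (fell_sectionE _ Dx) /data_section; case: pselect => [Cx|nCx].
  rewrite (Prop_irrelevance Dx (comp_dom_fst (set_valP (sub_elt Cx)))).
  apply: (congr1 (fbeta g (comp_fst (sub_elt Cx)))).
  exact: (esym (fell_sectionE (f := f) a (comp_dom_snd (sub_elt Cx)))).
rewrite fell_section_out ?beta0 // => Dfx; apply: nCx.
by exists Dx.
Qed.

Section reduced_hom.
Context (R : realType) (X X' : fellObject R) (f : fellMorphism X X').
Implicit Types u v : rsect X.

Definition rpush u : rsect X' := RSect (fell_section_approximable f (rvalP u)).

Lemma rpush_linear (k : R[i]) u v : rpush (k *: u + v) = k *: rpush u + rpush v.
Proof.
apply: rsect_eq => g; rewrite rlinE -[LHS]/(fell_section f (rval (k *: u + v)) g).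
by rewrite rlinE fell_section_lin.
Qed.

Lemma rpush_mul u v : rpush (rmul u v) = rmul (rpush u) (rpush v).
Proof.
apply: rsect_eq => g.
exact: (congr1 (@^~ g) (fell_section_approx_conv f (rvalP u) (rvalP v))).
Qed.

Lemma rpush_star u : rpush (rstar u) = rstar (rpush u).
Proof. by apply: rsect_eq => g; exact: (congr1 (@^~ g) (fell_section_star f (rval u))). Qed.

Definition reduced_hom : starHom (reduced_algebra X) (reduced_algebra X') :=
  @StarHom R (reduced_algebra X) (reduced_algebra X') rpush
    rpush_linear rpush_mul rpush_star.

End reduced_hom.

Theorem theorem4p9 (R : realType) :
  exists (Cr : forall X : fellObject R, reducedAlgebra X)
    (A : fellElement R -> cstarElement R),
    is_functor (@fell_unit R) (@fell_product R)
      (@cstar_unit R) (@cstar_product R) A /\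
    forall (X X' : fellObject R) (f : fellMorphism X X'),
      exists pi : starHom (Cr X) (Cr X'),
        A (FellElement f) = CstarElement pi /\
        forall a : Cr X,
          red_sec (pi a) =
          fibre_section (fbeta f) (pullback_section (fphi f) (red_sec a)).
Proof.
exists (fun X : fellObject R => reduced_algebra X), (fun e => CstarElement (reduced_hom (fell_mor e))).
split; last by move=> X X' f; exists (reduced_hom f).
split=> [_ [X u uE]|_ _ _ [X X' X'' g f h hE]]; constructor; apply/funext => a.
  apply: rsect_eq => g.
  rewrite -[LHS]/(fell_section u (rval a) g) fell_section_data uE.
  by rewrite data_section_id.
apply: rsect_eq => x.
rewrite -[LHS]/(fell_section h (rval a) x) fell_section_data hE.
by rewrite data_section_comp.
Qed.
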